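(* Let $d\in\mathbb{N}$, let the parameters satisfy the conditions in the context, and assume in addition that $2(b_j+\beta_j)>\beta_jd$ for $j=1,\dots,m$. Then the density $\varrho_H^d$ of the generalized Wright measure $\mu_\Psi^d$ on $\mathbb{R}^d$ is a Gaussian mixture: for $x\in\mathbb{R}^d$, $$\varrho_H^d(x)=\frac{1}{(2\pi)^{d/2}K}\,G_d\!\left(\frac{(x,x)}{2}\right)=\frac{1}{(2\pi)^{d/2}K}\int_0^\infty\frac{1}{\tau^{d/2}}\exp\!\left(-\frac{(x,x)}{2\tau}\right)H^{m,0}_{p,m}(\tau)\,\mathrm{d}\tau .$$
   Context: Parameters. $m,p\in\mathbb{N}_0=\{0,1,2,\dots\}$; $a_i\in\mathbb{R}$, $\alpha_i>0$, $a_i+\alpha_i>0$ for $i=1,\dots,p$; $b_j\in\mathbb{R}$, $\beta_j>0$, $b_j+\beta_j>0$ for $j=1,\dots,m$. Put $a^*:=\sum_{j=1}^m\beta_j-\sum_{i=1}^p\alpha_i$ and $\mu:=\sum_{j=1}^m b_j-\sum_{i=1}^p a_i+(p-m)/2$. It is assumed that either $a^*>0$, or $a^*=0$ and $\mu<-1$, and that the Fox-$H$ function $$H^{m,0}_{p,m}(\tau):=\frac{1}{2\pi\mathrm{i}}\int_{\gamma-\mathrm{i}\infty}^{\gamma+\mathrm{i}\infty}\frac{\prod_{j=1}^m\Gamma(b_j+\beta_js)}{\prod_{i=1}^p\Gamma(a_i+\alpha_is)}\,\tau^{-s}\,\mathrm{d}s,\qquad \tau>0,$$ is non-negative on $(0,\infty)$;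 here $\gamma\in(0,1)$ is such that all poles of the numerator lie to the left of the contour. Put $K:=\prod_{j=1}^m\Gamma(b_j+\beta_j)\big/\prod_{i=1}^p\Gamma(a_i+\alpha_i)$. $G_d$ denotes the Fox-$H$ function $H^{m+1,0}_{p,m+1}$ given by $$G_d(z)=\frac{1}{2\pi\mathrm{i}}\int_{\gamma-\mathrm{i}\infty}^{\gamma+\mathrm{i}\infty}\Gamma(s)\,\frac{\prod_{j=1}^m\Gamma(b_j+\beta_j(1-d/2)+\beta_js)}{\prod_{i=1}^p\Gamma(a_i+\alpha_i(1-d/2)+\alpha_is)}\,z^{-s}\,\mathrm{d}s,\qquad z>0,\ \gamma\in(0,1),$$ and at $z=0$ its value is understood as the limit $z\to0^+$. Generalized Wright function. $\Psi$ is formally the power series $\Psi(z)=\sum_{k\ge0}\frac{\prod_{j=1}^m\Gamma(b_j+\beta_j(k+1))}{\prod_{i=1}^p\Gamma(a_i+\alpha_i(k+1))}\frac{z^k}{k!}$ (entire if $a^*<1$); in general, for $z>0$, $\Psi(-z)=\frac{1}{2\pi\mathrm{i}}\int_{\gamma-\mathrm{i}\infty}^{\gamma+\mathrm{i}\infty}\Gamma(s)\frac{\prod_{j=1}^m\Gamma(b_j+\beta_j-\beta_js)}{\prod_{i=1}^p\Gamma(a_i+\alpha_i-\alpha_is)}z^{-s}\,\mathrm{d}s$ with $0<\gamma<\min\{1,\min_j(b_j+\beta_j)/\beta_j\}$, and $\Psi(0)=K$. The measure $\mu_\Psi^d$ is the unique probability measure on $\mathbb{R}^d$ with $\int_{\mathbb{R}^d}\mathrm{e}^{\mathrm{i}(y,x)}\,\mathrm{d}\mu_\Psi^d(x)=\frac1K\Psi\big(-\tfrac{(y,y)}{2}\big)$,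 $y\in\mathbb{R}^d$, where $(\cdot,\cdot)$ is the Euclidean inner product; $\varrho_H^d$ denotes its density with respect to Lebesgue measure. *)

(* Defs.v *)
From HB Require Import structures.
From mathcomp Require Import all_boot all_order all_algebra.
From mathcomp Require Import all_classical all_reals all_analysis.
From mathcomp Require Import complex.

Set Implicit Arguments.
Unset Strict Implicit.
Unset Printing Implicit Defensive.
Import Order.TTheory GRing.Theory Num.Theory.
Import numFieldNormedType.Exports.

Local Open Scope classical_set_scope.
Local Open Scope ring_scope.
Local Open Scope complex_scope.

(* R^d is realized as a tuple type, which carries the product sigma-algebra. *)
Notation Rtuple R d := (d.-tuple (measurableTypeR R)).

Section lebesgue_cons.
Context (R : realType) (n : nat).
Variable m : {sigma_finite_measure set (Rtuple R n) -> \bar R}.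

Let consT (z : measurableTypeR R * Rtuple R n) : Rtuple R n.+1 :=
  [tuple of z.1 :: z.2].

Definition lebesgue_cons : set (Rtuple R n.+1) -> \bar R :=
  pushforward (lebesgue_measure \x m)%E consT.

Let measurable_consT : measurable_fun setT consT.
Proof. by apply: measurable_cons. Qed.

Let lebesgue_cons0 : lebesgue_cons set0 = 0%E.
Proof. by rewrite /lebesgue_cons /pushforward preimage_set0 measure0. Qed.

Let lebesgue_cons_ge0 A : (0 <= lebesgue_cons A)%E.
Proof. exact: measure_ge0. Qed.

Let lebesgue_cons_sigma_additive : semi_sigma_additive lebesgue_cons.
Proof.
move=> F mF tF mUF; rewrite /lebesgue_cons /pushforward preimage_bigcup.
apply: measure_semi_sigma_additive.
- by move=> k; rewrite -[X in measurable X]setTI; exact: measurable_consT.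
- apply/trivIsetP => /= i j _ _ ij; rewrite -preimage_setI.
  by move/trivIsetP : tF => /(_ _ _ _ _ ij) ->//; rewrite preimage_set0.
- by rewrite -preimage_bigcup -[X in measurable X]setTI; exact: measurable_consT.
Qed.

HB.instance Definition _ := isMeasure.Build _ _ _ lebesgue_cons
  lebesgue_cons0 lebesgue_cons_ge0 lebesgue_cons_sigma_additive.

Let lebesgue_cons_sigma_finite : sigma_finite setT lebesgue_cons.
Proof.
have /sigma_finiteP[F [FT ndF Foo]] :=
  sigma_finiteT (@lebesgue_measure R : {sigma_finite_measure set _ -> \bar R}).
have /sigma_finiteP[G [GT ndG Goo]] := sigma_finiteT m.
pose g (t : Rtuple R n.+1) : measurableTypeR R * Rtuple R n :=
  (thead t, [tuple of behead t]).
have mg : measurable_fun setT g.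
  by apply: measurable_fun_pair; [exact: measurable_tnth|exact: measurable_behead].
have gK : cancel consT g.
  by case=> x t; rewrite /g /consT/=; congr pair; apply/val_inj.
exists (fun k => g @^-1` (F k `*` G k)).
  rewrite -preimage_bigcup; apply/esym; rewrite -subTset => t _ /=.
  have : [set: measurableTypeR R] (g t).1 by [].
  have : [set: Rtuple R n] (g t).2 by [].
  rewrite {1}GT {1}FT => -[k _ Gk] [l _ Fl]; exists (maxn k l) => //; split.
    by move: Fl; apply/subsetPset/ndF/leq_maxr.
  by move: Gk; apply/subsetPset/ndG/leq_maxl.
move=> k; have [mF Fk] := Foo k; have [mG Gk] := Goo k; split.
  by rewrite -[X in measurable X]setTI; apply: mg => //; exact: measurableX.
rewrite /lebesgue_cons /pushforward -comp_preimage.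
rewrite (_ : g \o consT = id); last by apply/funext => z /=; rewrite gK.
by rewrite preimage_id product_measure1E// lte_mul_pinfty// ge0_fin_numE.
Qed.

HB.instance Definition _ := Measure_isSigmaFinite.Build _ _ _ lebesgue_cons
  lebesgue_cons_sigma_finite.

End lebesgue_cons.

Fixpoint lebesgue_tuple (R : realType) (d : nat) :
    {sigma_finite_measure set (Rtuple R d) -> \bar R} :=
  match d with
  | 0 => \d_([tuple] : Rtuple R 0)
  | d'.+1 => lebesgue_cons (lebesgue_tuple R d')
  end.

Lemma lebesgue_tupleE (R : realType) (d : nat)
    (A : 'I_d -> set (measurableTypeR R)) :
  (forall i, measurable (A i)) ->
  lebesgue_tuple R d [set x | forall i, A i (tnth x i)] =
  (\prod_(i < d) lebesgue_measure (A i))%E.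
Proof.
elim: d A => [|d IH] A mA.
  rewrite big_ord0 /= diracE mem_set//=; by case.
rewrite big_ord_recl -IH//= /lebesgue_cons /pushforward.
rewrite -product_measure1E//; last first.
  rewrite (_ : [set _ | _] = \bigcap_(i in [set: 'I_d])
      ((fun x : Rtuple R d => tnth x i) @^-1` A (lift ord0 i))).
    apply: fin_bigcap_measurable => // i _; rewrite -[X in measurable X]setTI.
    exact: measurable_tnth.
  by apply/seteqP; split => x /=; [move=> h i _; exact: h|move=> h i; exact: h].
congr product_measure1; apply/seteqP; split => [[x t]/= h|[x t]/= [h0 h] i].
  split=> [|i]; first by have := h ord0; rewrite /= /tnth.
  by have := h (lift ord0 i); rewrite tnthS.
by case: (unliftP ord0 i) => [j|] ->//; rewrite tnthS.
Qed.

Definition dot (R : realType) (d : nat) (x y : Rtuple R d) : R :=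
  \sum_(i < d) (tnth x i : R) * (tnth y i : R).

Section complex_integral.
Context d (T : measurableType d) (R : realType).
Variables (mu : {measure set T -> \bar R}) (D : set T) (f : T -> R[i]).

Definition Cintegrable : Prop :=
  mu.-integrable D (fun x => (complex.Re (f x))%:E) /\
  mu.-integrable D (fun x => (complex.Im (f x))%:E).

Definition Cintegral : R[i] :=
  Rintegral mu D (fun x => complex.Re (f x)) +i*
  Rintegral mu D (fun x => complex.Im (f x)).

End complex_integral.

Section special_functions.
Context (R : realType).
Implicit Types (s z : R[i]).

Definition Cexp z : R[i] :=
  (expR (complex.Re z))%:C * (cos (complex.Im z) +i* sin (complex.Im z)).

(* x ^ s for x > 0 *)
Definition Cpow (x : R) s : R[i] := Cexp (s * (ln x)%:C).

Definition Euler_integral s : R[i] :=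
  Cintegral lebesgue_measure `]0, +oo[
    (fun t : R => Cpow t (s - 1) * (expR (- t))%:C).

(* For Re s <= 0, Gamma s = Gamma (s + n) / (s (s + 1) ... (s + n - 1)) with n
   the least natural number such that 0 < Re s + n.  At a pole s = - k the
   denominator vanishes, so that Gamma s = 0 and (Gamma s)^-1 = 0: the latter
   is the value there of the entire function 1 / Gamma. *)
Definition Gamma s : R[i] :=
  if 0 < complex.Re s then Euler_integral s
  else let n := (Num.truncn (- complex.Re s)).+1 in
       Euler_integral (s + n%:R) / \prod_(k < n) (s + k%:R).

(* (2 pi i)^-1 times the integral of f over the upward line Re s = c *)
Definition Mellin_Barnes (c : R) (f : R[i] -> R[i]) : R[i] :=
  ((2 * pi)%:C * 'i%C)^-1 *
  Cintegral lebesgue_measure setT (fun t : R => f (c +i* t) * 'i%C).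

Section Fox.
Context (p m : nat) (a alpha : 'I_p -> R) (b beta : 'I_m -> R).

Definition Gamma_quotient s : R[i] :=
  (\prod_(j < m) Gamma ((b j)%:C + (beta j)%:C * s)) /
  (\prod_(i < p) Gamma ((a i)%:C + (alpha i)%:C * s)).

(* The Fox function H^{m,0}_{p,m}, computed on the line Re s = c *)
Definition FoxH (c tau : R) : R[i] :=
  Mellin_Barnes c (fun s => Gamma_quotient s * Cpow tau (- s)).

End Fox.

Section Wright.
Context (p m : nat) (a alpha : 'I_p -> R) (b beta : 'I_m -> R).

Definition Wright_const : R[i] :=
  (\prod_(j < m) Gamma (b j + beta j)%:C) /
  (\prod_(i < p) Gamma (a i + alpha i)%:C).

(* The generalized Wright function Psi on ]-oo, 0], the only range on which it
   is given in general (the power series may diverge). *)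
Definition Wright (c z : R) : R[i] :=
  if z == 0 then Wright_const
  else Mellin_Barnes c (fun s => Gamma s *
    Gamma_quotient (fun i => a i + alpha i) (fun i => - alpha i)
                   (fun j => b j + beta j) (fun j => - beta j) s *
    Cpow (- z) (- s)).

(* The Fox function G_d = H^{m+1,0}_{p,m+1} for z > 0 *)
Definition FoxG_pos (d : nat) (c z : R) : R[i] :=
  Mellin_Barnes c (fun s => Gamma s *
    Gamma_quotient (fun i => a i + alpha i * (1 - d%:R / 2)) alpha
                   (fun j => b j + beta j * (1 - d%:R / 2)) beta s *
    Cpow z (- s)).

(* G_d on [0, +oo[; R[i] has a topology only through its alias R[i]^o *)
Definition FoxG (d : nat) (c z : R) : R[i] :=
  if z == 0 then lim ((FoxG_pos d c y : R[i]^o) @[y --> 0^'+])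
  else FoxG_pos d c z.

End Wright.

End special_functions.

Definition charfun (R : realType) (d : nat)
    (mu : {measure set (Rtuple R d) -> \bar R}) (y : Rtuple R d) : R[i] :=
  Cintegral mu setT (fun x => Cexp (0 +i* dot y x)).

Definition is_density (R : realType) (d : nat)
    (mu : {measure set (Rtuple R d) -> \bar R}) (rho : Rtuple R d -> R) : Prop :=
  [/\ measurable_fun setT rho,
      forall x, 0 <= rho x &
      forall A, measurable A ->
        mu A = (\int[lebesgue_tuple R d]_(x in A) (rho x)%:E)%E].

(* Main.v *)
Require Import Defs.
From HB Require Import structures.
From mathcomp Require Import all_boot all_order all_algebra.
From mathcomp Require Import all_classical all_reals all_analysis.
From mathcomp Require Import measurable_realfun complex.
From mathcomp Require Import ring lra.

(** Write [h] for the quotient of Gamma products and substitute [tau = exp u], so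
    that Mellin transforms become Laplace integrals over the real line and
    [F u = exp (c u) H (exp u)] is, up to [2 pi], the Fourier transform of
    [t |-> h (c + i t)].

    The Stirling bounds ([Euler_decays]) give [|Gamma (x + i y)|] the order of
    [(1 + y^2)^((x - 1/2)/2) exp (- pi |y| / 2)].  The exponents of the factors of
    [h] add up to expressions in [a_star] and [mu] ([Gamma_quotient_line]), and the
    assumption on these two numbers makes [h] integrable on the line
    ([decays_integrable]).  Since [F] is nonnegative, its integrability is
    automatic ([fourier_positive]), and Fourier inversion shows that the Mellin
    transform of [H] is [h] on the line [Re s = c].

    The other formulas need the Mellin transform of [H] on other lines
    ([fox_mellin]).  Instead of shifting a contour, positivity is used once more.
    Multiplying [h] by the Gamma functions [Gamma (a_i + N_i + alpha_i s)] cancels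
    its denominator and leaves a polynomial times a product of Gamma functions;
    by [w Gamma w = Gamma (w + 1)] this is a difference of transforms of two
    explicit finite measures [rho1] and [rho2] ([signed_poly]), while the factor
    itself is the transform of a measure [kappa].  So the convolution of [F du] and
    [kappa], plus [rho2], has the Fourier transform of [rho1], and is equal to
    [rho1] ([charfun_unique]).  The exponential moments of [rho1] then bound those
    of [F du], and the identity of transforms extends to every line on which all
    [b_j + beta_j Re s] are positive ([transform_extend]).

    Fubini and the Cahen-Mellin integral for [exp (- z)] now turn the contour
    integrals of [Psi] and [G_d] into integrals of [H] ([Mellin_Barnes_laplace]):
    with [tau = exp u],
      [K = int H], [Psi (- x) = int exp (- x tau) H (tau) dtau],
      [G_d z = int tau^(- d/2) exp (- z / tau) H (tau) dtau].
    The condition [beta_j d < 2 (b_j + beta_j)] makes the last integral finite at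
    [z = 0], whence the limit there.  Thus [(2 pi)^(- d/2) K^-1 G_d (|x|^2 / 2)] is
    the mixture, with weight [H (tau) / K], of the centred Gaussian densities of
    variance [tau]; integrating their characteristic functions
    [exp (- tau |y|^2 / 2)] yields [K^-1 Psi (- |y|^2 / 2)]
    ([mix_density_fourier]), and a finite measure on [R^d] is determined by its
    characteristic function ([charfun_unique]). *)
Set Implicit Arguments.
Unset Strict Implicit.
Unset Printing Implicit Defensive.
Import Order.TTheory GRing.Theory Num.Theory.
Import numFieldNormedType.Exports.
Import ComplexField.Normc.
Local Open Scope classical_set_scope.
Local Open Scope ring_scope.
Local Open Scope complex_scope.

(** * Complex exponentials and moduli *)
Section complex_basics.
Context {R : realType}.
Implicit Types z w : R[i].

Lemma CeqP z w : complex.Re z = complex.Re w -> complex.Im z = complex.Im w -> z = w.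
Proof. by case: z w => [a b] [c d] /= -> ->. Qed.

Lemma cReM z w : complex.Re (z * w) =
  complex.Re z * complex.Re w - complex.Im z * complex.Im w.
Proof. by case: z w => [a b] [c d]. Qed.

Lemma cImM z w : complex.Im (z * w) =
  complex.Re z * complex.Im w + complex.Im z * complex.Re w.
Proof. by case: z w => [a b] [c d]. Qed.

Lemma cReD z w : complex.Re (z + w) = complex.Re z + complex.Re w.
Proof. by case: z w => [a b] [c d]. Qed.

Lemma cImD z w : complex.Im (z + w) = complex.Im z + complex.Im w.
Proof. by case: z w => [a b] [c d]. Qed.

Lemma cReN z : complex.Re (- z) = - complex.Re z.
Proof. by case: z. Qed.

Lemma normc_sqr z : normc z ^+ 2 = complex.Re z ^+ 2 + complex.Im z ^+ 2.
Proof. by case: z => a b /=; rewrite sqr_sqrtr// addr_ge0// sqr_ge0. Qed.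

Lemma normc_ge0 z : 0 <= normc z.
Proof. by case: z => a b; exact: sqrtr_ge0. Qed.

Lemma normc_real (x : R) : normc x%:C = `|x|.
Proof. by rewrite /= expr0n addr0 sqrtr_sqr. Qed.

Lemma normc_gt0 z : (0 < normc z) = (z != 0).
Proof.
rewrite lt0r normc_ge0 andbT; congr (~~ _); apply/eqP/eqP => [/eq0_normc//|->].
exact: normc0.
Qed.

Lemma Re_le_normc z : `|complex.Re z| <= normc z.
Proof.
rewrite -ler_sqr ?nnegrE ?normr_ge0 ?normc_ge0// normc_sqr real_normK ?num_real//.
by rewrite lerDl sqr_ge0.
Qed.

Lemma Im_le_normc z : `|complex.Im z| <= normc z.
Proof.
rewrite -ler_sqr ?nnegrE ?normr_ge0 ?normc_ge0// normc_sqr real_normK ?num_real//.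
by rewrite lerDr sqr_ge0.
Qed.

Lemma normc_le_ReIm z : normc z <= `|complex.Re z| + `|complex.Im z|.
Proof.
rewrite -ler_sqr ?nnegrE ?addr_ge0 ?normr_ge0 ?normc_ge0// normc_sqr.
rewrite sqrrD !real_normK ?num_real// addrAC lerDl.
by rewrite mulrn_wge0// mulr_ge0.
Qed.

Lemma CexpD z w : Cexp (z + w) = Cexp z * Cexp w.
Proof.
case: z w => [a b] [c d]; rewrite /Cexp /= expRD cosD sinD.
apply: CeqP; rewrite ?(cReM, cImM)/=; ring.
Qed.

Lemma Cexp0 : Cexp 0 = 1 :> R[i].
Proof. by rewrite /Cexp/= expR0 cos0 sin0 mul1r. Qed.

Lemma ReCexp z : complex.Re (Cexp z) = expR (complex.Re z) * cos (complex.Im z).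
Proof. by rewrite /Cexp cReM/=; ring. Qed.

Lemma ImCexp z : complex.Im (Cexp z) = expR (complex.Re z) * sin (complex.Im z).
Proof. by rewrite /Cexp cImM/=; ring. Qed.

Lemma normc_Cexp z : normc (Cexp z) = expR (complex.Re z).
Proof.
apply/eqP; rewrite -(@eqrXn2 _ 2) ?normc_ge0 ?expR_ge0//.
by rewrite normc_sqr ReCexp ImCexp !exprMn -mulrDr cos2Dsin2 mulr1.
Qed.

Lemma Cexp_real (x : R) : Cexp x%:C = (expR x)%:C.
Proof. by rewrite /Cexp/= cos0 sin0 mulr1. Qed.

Lemma Cpow_exp (u : R) s : Cpow (expR u) s = Cexp (s * u%:C).
Proof. by rewrite /Cpow expRK. Qed.

Lemma ReCpow (x : R) s : 0 < x ->
  complex.Re (Cpow x s) = x `^ complex.Re s * cos (complex.Im s * ln x).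
Proof.
by move=> x0; rewrite ReCexp cReM cImM/= !mulr0 subr0 add0r /powR gt_eqF.
Qed.

Lemma ImCpow (x : R) s : 0 < x ->
  complex.Im (Cpow x s) = x `^ complex.Re s * sin (complex.Im s * ln x).
Proof.
by move=> x0; rewrite ImCexp cReM cImM/= !mulr0 subr0 add0r /powR gt_eqF.
Qed.

Lemma normc_Cpow (x : R) s : 0 < x -> normc (Cpow x s) = x `^ complex.Re s.
Proof. by move=> x0; rewrite normc_Cexp cReM/= mulr0 subr0 /powR gt_eqF. Qed.

End complex_basics.

(** * Integrals of complex functions *)
Section Cintegral_theory.
Context d (T : measurableType d) (R : realType).
Variables (mu : {measure set T -> \bar R}).
Implicit Types (D : set T) (f g : T -> R[i]).

Definition Cmeasurable D f :=
  measurable_fun D (fun x => complex.Re (f x)) /\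
  measurable_fun D (fun x => complex.Im (f x)).

Lemma CmeasurableM D f g : Cmeasurable D f -> Cmeasurable D g ->
  Cmeasurable D (fun x => f x * g x).
Proof.
move=> [f1 f2] [g1 g2]; split.
  under eq_fun do rewrite cReM.
  by apply: measurable_funB; apply: measurable_funM.
under eq_fun do rewrite cImM.
by apply: measurable_funD; apply: measurable_funM.
Qed.

Lemma Cmeasurable_real D (f : T -> R) : measurable_fun D f ->
  Cmeasurable D (fun x => (f x)%:C).
Proof. by move=> mf; split. Qed.

Lemma Cmeasurable_cst D (c : R[i]) : Cmeasurable D (fun=> c).
Proof. by split; exact: measurable_cst. Qed.

Lemma Cmeasurable_Cexp D f : Cmeasurable D f -> Cmeasurable D (fun x => Cexp (f x)).
Proof.
move=> [f1 f2]; have me : measurable_fun D (fun x => expR (complex.Re (f x))).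
  exact: measurableT_comp.
split.
  under eq_fun do rewrite ReCexp.
  apply: measurable_funM => //; apply: measurableT_comp => //.
  exact: continuous_measurable_fun (@continuous_cos R).
under eq_fun do rewrite ImCexp.
apply: measurable_funM => //; apply: measurableT_comp => //.
exact: continuous_measurable_fun (@continuous_sin R).
Qed.

Lemma Cmeasurable_normc D f : Cmeasurable D f ->
  measurable_fun D (fun x => normc (f x)).
Proof.
move=> [f1 f2].
have -> : (fun x => normc (f x)) =
    (fun x => (complex.Re (f x) ^+ 2 + complex.Im (f x) ^+ 2) `^ 2^-1).
  apply/funext => x; rewrite powR12_sqrt; first by case: (f x).
  by rewrite addr_ge0// sqr_ge0.
apply: (measurableT_comp (measurable_powR _)).
by apply: measurable_funD; exact: measurable_funX.
Qed.

Lemma Cintegrable_measurable D f : Cintegrable mu D f -> Cmeasurable D f.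
Proof. by move=> [/measurable_int/measurable_EFinP ? /measurable_int/measurable_EFinP ?]. Qed.

Lemma Cintegrable_le D f (g : T -> R) : measurable D -> Cmeasurable D f ->
  mu.-integrable D (EFin \o g) ->
  (forall x, D x -> normc (f x) <= g x) -> Cintegrable mu D f.
Proof.
move=> mD [f1 f2] ig fg; split.
  apply: (le_integrable mD _ _ ig); first exact/measurable_EFinP.
  move=> x Dx; rewrite /= lee_fin (le_trans (Re_le_normc _))//.
  by rewrite (le_trans (fg _ Dx))// ler_norm.
apply: (le_integrable mD _ _ ig); first exact/measurable_EFinP.
move=> x Dx; rewrite /= lee_fin (le_trans (Im_le_normc _))//.
by rewrite (le_trans (fg _ Dx))// ler_norm.
Qed.

Lemma Cintegrable_normc D f : measurable D -> Cintegrable mu D f ->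
  mu.-integrable D (EFin \o (fun x => normc (f x))).
Proof.
move=> mD If; have [mf1 mf2] := Cintegrable_measurable If; case: If => f1 f2.
have := integrableD mD (integrable_norm f1) (integrable_norm f2).
apply: le_integrable => //; first exact/measurable_EFinP/Cmeasurable_normc.
move=> x Dx /=; rewrite lee_fin ger0_norm ?normc_ge0// ger0_norm ?addr_ge0//.
exact: normc_le_ReIm.
Qed.

Lemma CintegrableM_bounded D f g (M : R) : measurable D -> Cintegrable mu D f ->
  Cmeasurable D g -> (forall x, D x -> normc (g x) <= M) ->
  Cintegrable mu D (fun x => f x * g x).
Proof.
move=> mD If mg gM.
apply: (@Cintegrable_le _ _ (fun x => M * normc (f x))) => //.
- by apply: CmeasurableM => //; exact: Cintegrable_measurable If.
- under [X in integrable _ _ X]eq_fun => x do rewrite /= EFinM.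
  by apply: integrableZl => //; exact: Cintegrable_normc.
- by move=> x Dx; rewrite normcM mulrC ler_wpM2r ?normc_ge0 ?gM.
Qed.

Lemma eq_Cintegral D f g : (forall x, D x -> f x = g x) ->
  Cintegral mu D f = Cintegral mu D g.
Proof.
move=> fg; rewrite /Cintegral; congr Complex; apply: eq_Rintegral => x /set_mem Dx;
  by rewrite fg.
Qed.

Lemma eq_Cintegrable D f g : measurable D -> (forall x, D x -> f x = g x) ->
  Cintegrable mu D f -> Cintegrable mu D g.
Proof.
move=> mD fg [f1 f2]; split; [move: f1|move: f2]; apply: eq_integrable => //;
  by move=> x /set_mem Dx; rewrite fg.
Qed.

Lemma CintegrableZ D f (c : R[i]) : measurable D -> Cintegrable mu D f ->
  Cintegrable mu D (fun x => c * f x).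
Proof.
move=> mD If.
apply: (@eq_Cintegrable _ (fun x => f x * c)) => //.
  by move=> x _; rewrite mulrC.
by apply: (CintegrableM_bounded (M := normc c)) => //; exact: Cmeasurable_cst.
Qed.

Lemma CintegralZ D f (c : R[i]) : measurable D -> Cintegrable mu D f ->
  Cintegral mu D (fun x => c * f x) = c * Cintegral mu D f.
Proof.
move=> mD [f1 f2]; have Z (r : R) (g : T -> R) : mu.-integrable D (EFin \o g) ->
    mu.-integrable D (EFin \o (fun x => r * g x)).
  by move=> ?; under [X in integrable _ _ X]eq_fun => x do rewrite /= EFinM; exact: integrableZl.
apply: CeqP; rewrite ?cReM ?cImM/= -!RintegralZl// -?RintegralB// -?RintegralD//; try exact: Z.
  by apply: eq_Rintegral => x _; rewrite cReM.
by apply: eq_Rintegral => x _; rewrite cImM.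
Qed.

Lemma Cintegral_real D (f : T -> R) :
  Cintegral mu D (fun x => (f x)%:C) = (Rintegral mu D f)%:C.
Proof.
apply: CeqP => //=; rewrite -[RHS](_ : Rintegral mu D (cst 0) = 0)//.
by rewrite /Rintegral integral0.
Qed.

Lemma Cintegrable_real D (f : T -> R) : mu.-integrable D (EFin \o f) ->
  Cintegrable mu D (fun x => (f x)%:C).
Proof. by move=> If; split => //=; exact: integrable0. Qed.

End Cintegral_theory.
Arguments CmeasurableM {d T R D f g}.

Section Cfubini.
Context d1 d2 (T1 : measurableType d1) (T2 : measurableType d2) (R : realType).
Variables (m1 : {sigma_finite_measure set T1 -> \bar R})
          (m2 : {sigma_finite_measure set T2 -> \bar R}).

Lemma Rfubini (f : T1 * T2 -> R) :
  (m1 \x m2)%E.-integrable setT (EFin \o f) ->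
  (forall x, m2.-integrable setT (EFin \o (fun y => f (x, y)))) ->
  (forall y, m1.-integrable setT (EFin \o (fun x => f (x, y)))) ->
  Rintegral m1 setT (fun x => Rintegral m2 setT (fun y => f (x, y))) =
  Rintegral m2 setT (fun y => Rintegral m1 setT (fun x => f (x, y))).
Proof.
move=> If I1 I2; rewrite /Rintegral; congr fine.
under eq_integral => x _.
  rewrite fineK; last by apply: (integrable_fin_num _ (I1 x)).
  over.
under [RHS]eq_integral => y _.
  rewrite fineK; last by apply: (integrable_fin_num _ (I2 y)).
  over.
exact: (Fubini If).
Qed.

Lemma Cfubini (f : T1 * T2 -> R[i]) :
  Cintegrable (m1 \x m2)%E setT f ->
  (forall x, Cintegrable m2 setT (fun y => f (x, y))) ->
  (forall y, Cintegrable m1 setT (fun x => f (x, y))) ->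
  Cintegral m1 setT (fun x => Cintegral m2 setT (fun y => f (x, y))) =
  Cintegral m2 setT (fun y => Cintegral m1 setT (fun x => f (x, y))).
Proof.
move=> [If1 If2] I1 I2; apply: CeqP => /=.
  apply: (@Rfubini (fun z => complex.Re (f z))) => //.
    by move=> x; have [] := I1 x.
  by move=> y; have [] := I2 y.
apply: (@Rfubini (fun z => complex.Im (f z))) => //.
  by move=> x; have [] := I1 x.
by move=> y; have [] := I2 y.
Qed.

Lemma Cmeasurable_fst (f : T1 -> R[i]) : Cmeasurable setT f ->
  Cmeasurable setT (fun z : T1 * T2 => f z.1).
Proof.
by move=> [m m']; split; [exact: (measurableT_comp m)|exact: (measurableT_comp m')].
Qed.

Lemma Cmeasurable_snd (f : T2 -> R[i]) : Cmeasurable setT f ->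
  Cmeasurable setT (fun z : T1 * T2 => f z.2).
Proof.
by move=> [m m']; split; [exact: (measurableT_comp m)|exact: (measurableT_comp m')].
Qed.

(** By Tonelli, the norm of [g1 * g2] integrates to the product of the two norms. *)
Lemma Cintegrable_prod (g1 : T1 -> R[i]) (g2 : T2 -> R[i]) (k : T1 * T2 -> R[i]) (M : R) :
  Cintegrable m1 setT g1 -> Cintegrable m2 setT g2 ->
  Cmeasurable setT k -> (forall z, normc (k z) <= M) ->
  Cintegrable (m1 \x m2)%E setT (fun z => g1 z.1 * g2 z.2 * k z).
Proof.
move=> I1 I2 mk kM; apply: (CintegrableM_bounded (M := M)) => //.
have mg1 := Cmeasurable_fst (Cintegrable_measurable I1).
have mg2 := Cmeasurable_snd (Cintegrable_measurable I2).
have mn := Cmeasurable_normc (CmeasurableM mg1 mg2).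
apply: (@Cintegrable_le _ _ _ _ _ _ (fun z => normc (g1 z.1 * g2 z.2))) => //.
  exact: CmeasurableM.
apply/integrable12ltyP; first exact/measurable_EFinP.
have J1 := Cintegrable_normc measurableT I1.
have J2 := Cintegrable_normc measurableT I2.
have fin1 := integrable_fin_num measurableT J1.
have fin2 := integrable_fin_num measurableT J2.
rewrite [X in (X < _)%E](_ : _ =
   ((\int[m1]_x (normc (g1 x))%:E) * (\int[m2]_y (normc (g2 y))%:E))%E); last first.
  rewrite -ge0_integralZr//; last 3 first.
  - exact/measurable_EFinP/Cmeasurable_normc/(Cintegrable_measurable I1).
  - by move=> x _; rewrite lee_fin normc_ge0.
  - by apply: integral_ge0 => y _; rewrite lee_fin normc_ge0.
  apply: eq_integral => x _.
  rewrite -ge0_integralZl//; last 3 first.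
  - exact/measurable_EFinP/Cmeasurable_normc/(Cintegrable_measurable I2).
  - by move=> y _; rewrite lee_fin normc_ge0.
  - by rewrite lee_fin normc_ge0.
  by apply: eq_integral => y _; rewrite /= ger0_norm ?normc_ge0// normcM EFinM.
by rewrite ltey_eq fin_numM.
Qed.

(** The form in which Fubini is used for oscillating kernels: the weights [g1] and
    [g2] carry the integrability, the kernel is merely bounded. *)
Lemma Cfubini_bounded (g1 : T1 -> R[i]) (g2 : T2 -> R[i]) (k : T1 * T2 -> R[i]) (M : R) :
  Cintegrable m1 setT g1 -> Cintegrable m2 setT g2 ->
  Cmeasurable setT k -> (forall z, normc (k z) <= M) ->
  Cintegral m1 setT (fun x => g1 x * Cintegral m2 setT (fun y => g2 y * k (x, y))) =
  Cintegral m2 setT (fun y => g2 y * Cintegral m1 setT (fun x => g1 x * k (x, y))).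
Proof.
move=> I1 I2 mk kM.
have mk1 x : Cmeasurable setT (fun y => k (x, y)).
  by case: mk => k1 k2; split; [exact: (measurableT_comp k1 (pair1_measurable x))|exact: (measurableT_comp k2 (pair1_measurable x))].
have mk2 y : Cmeasurable setT (fun x => k (x, y)).
  by case: mk => k1 k2; split; [exact: (measurableT_comp k1 (pair2_measurable y))|exact: (measurableT_comp k2 (pair2_measurable y))].
have J1 x : Cintegrable m2 setT (fun y => g2 y * k (x, y)).
  exact: (CintegrableM_bounded (M := M)).
have J2 y : Cintegrable m1 setT (fun x => g1 x * k (x, y)).
  exact: (CintegrableM_bounded (M := M)).
transitivity (Cintegral m1 setT (fun x => Cintegral m2 setT (fun y => g1 x * g2 y * k (x, y)))).
  apply: eq_Cintegral => x _; rewrite -CintegralZ//.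
  by apply: eq_Cintegral => y _; rewrite mulrA.
rewrite (@Cfubini (fun z => g1 z.1 * g2 z.2 * k z)).
- apply: eq_Cintegral => y _; rewrite -CintegralZ//.
  by apply: eq_Cintegral => x _ /=; rewrite mulrCA mulrA.
- exact: (Cintegrable_prod (M := M)).
- move=> x /=; apply: eq_Cintegrable (CintegrableZ (g1 x) measurableT (J1 x)) => //.
  by move=> y _; rewrite mulrA.
- move=> y /=; apply: eq_Cintegrable (CintegrableZ (g2 y) measurableT (J2 y)) => //.
  by move=> x _; rewrite mulrCA mulrA.
Qed.

End Cfubini.

(** * Dominated convergence and improper integrals *)
Section convergence.
Context d (T : measurableType d) (R : realType).
Variables (mu : {measure set T -> \bar R}) (D : set T) (mD : measurable D).

Lemma Rdominated (f_ : nat -> T -> R) (f g : T -> R) :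
  (forall n, measurable_fun D (f_ n)) -> measurable_fun D f ->
  (forall x, D x -> f_ n x @[n --> \oo] --> f x) ->
  mu.-integrable D (EFin \o g) ->
  (forall n x, D x -> `|f_ n x| <= g x) ->
  mu.-integrable D (EFin \o f) /\
  Rintegral mu D (f_ n) @[n --> \oo] --> Rintegral mu D f.
Proof.
move=> mf_ mf ff ig fg.
have [||||If _ cv] := @dominated_convergence _ _ _ mu D mD (fun n => EFin \o f_ n)
  (EFin \o f) (EFin \o g) _ _ _ ig.
- by move=> n; exact/measurable_EFinP.
- exact/measurable_EFinP.
- by apply: aeW => x Dx; apply: cvg_EFin; [exact: nearW|exact: ff].
- by apply: aeW => x n Dx; rewrite lee_fin; exact: fg.
split => //; apply: fine_cvg; rewrite fineK//.
exact: integrable_fin_num.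
Qed.

(** Fatou's lemma as a criterion of integrability for a nonnegative limit. *)
Lemma Rfatou (f_ : nat -> T -> R) (f : T -> R) (M : R) :
  (forall n, measurable_fun D (f_ n)) -> measurable_fun D f ->
  (forall n x, D x -> 0 <= f_ n x) ->
  (forall x, D x -> f_ n x @[n --> \oo] --> f x) ->
  (forall n, (\int[mu]_(x in D) (f_ n x)%:E <= M%:E)%E) ->
  mu.-integrable D (EFin \o f) /\ Rintegral mu D f <= M.
Proof.
move=> mf_ mf f0 ff fM.
have ff0 x : D x -> 0 <= f x.
  move=> Dx; rewrite -(cvg_lim _ (ff x Dx))//; apply: limr_ge.
    by apply/cvg_ex; exists (f x); exact: ff.
  by apply: nearW => n; exact: f0.
have le : (\int[mu]_(x in D) (f x)%:E <= M%:E)%E.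
  have := @fatou _ _ _ mu D mD (fun n => EFin \o f_ n)
    (fun n => (measurable_EFinP _ _).2 (mf_ n)) (fun n x Dx => f0 n x Dx).
  rewrite [X in (X <= _)%E -> _](_ : _ = (\int[mu]_(x in D) (f x)%:E)%E); last first.
    apply: eq_integral => x /set_mem Dx.
    have cx : (EFin \o f_^~ x) n @[n --> \oo] --> (f x)%:E.
      by apply: cvg_EFin; [exact: nearW|exact: ff].
    by rewrite (cvg_limn_einf_sup cx).
  move=> /le_trans; apply.
  rewrite limn_einf_lim; apply: lime_le; first exact: is_cvg_einfs.
  apply: nearW => n; apply: le_trans (fM n).
  by apply: ereal_inf_lbound; exists n => //=.
have If : mu.-integrable D (EFin \o f).
  apply/integrableP; split; first exact/measurable_EFinP.
  apply: le_lt_trans (ltry M); apply: le_trans le; rewrite le_eqVlt; apply/orP; left; apply/eqP.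
  by apply: eq_integral => x /set_mem Dx; rewrite /= ger0_norm ?ff0.
split => //; rewrite -lee_fin /Rintegral fineK//; exact: integrable_fin_num.
Qed.

End convergence.

Section improper_FTC.
Context (R : realType).
Notation mu := (@lebesgue_measure R).

Lemma Rintegral_FTC (F f : R -> R) (a b : R) : a < b ->
  (forall x, a <= x <= b -> is_derive x 1 F (f x)) ->
  (forall x, a <= x <= b -> {for x, continuous f}) ->
  (\int[mu]_(x in `[a, b]) (f x)%:E = (F b - F a)%:E)%E.
Proof.
move=> ab dF cf; rewrite EFinB; apply: continuous_FTC2 => //.
- apply: continuous_in_subspaceT => x; rewrite inE/= in_itv/=; exact: cf.
- have cF x : a <= x <= b -> {for x, continuous F}.
    by move=> /dF [dx _]; exact/differentiable_continuous/derivable1_diffP.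
  split.
  + by move=> x; rewrite in_itv/= => /andP[ax xb]; have [] := dF x; rewrite ?ltW.
  + by apply: cvg_at_right_filter; apply: cF; rewrite lexx ltW.
  + by apply: cvg_at_left_filter; apply: cF; rewrite lexx ltW.
- move=> x; rewrite in_itv/= => /andP[ax xb].
  by rewrite derive1E; have [|_ ->] := dF x; rewrite ?ltW.
Qed.

(** Improper integrals as limits of integrals over segments [[a n, b n]] that
    exhaust [D]. *)
Section exhaustion.
Variables (D : set R) (mD : measurable D) (a b : nat -> R) (f : R -> R).
Hypothesis abD : forall n x, a n <= x <= b n -> D x.
Hypothesis Dab : forall x, D x -> \forall n \near \oo, a n <= x <= b n.
Hypothesis mf : measurable_fun D f.

Let fn n : R -> R := f \_ `[a n, b n].

Let mfn n : measurable_fun D (fn n).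
Proof. by apply/measurable_restrict => //; apply: measurable_funS mf. Qed.

Let fn_cvg x : D x -> fn n x @[n --> \oo] --> f x.
Proof.
move=> Dx; apply: cvg_near_cst; near=> n; rewrite /fn patchE mem_set//= in_itv/=.
by near: n; exact: Dab.
Unshelve. all: end_near. Qed.

Let int_fn n : (\int[mu]_(x in D) (fn n x)%:E = \int[mu]_(x in `[a n, b n]) (f x)%:E)%E.
Proof.
have -> : (\int[mu]_(x in D) (fn n x)%:E = \int[mu]_(x in D) ((EFin \o f) \_ `[a n, b n]) x)%E.
  by apply: eq_integral => x _; rewrite restrict_EFin.
rewrite -integral_mkcondr; congr integral; apply/setIidPr => x/=.
by rewrite in_itv/=; exact: abD.
Qed.

Lemma Rintegral_exhaust : mu.-integrable D (EFin \o f) ->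
  Rintegral mu `[a n, b n] f @[n --> \oo] --> Rintegral mu D f.
Proof.
move=> If.
have [|_] := @Rdominated _ _ _ mu D mD fn f (fun x => `|f x|) mfn mf fn_cvg (integrable_norm If).
  by move=> n x Dx; rewrite /fn patchE; case: ifP => // _; rewrite normr0.
have -> // : (fun n => Rintegral mu D (fn n)) = (fun n => Rintegral mu `[a n, b n] f).
by apply/funext => n; rewrite /Rintegral int_fn.
Qed.

Lemma integrable_exhaust (M : R) : (forall x, D x -> 0 <= f x) ->
  (forall n, (\int[mu]_(x in `[a n, b n]) (f x)%:E <= M%:E)%E) -> mu.-integrable D (EFin \o f).
Proof.
move=> f0 FM; have [] := @Rfatou _ _ _ mu D mD fn f M mfn mf _ fn_cvg _ => //.
- by move=> n x Dx; rewrite /fn patchE; case: ifP => // _; exact: f0.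
- by move=> n; rewrite int_fn.
Qed.

Variable F : R -> R.
Hypothesis ab : forall n, a n < b n.
Hypothesis dF : forall x, D x -> is_derive x 1 F (f x).
Hypothesis cf : forall x, D x -> {for x, continuous f}.

Let FTC n := @Rintegral_FTC F f (a n) (b n) (ab n)
  (fun x h => dF (abD h)) (fun x h => cf (abD h)).

Lemma improper_FTC (l : R) : mu.-integrable D (EFin \o f) ->
  F (b n) - F (a n) @[n --> \oo] --> l -> Rintegral mu D f = l.
Proof.
move=> If; apply: cvg_unique => //.
rewrite (_ : (fun n => _) = (fun n => Rintegral mu `[a n, b n] f)).
  exact: Rintegral_exhaust.
by apply/funext => n; rewrite /Rintegral FTC.
Qed.

Lemma improper_FTC_integrable (M : R) : (forall x, D x -> 0 <= f x) ->
  (forall n, F (b n) - F (a n) <= M) -> mu.-integrable D (EFin \o f).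
Proof.
by move=> f0 FM; apply: (@integrable_exhaust M) => // n; rewrite FTC lee_fin.
Qed.

End exhaustion.

(** The bound makes [F] vanish at both infinities. *)
Lemma improper_FTC_R (F f : R -> R) (C : R) :
  (forall x : R, is_derive x 1 F (f x)) -> continuous f ->
  (forall x, `|F x| * (1 + `|x|) <= C) ->
  mu.-integrable setT (EFin \o f) -> Rintegral mu setT f = 0.
Proof.
move=> dF cf F0 If.
apply: (@improper_FTC setT measurableT (fun n => - n.+1%:R) (fun n => n.+1%:R) f _ _ _ F) => //.
- move=> x _; near=> n; rewrite -ler_norml.
  near: n; exists (Num.truncn `|x|) => // n /= xn.
  rewrite ltW// (lt_le_trans (truncnS_gt _))// ler_nat//.
- exact: continuous_measurable_fun.
- by move=> n; rewrite gtrN.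
- by move=> x _; exact: cf.
- have H : C *+ 2 * harmonic n @[n --> \oo] --> C *+ 2 * 0.
    by apply: cvgM; [exact: cvg_cst|exact: cvg_harmonic].
  rewrite mulr0 in H; apply/norm_cvg0P; apply: squeeze_cvgr (cvg_cst _) H.
  apply: nearW => n; rewrite normr_ge0/= (le_trans (ler_normB _ _))// mulrnAl mulr2n.
  have n0 : 0 <= n.+1%:R :> R by [].
  by apply: lerD; rewrite /harmonic/= ler_pdivlMr//; apply: le_trans (F0 _);
    apply: ler_wpM2l => //; rewrite ?normrN ger0_norm// lerDr.
Unshelve. all: end_near. Qed.

Lemma itv0y_exhaust (x : R) : 0 < x ->
  \forall n \near \oo, (n.+2%:R)^-1 <= x <= n.+2%:R.
Proof.
move=> x0; near=> n; apply/andP; split.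
  rewrite -[leRHS]invrK lef_pV2 ?posrE ?invr_gt0//.
  near: n; exists (Num.truncn x^-1) => // n /= xn.
  by rewrite ltW// (lt_le_trans (truncnS_gt _))// ler_nat ltnW.
near: n; exists (Num.truncn x) => // n /= xn.
by rewrite ltW// (lt_le_trans (truncnS_gt _))// ler_nat ltnW.
Unshelve. all: end_near. Qed.

Let inv_lt n : (n.+2%:R)^-1 < n.+2%:R :> R.
Proof.
by rewrite (@lt_le_trans _ _ 1)// ?invf_lt1 ?ltr1n// ler1n.
Qed.

Let inv_sub n (x : R) : (n.+2%:R)^-1 <= x <= n.+2%:R -> x \in `]0, +oo[.
Proof. by move=> /andP[h _]; rewrite in_itv/= andbT (lt_le_trans _ h). Qed.

Lemma measurable_0y (f : R -> R) :
  (forall x, 0 < x -> {for x, continuous f}) -> measurable_fun (`]0, +oo[ : set (measurableTypeR R)) f.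
Proof.
move=> cf; apply: open_continuous_measurable_fun; first exact: interval_open.
by move=> x; rewrite inE/= in_itv/= andbT => /cf.
Qed.

Lemma improper_FTC_0y (F f : R -> R) (l : R) :
  (forall x : R, 0 < x -> is_derive x 1 F (f x)) ->
  (forall x, 0 < x -> {for x, continuous f}) ->
  (F n.+2%:R - F (n.+2%:R)^-1 @[n --> \oo] --> l) ->
  mu.-integrable `]0, +oo[ (EFin \o f) -> Rintegral mu `]0, +oo[ f = l.
Proof.
move=> dF cf F0 If.
have i0 (x : R) : `]0, +oo[%classic x -> 0 < x by rewrite /= in_itv/= andbT.
apply: (@improper_FTC _ _ (fun n => (n.+2%:R)^-1) (fun n => n.+2%:R) f _ _ _ F) => //.
- by move=> x /i0; exact: itv0y_exhaust.
- exact: measurable_0y.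
- by move=> x /i0; exact: dF.
- by move=> x /i0; exact: cf.
Qed.

Lemma improper_FTC_0y_integrable (F f : R -> R) (M : R) :
  (forall x : R, 0 < x -> is_derive x 1 F (f x)) ->
  (forall x, 0 < x -> {for x, continuous f}) ->
  (forall x, 0 < x -> 0 <= f x) ->
  (forall x, 0 < x -> 0 <= F x <= M) ->
  mu.-integrable `]0, +oo[ (EFin \o f).
Proof.
move=> dF cf f0 FM.
have i0 (x : R) : `]0, +oo[%classic x -> 0 < x by rewrite /= in_itv/= andbT.
apply: (@improper_FTC_integrable _ _ (fun n => (n.+2%:R)^-1) (fun n => n.+2%:R) f _ _ _ F _ _ _ M) => //.
- by move=> x /i0; exact: itv0y_exhaust.
- exact: measurable_0y.
- by move=> x /i0; exact: dF.
- by move=> x /i0; exact: cf.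
- by move=> x /i0; exact: f0.
- move=> n; have /andP[_ h1] := FM n.+2%:R (ltr0Sn _ _).
  have /andP[h2 _] : 0 <= F (n.+2%:R)^-1 <= M by apply: FM; rewrite invr_gt0.
  by rewrite lerBlDr (le_trans h1)// lerDl.
Qed.

(** The substitution [t = exp u] from [0 < t] to the real line, obtained on
    segments and extended by exhaustion. *)
Section exp_substitution.
Variable f : R -> R.
Hypothesis cf : forall t, 0 < t -> {for t, continuous f}.

Let h u := f (expR u) * expR u.

Let ch : continuous h.
Proof.
move=> u; apply: cvgM; last exact: continuous_expR.
apply: (@continuous_comp _ _ _ (@expR R) f); first exact: continuous_expR.
by apply: cf; exact: expR_gt0.
Qed.

Let subst (n : nat) : (\int[mu]_(t in `[expR (- n.+1%:R)%R, expR n.+1%:R%R]) (f t)%:E =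
  \int[mu]_(u in `[(- n.+1%:R)%R, n.+1%:R%R]) (h u)%:E)%E.
Proof.
have n0 : - n.+1%:R <= n.+1%:R :> R by have := ler0n R n.+1; lra.
have dE : derive1 (@expR R) = @expR R by apply/funext => x; rewrite derive1E derive_val.
rewrite (@integration_by_substitution_increasing R expR f)//.
- by apply: eq_integral => u _; rewrite fctE /= dE.
- by move=> x y _ _; rewrite ltr_expR.
- by move=> x _; rewrite dE; exact: continuous_expR.
- by rewrite dE; apply/cvg_ex; exists (expR (- n.+1%:R)); apply: cvg_at_right_filter; exact: continuous_expR.
- by rewrite dE; apply/cvg_ex; exists (expR n.+1%:R); apply: cvg_at_left_filter; exact: continuous_expR.
- split; first by move=> x _; exact: derivable_expR.
    by apply: cvg_at_right_filter; exact: continuous_expR.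
  by apply: cvg_at_left_filter; exact: continuous_expR.
- apply: continuous_in_subspaceT => t; rewrite inE/= in_itv/= => /andP[t0 _].
  by apply: cf; rewrite (lt_le_trans _ t0)// expR_gt0.
Qed.

Let D0 : set (measurableTypeR R) := `]0, +oo[%classic.

Let exh1 n t : expR (- n.+1%:R) <= t <= expR n.+1%:R -> D0 t.
Proof. by move=> /andP[h1 _]; rewrite /D0/= in_itv/= andbT (lt_le_trans _ h1)// expR_gt0. Qed.

Let exhR (u : R) : \forall n \near \oo, - n.+1%:R <= u <= n.+1%:R.
Proof.
near=> n; rewrite -ler_norml; near: n; exists (Num.truncn `|u|) => // n /= xn.
by rewrite ltW// (lt_le_trans (truncnS_gt _))// ler_nat.
Unshelve. all: end_near. Qed.

Let exh2 t : D0 t -> \forall n \near \oo, expR (- n.+1%:R) <= t <= expR n.+1%:R.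
Proof.
rewrite /D0/= in_itv/= andbT => t0; near=> n.
rewrite -[t]lnK ?posrE// !ler_expR; near: n; exact: exhR.
Unshelve. all: end_near. Qed.

Let mf : measurable_fun D0 f. Proof. exact: measurable_0y. Qed.
Let mh : measurable_fun setT h. Proof. exact: continuous_measurable_fun. Qed.
Let mD0 : measurable D0. Proof. exact: measurable_itv. Qed.

Lemma Rintegral_exp : mu.-integrable D0 (EFin \o f) -> mu.-integrable setT (EFin \o h) ->
  Rintegral mu D0 f = Rintegral mu setT h.
Proof.
move=> If Ih.
have h1 := Rintegral_exhaust mD0 exh1 exh2 mf If.
have h2 := Rintegral_exhaust measurableT (fun _ _ _ => I) (fun u _ => exhR u) mh Ih.
have E : (fun n => Rintegral mu `[- n.+1%:R, n.+1%:R] h) =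
    (fun n => Rintegral mu `[expR (- n.+1%:R), expR n.+1%:R] f).
  by apply/funext => n; rewrite /Rintegral subst.
by rewrite E in h2; exact: (cvg_unique _ h1 h2).
Qed.

Hypothesis f0 : forall t, 0 < t -> 0 <= f t.

Lemma integrable_exp : mu.-integrable D0 (EFin \o f) -> mu.-integrable setT (EFin \o h).
Proof.
move=> If; apply: (integrable_exhaust measurableT (fun _ _ _ => I) (fun u _ => exhR u) mh (M := Rintegral mu D0 f)).
  by move=> u _; rewrite mulr_ge0 ?expR_ge0// f0// expR_gt0.
move=> n; rewrite -subst /Rintegral fineK; last exact: (integrable_fin_num mD0 If).
apply: ge0_subset_integral => //.
- by apply/measurable_EFinP.
- by move=> t; rewrite /D0/= in_itv/= andbT => t0; rewrite lee_fin f0.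
- by move=> t; rewrite /= in_itv/= => /exh1.
Qed.

Lemma integrable_ln : mu.-integrable setT (EFin \o h) -> mu.-integrable D0 (EFin \o f).
Proof.
move=> Ih; apply: (integrable_exhaust mD0 exh1 exh2 mf (M := Rintegral mu setT h)).
  by move=> t; rewrite /D0/= in_itv/= andbT; exact: f0.
move=> n; rewrite subst /Rintegral fineK; last exact: (integrable_fin_num measurableT Ih).
apply: ge0_subset_integral => //.
- by apply/measurable_EFinP.
- by move=> u _; rewrite lee_fin mulr_ge0 ?expR_ge0// f0// expR_gt0.
Qed.

End exp_substitution.

End improper_FTC.

(** * Derivatives of elementary functions *)
Section derivation_rules.
Context {R : realType}.
Implicit Types (f g : R -> R) (x a b : R).

Lemma d_cst (c x : R) : is_derive x 1 (fun _ : R => c) 0.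
Proof. exact: is_derive_cst. Qed.

Lemma d_id x : is_derive x 1 (fun t : R => t) 1.
Proof. exact: is_derive_id. Qed.

Lemma d_add f g x a b : is_derive x 1 f a -> is_derive x 1 g b ->
  is_derive x 1 (fun t => f t + g t) (a + b).
Proof. exact: is_deriveD. Qed.

Lemma d_opp f x a : is_derive x 1 f a -> is_derive x 1 (fun t => - f t) (- a).
Proof. exact: is_deriveN. Qed.

Lemma d_mul f g x a b : is_derive x 1 f a -> is_derive x 1 g b ->
  is_derive x 1 (fun t => f t * g t) (f x * b + g x * a).
Proof. exact: is_deriveM. Qed.

Lemma d_comp f g x a b : is_derive x 1 g a -> is_derive (g x) 1 f b ->
  is_derive x 1 (fun t => f (g t)) (b * a).
Proof. by move=> dg df; exact: is_derive1_comp. Qed.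

Lemma d_exp g x a : is_derive x 1 g a -> is_derive x 1 (fun t => expR (g t)) (expR (g x) * a).
Proof. by move=> dg; apply: d_comp. Qed.

Lemma d_cos g x a : is_derive x 1 g a -> is_derive x 1 (fun t => cos (g t)) (- sin (g x) * a).
Proof. by move=> dg; apply: d_comp. Qed.

Lemma d_sin g x a : is_derive x 1 g a -> is_derive x 1 (fun t => sin (g t)) (cos (g x) * a).
Proof. by move=> dg; apply: d_comp. Qed.

Lemma d_atan g x a : is_derive x 1 g a ->
  is_derive x 1 (fun t => atan (g t)) ((1 + g x ^+ 2)^-1 * a).
Proof. by move=> dg; apply: (@d_comp atan). Qed.

Lemma d_ln g x a : 0 < g x -> is_derive x 1 g a ->
  is_derive x 1 (fun t => ln (g t)) ((g x)^-1 * a).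
Proof. by move=> g0 dg; apply: (@d_comp (@ln R)) => //; exact: is_derive1_ln. Qed.

Lemma d_powR c g x a : 0 < g x -> is_derive x 1 g a ->
  is_derive x 1 (fun t => g t `^ c) (c * g x `^ (c - 1) * a).
Proof. by move=> g0 dg; apply: (@d_comp (fun t => t `^ c)) => //; exact: is_derive1_powR. Qed.

Lemma d_sqr g x a : is_derive x 1 g a ->
  is_derive x 1 (fun t => g t ^+ 2) (2 * g x * a).
Proof.
move=> dg; have -> : (fun t => g t ^+ 2) = (fun t => g t * g t) by apply/funext.
by have -> : 2 * g x * a = g x * a + g x * a; [ring|apply: d_mul].
Qed.

Lemma d_inv g x a : g x != 0 -> is_derive x 1 g a ->
  is_derive x 1 (fun t => (g t)^-1) (- (g x) ^- 2 * a).
Proof. by move=> g0 dg; apply: is_deriveV. Qed.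

Lemma d_eq f x a b : is_derive x 1 f a -> a = b -> is_derive x 1 f b.
Proof. by move=> ? <-. Qed.

Lemma d_continuous f x a : is_derive x 1 f a -> {for x, continuous f}.
Proof. by move=> [dx _]; exact/differentiable_continuous/derivable1_diffP. Qed.

End derivation_rules.

(** Computes a derivative from the shape of the function.  Positivity side
    conditions are left as goals. *)
Ltac deriv_rules := lazymatch goal with
  | |- is_derive _ _ _ _ => first [ eassumption | eapply d_cst | eapply d_id
  | eapply d_sqr | eapply d_add | eapply d_opp | eapply d_inv
  | eapply d_exp | eapply d_cos | eapply d_sin | eapply d_atan
  | eapply d_ln | eapply d_powR | eapply d_mul ]; deriv_rules
  | _ => idtac end.
Ltac deriv := eapply d_eq; [ deriv_rules | rewrite /= ].

(** * The Gaussian density and its Fourier transform *)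
Section gaussian.
Context {R : realType}.
Notation mu := (@lebesgue_measure R).
Implicit Types v t y c : R.

Definition gauss v t : R := (Num.sqrt (2 * pi * v))^-1 * expR (- (t ^+ 2 / (2 * v))).

Lemma gauss_pdf v m t : 0 < v -> gauss v (t - m) = normal_pdf m (Num.sqrt v) t.
Proof.
move=> v0; rewrite normal_pdfE ?gt_eqF ?sqrtr_gt0// /normal_peak /normal_fun sqr_sqrtr ?ltW//.
rewrite /gauss mulNr; congr (_ * expR (- (_ / _))); last by rewrite mulr_natl.
by congr (Num.sqrt _)^-1; rewrite -mulr_natl; ring.
Qed.

Lemma gauss_ge0 v t : 0 <= gauss v t.
Proof. by rewrite mulr_ge0 ?expR_ge0// invr_ge0 sqrtr_ge0. Qed.

Lemma gauss_le v t : 0 < v -> gauss v t <= (Num.sqrt (2 * pi * v))^-1.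
Proof.
move=> v0; rewrite ler_piMr ?invr_ge0 ?sqrtr_ge0// -[leRHS]expR0 ler_expR oppr_le0.
by rewrite mulr_ge0 ?sqr_ge0// invr_ge0 mulr_ge0// ltW.
Qed.

Lemma d_gauss v t : v != 0 -> is_derive t 1 (gauss v) (- (t / v) * gauss v t).
Proof.
move=> v0; rewrite /gauss; deriv.
by set p := (Num.sqrt _)^-1; set e := expR _; field.
Qed.

Lemma measurable_gauss v : measurable_fun setT (gauss v).
Proof.
apply: measurable_funM => //; apply: measurableT_comp => //.
by apply: measurableT_comp => //; apply: measurable_funM.
Qed.

Lemma integral_gauss v m : 0 < v -> (\int[mu]_t (gauss v (t - m))%:E = 1)%E.
Proof. by move=> v0; under eq_integral do rewrite gauss_pdf//; exact: integral_normal_pdf. Qed.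

Lemma integrable_gauss v m : 0 < v -> mu.-integrable setT (EFin \o (fun t => gauss v (t - m))).
Proof.
move=> v0; have -> : (fun t => gauss v (t - m)) = normal_pdf m (Num.sqrt v).
  by apply/funext => t; rewrite gauss_pdf.
exact: integrable_normal_pdf.
Qed.

Lemma integrable_gauss0 v : 0 < v -> mu.-integrable setT (EFin \o gauss v).
Proof.
by move=> /(integrable_gauss 0); under [X in EFin \o X]eq_fun do rewrite subr0.
Qed.

(** A Gaussian is a wider one times a factor that is small away from the centre;
    this bounds its tails by a multiple of a probability density. *)
Lemma gauss_split v t : 0 < v ->
  gauss v t = Num.sqrt 2 * expR (- (t ^+ 2 / (4 * v))) * gauss (2 * v) t.
Proof.
move=> v0; rewrite /gauss (_ : 2 * pi * (2 * v) = 2 * (2 * pi * v)); last by ring.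
rewrite [Num.sqrt (2 * (2 * pi * v))]sqrtrM//.
rewrite (_ : t ^+ 2 / (2 * v) = t ^+ 2 / (4 * v) + t ^+ 2 / (2 * (2 * v))); last by field; rewrite gt_eqF.
rewrite opprD expRD; field.
by rewrite !gt_eqF// sqrtr_gt0// !mulr_gt0// pi_gt0.
Qed.

Lemma integrable_norm_gauss v : 0 < v -> mu.-integrable setT (EFin \o (fun t => `|t| * gauss v t)).
Proof.
move=> v0; have v20 : 0 < 2 * v by rewrite mulr_gt0.
pose C := 4 * v + 1.
have I := integrableZl measurableT (Num.sqrt 2 * C) (integrable_gauss0 v20).
apply: le_integrable I => //.
  apply/measurable_EFinP; apply: measurable_funM; last exact: measurable_gauss.
  exact: normr_measurable.
move=> t _; rewrite /= lee_fin ger0_norm ?mulr_ge0 ?gauss_ge0//.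
have C0 : 0 <= C by rewrite /C; lra.
rewrite [X in _ <= X]ger0_norm; last by rewrite mulr_ge0 ?gauss_ge0// mulr_ge0 ?sqrtr_ge0.
rewrite gauss_split// mulrA ler_wpM2r ?gauss_ge0// mulrCA ler_wpM2l ?sqrtr_ge0//.
have e1 : 1 + t ^+ 2 / (4 * v) <= expR (t ^+ 2 / (4 * v)) by exact: expR_ge1Dx.
rewrite expRN ler_pdivrMr ?expR_gt0//.
apply: le_trans (ler_wpM2l C0 e1).
have -> : C * (1 + t ^+ 2 / (4 * v)) = 4 * v + 1 + t ^+ 2 + t ^+ 2 / (4 * v).
  by rewrite /C; field; rewrite gt_eqF.
have : 0 <= t ^+ 2 / (4 * v) by rewrite divr_ge0 ?sqr_ge0//; lra.
have : `|t| <= 1 + t ^+ 2 by rewrite -(real_normK (num_real t)); nra.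
by lra.
Qed.

Lemma gauss_cos_integrable v y c : 0 < v ->
  mu.-integrable setT (EFin \o (fun t => gauss v t * cos (y * t + c))).
Proof.
move=> v0; apply: le_integrable (integrable_gauss0 v0) => //.
  apply/measurable_EFinP; apply: measurable_funM; first exact: measurable_gauss.
  apply: measurableT_comp => //; first exact: continuous_measurable_fun (@continuous_cos R).
  by apply: measurable_funD => //; exact: measurable_funM.
move=> t _; rewrite /= lee_fin normrM ler_piMr//.
by rewrite ler_norml cos_geN1 cos_le1.
Qed.

Lemma gauss_tail v x : 0 < v ->
  gauss v x * (1 + `|x|) <= (Num.sqrt (2 * pi * v))^-1 * (2 + 2 * v).
Proof.
move=> v0; rewrite /gauss -[leLHS]mulrA ler_wpM2l ?invr_ge0 ?sqrtr_ge0//.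
rewrite expRN mulrC ler_pdivrMr ?expR_gt0//.
have v20 : 0 <= 2 + 2 * v by lra.
apply: le_trans (ler_wpM2l v20 (expR_ge1Dx _)).
have -> : (2 + 2 * v) * (1 + x ^+ 2 / (2 * v)) = 2 + 2 * v + x ^+ 2 / v + x ^+ 2.
  by field; rewrite gt_eqF.
have : 0 <= x ^+ 2 / v by rewrite divr_ge0 ?sqr_ge0// ltW.
have : `|x| <= 1 + x ^+ 2 by rewrite -(real_normK (num_real x)); nra.
by lra.
Qed.

(** The function [y |-> exp (v y^2 / 2) * integral of gauss v t * cos (y t + c)] is
    constant: its derivative is the integral of the [t]-derivative of
    [v * gauss v t * sin (y t + c)], up to a factor free of [t].  The phase [c]
    covers cosine and sine at once. *)
Lemma gauss_fourier v y c : 0 < v ->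
  Rintegral mu setT (fun t => gauss v t * cos (y * t + c)) =
  expR (- (v * y ^+ 2 / 2)) * cos c.
Proof.
move=> v0.
pose f y t := expR (v * y ^+ 2 / 2) * (gauss v t * cos (y * t + c)).
pose df y t := expR (v * y ^+ 2 / 2) * (v * y * cos (y * t + c) - t * sin (y * t + c)) * gauss v t.
have dfE (z t : R) : is_derive z 1 (f ^~ t) (df z t).
  rewrite /f; deriv.
  by rewrite /df; field.
have If (z : R) : mu.-integrable setT (EFin \o f z).
  exact: (integrableZl measurableT (expR (v * z ^+ 2 / 2)) (gauss_cos_integrable z c v0)).
have cdf z : continuous (df z).
  by move=> t; apply: d_continuous; rewrite /df /gauss; deriv_rules.
pose G (M t : R) := expR (v * M ^+ 2 / 2) * (v * M * gauss v t + `|t| * gauss v t).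
have dfG (M z t : R) : `|z| <= M -> `|df z t| <= G M t.
  move=> zM; rewrite /df /G normrM (ger0_norm (gauss_ge0 _ _)) normrM (ger0_norm (expR_ge0 _)).
  rewrite -mulrA -mulrDl ler_pM ?expR_ge0 ?mulr_ge0 ?gauss_ge0//.
    rewrite ler_expR ler_pM2r// ler_pM2l// -(real_normK (num_real z)) lerXn2r// nnegrE//.
    exact: le_trans zM.
  rewrite ler_wpM2r ?gauss_ge0// (le_trans (ler_normB _ _))// lerD//.
    rewrite normrM normrM (gtr0_norm v0) -mulrA ler_wpM2l ?(ltW v0)//.
    rewrite -[leRHS]mulr1 ler_pM//.
    by rewrite ler_norml cos_geN1 cos_le1.
  by rewrite normrM ler_piMr// ler_norml sin_geN1 sin_le1.
have iG (M : R) : mu.-integrable setT (EFin \o G M).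
  have I1 := integrableZl measurableT (v * M) (integrable_gauss0 v0).
  have I2 := integrableD measurableT I1 (integrable_norm_gauss v0).
  exact: (integrableZl measurableT (expR (v * M ^+ 2 / 2)) I2).
have G0 (M : R) t : 0 <= G `|M| t.
  by rewrite /G mulr_ge0 ?expR_ge0// addr_ge0// !mulr_ge0 ?gauss_ge0// ltW.
have idf z : mu.-integrable setT (EFin \o df z).
  apply: le_integrable (iG `|z|) => //.
    by apply/measurable_EFinP; exact: continuous_measurable_fun.
  by move=> t _; rewrite /= lee_fin (ger0_norm (G0 _ _)) dfG.
(* the integrand is an exact derivative in t of a function vanishing at infinity *)
have d0 (z : R) : Rintegral mu setT (df z) = 0.
  apply: (@improper_FTC_R _ (fun t => v * expR (v * z ^+ 2 / 2) * (gauss v t * sin (z * t + c))) _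
    (v * expR (v * z ^+ 2 / 2) * ((Num.sqrt (2 * pi * v))^-1 * (2 + 2 * v)))).
  - move=> t; have dg := d_gauss t (lt0r_neq0 v0); deriv.
    by rewrite /df; field; rewrite gt_eqF.
  - exact: cdf.
  - move=> t; rewrite normrM (ger0_norm (mulr_ge0 (ltW v0) (expR_ge0 _))) -[leLHS]mulrA.
    rewrite ler_wpM2l ?mulr_ge0 ?expR_ge0 ?(ltW v0)//.
    apply: le_trans (gauss_tail t v0); rewrite ler_wpM2r ?addr_ge0//.
    rewrite normrM (ger0_norm (gauss_ge0 _ _)) ler_piMr ?gauss_ge0//.
    by rewrite ler_norml sin_geN1 sin_le1.
  - exact: idf.
pose F z := Rintegral mu setT (f z).
have dF (z : R) : is_derive z 1 F 0.
  have zI : `]z - 1, z + 1[%classic z by rewrite /= in_itv/=; lra.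
  have ub (x t : R) : `]z - 1, z + 1[%classic x -> setT t ->
      `|partial1of2 f x t| <= G (`|z| + 1) t.
    move=> xz _; rewrite partial1of2E (derive_val (is_derive := dfE x t)).
    apply: dfG; move: xz; rewrite /= in_itv/= => xz.
    have -> : x = z + (x - z) by ring.
    by rewrite (le_trans (ler_normD _ _))// lerD2l ler_norml; lra.
  have G0' t : 0 <= G (`|z| + 1) t.
    by have := G0 (`|z| + 1) t; rewrite ger0_norm// addr_ge0.
  apply: DeriveDef.
    apply: (@derivable_under_integral _ _ _ mu f setT measurableT z _ _ zI
      (fun x _ => If x) _ (G (`|z| + 1)) G0' (iG _) ub).
    by move=> x t _ _; have [] := dfE x t.
  rewrite -derive1E (@differentiation_under_integral _ _ _ mu f setT measurableT z _ _ zI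
      (fun x _ => If x) _ (G (`|z| + 1)) G0' (iG _) ub).
    rewrite -(d0 z); apply: eq_Rintegral => t _.
    by rewrite partial1of2E (derive_val (is_derive := dfE z t)).
  by move=> x t _ _; have [] := dfE x t.
have : F y = F 0 by exact: is_derive_0_is_cst.
rewrite /F /f RintegralZl//; last exact: gauss_cos_integrable.
under [X in _ = X -> _]eq_Rintegral => t _.
  rewrite expr0n /= mulr0 mul0r expR0 mul1r mul0r add0r.
  over.
rewrite RintegralZr//; last exact: integrable_gauss0.
rewrite -(_ : 1 = Rintegral mu setT (gauss v)); last first.
  rewrite /Rintegral; under eq_integral do rewrite -[X in gauss v X]subr0.
  by rewrite integral_gauss.
rewrite mul1r => h; rewrite expRN -h mulKf//; by rewrite gt_eqF// expR_gt0.
Qed.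
End gaussian.

(** * Fourier inversion *)
Section parameter_integral.
Context d (T : measurableType d) (R : realType).
Variables (mu : {measure set T -> \bar R}) (D : set T) (mD : measurable D).

Lemma continuous_Rintegral (f : R -> T -> R) (g : T -> R) :
  (forall x, measurable_fun D (f x)) -> mu.-integrable D (EFin \o g) ->
  (forall x y, D y -> `|f x y| <= g y) ->
  (forall y, D y -> continuous (f ^~ y)) ->
  continuous (fun x => Rintegral mu D (f x)).
Proof.
move=> mf ig fg cf x.
apply: (@continuity_under_integral _ _ _ mu f D mD (x - 1) (x + 1) _ _ g ig).
- move=> z _; apply: le_integrable ig => //; first exact/measurable_EFinP.
  by move=> y Dy; rewrite /= lee_fin (le_trans (fg _ _ Dy))// ler_norm.
- by apply: aeW => y Dy z _; exact: cf.
- by move=> z _; apply: aeW => y Dy; exact: fg.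
- by rewrite inE/= in_itv/=; lra.
Qed.

Lemma normc_Cintegral_le (f : T -> R[i]) : Cintegrable mu D f ->
  normc (Cintegral mu D f) <= 2 * Rintegral mu D (fun x => normc (f x)).
Proof.
move=> If; have [I1 I2] := If; have In := Cintegrable_normc mD If.
rewrite (le_trans (normc_le_ReIm _))//= mulr_natl mulr2n; apply: lerD.
  rewrite (le_trans (le_normr_Rintegral mD I1))//.
  apply: le_Rintegral => //; first exact: integrable_norm I1.
  by move=> x _; exact: Re_le_normc.
rewrite (le_trans (le_normr_Rintegral mD I2))//.
apply: le_Rintegral => //; first exact: integrable_norm I2.
by move=> x _; exact: Im_le_normc.
Qed.

Definition Ccvg (z : nat -> R[i]) (l : R[i]) :=
  complex.Re (z n) @[n --> \oo] --> complex.Re l /\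
  complex.Im (z n) @[n --> \oo] --> complex.Im l.

Lemma Ccvg_unique (z : nat -> R[i]) (l l' : R[i]) : Ccvg z l -> Ccvg z l' -> l = l'.
Proof.
by move=> [h1 h2] [h1' h2']; apply: CeqP; [exact: cvg_unique h1 h1'|exact: cvg_unique h2 h2'].
Qed.

Lemma Cdominated (f_ : nat -> T -> R[i]) (f : T -> R[i]) (g : T -> R) :
  (forall n, Cmeasurable D (f_ n)) -> Cmeasurable D f ->
  (forall x, D x -> Ccvg (f_ ^~ x) (f x)) ->
  mu.-integrable D (EFin \o g) ->
  (forall n x, D x -> normc (f_ n x) <= g x) ->
  Ccvg (fun n => Cintegral mu D (f_ n)) (Cintegral mu D f).
Proof.
move=> mf_ mf ff ig fg; split => /=.
  have [] // := @Rdominated _ _ _ mu D mD (fun n x => complex.Re (f_ n x))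
    (fun x => complex.Re (f x)) g.
  - by move=> n; have [] := mf_ n.
  - by case: mf.
  - by move=> x /ff[].
  - by move=> n x Dx; rewrite (le_trans (Re_le_normc _)) ?fg.
have [] // := @Rdominated _ _ _ mu D mD (fun n x => complex.Im (f_ n x))
  (fun x => complex.Im (f x)) g.
- by move=> n; have [] := mf_ n.
- by case: mf.
- by move=> x /ff[].
- by move=> n x Dx; rewrite (le_trans (Im_le_normc _)) ?fg.
Qed.

End parameter_integral.

Section gaussian_kernel.
Context {R : realType}.
Notation mu := (@lebesgue_measure R).
Implicit Types (e u : R).

(** The Gaussian damping factor, whose Fourier transform is a narrow Gaussian. *)
Definition ghat e (t : R) : R := expR (- (e * t ^+ 2 / 2)).

Lemma ghatE e t : 0 < e -> ghat e t = Num.sqrt (2 * pi / e) * gauss e^-1 t.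
Proof.
move=> e0; rewrite /ghat /gauss [RHS]mulrA divff ?mul1r; last first.
  by rewrite gt_eqF// sqrtr_gt0 divr_gt0// mulr_gt0// pi_gt0.
by congr expR; field; rewrite gt_eqF.
Qed.

Lemma ghat_ge0 e t : 0 <= ghat e t. Proof. exact: expR_ge0. Qed.

Lemma ghat_le1 e t : 0 < e -> ghat e t <= 1.
Proof.
move=> e0; rewrite -expR0 ler_expR oppr_le0 divr_ge0// mulr_ge0 ?sqr_ge0//; exact: ltW.
Qed.

Lemma integrable_ghat e : 0 < e -> mu.-integrable setT (EFin \o ghat e).
Proof.
move=> e0; have ei : 0 < e^-1 by rewrite invr_gt0.
apply: eq_integrable (integrableZl measurableT (Num.sqrt (2 * pi / e)) (integrable_gauss0 ei)) => //.
by move=> t _; rewrite /= ghatE.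
Qed.

Lemma Cintegral_ghat e (w : R) : 0 < e ->
  Cintegral mu setT (fun t => (ghat e t)%:C * Cexp (0 +i* (w * t))) =
  (2 * pi * gauss e w)%:C.
Proof.
move=> e0; have ei : 0 < e^-1 by rewrite invr_gt0.
have p0 := pi_gt0 R.
have key c : Rintegral mu setT (fun t => ghat e t * cos (w * t + c)) =
    2 * pi * gauss e w * cos c.
  transitivity (Num.sqrt (2 * pi / e) * Rintegral mu setT (fun t => gauss e^-1 t * cos (w * t + c))).
    rewrite -RintegralZl//; last exact: gauss_cos_integrable.
    by apply: eq_Rintegral => t _; rewrite ghatE// mulrA.
  rewrite gauss_fourier// /gauss mulrA; congr (_ * _).
  rewrite [RHS]mulrA; congr (_ * expR _); last by field; rewrite gt_eqF.
  have h : Num.sqrt (2 * pi / e) * Num.sqrt (2 * pi * e) = 2 * pi.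
    rewrite -sqrtrM ?divr_ge0 ?mulr_ge0 ?(ltW p0) ?(ltW e0)//.
    rewrite (_ : 2 * pi / e * (2 * pi * e) = (2 * pi) ^+ 2); last by field; rewrite gt_eqF.
    by rewrite sqrtr_sqr ger0_norm// mulr_ge0// ltW.
  apply: (canRL (mulfK _)) => //; by rewrite gt_eqF// sqrtr_gt0 !mulr_gt0.
apply: CeqP => /=.
  rewrite -[RHS]mulr1 -[X in _ = _ * X]cos0 -key; apply: eq_Rintegral => t _.
  by rewrite !(mul0r, subr0, expR0, mul1r, addr0).
rewrite -[RHS](mulr0 (2 * pi * gauss e w)) -(cos_pihalf R) -cosN -key.
apply: eq_Rintegral => t _; rewrite cosD cosN sinN cos_pihalf sin_pihalf expR0; ring.
Qed.

(** Split the average at [|v - u| = del]: inside, [f] is close to [c]; outside,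
    [|f - c| <= 2 M] and [gauss_split] makes the mass exponentially small. *)
Lemma gauss_avg (f : R -> R) (c M eta e del u : R) :
  0 < e -> 0 < del -> measurable_fun setT f -> (forall v, `|f v| <= M) -> `|c| <= M ->
  (forall v, `|v - u| < del -> `|f v - c| <= eta) -> 0 <= eta ->
  `|Rintegral mu setT (fun v => f v * gauss e (v - u)) - c| <=
  eta + 2 * M * Num.sqrt 2 * expR (- (del ^+ 2 / (4 * e))).
Proof.
move=> e0 d0 mf fM cM fc eta0.
have e20 : 0 < 2 * e by rewrite mulr_gt0.
have M0 : 0 <= M by exact: le_trans (normr_ge0 _) cM.
have mg w : measurable_fun setT (fun v : R => gauss w (v - u)).
  apply: (@measurableT_comp _ _ _ _ _ _ (gauss w)); first exact: measurable_gauss.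
  exact: measurable_funB.
have I1 : mu.-integrable setT (EFin \o (fun v => f v * gauss e (v - u))).
  have := integrableZl measurableT M (integrable_gauss u e0).
  apply: le_integrable => //; first by apply/measurable_EFinP; apply: measurable_funM => //; exact: mg.
  by move=> v _; rewrite /= lee_fin !normrM (ger0_norm M0) ler_wpM2r.
have I2 : mu.-integrable setT (EFin \o (fun v => c * gauss e (v - u))).
  exact: (integrableZl measurableT c (integrable_gauss u e0)).
have one w : 0 < w -> Rintegral mu setT (fun v => gauss w (v - u)) = 1.
  by move=> w0; rewrite /Rintegral integral_gauss.
have -> : c = Rintegral mu setT (fun v => c * gauss e (v - u)).
  by rewrite RintegralZl ?one ?mulr1//; exact: integrable_gauss.
rewrite -RintegralB//.
set K := 2 * M * Num.sqrt 2 * expR _.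
have -> : eta + K = Rintegral mu setT (fun v => eta * gauss e (v - u) + K * gauss (2 * e) (v - u)).
  rewrite RintegralD//; last 2 first.
  - exact: (integrableZl measurableT eta (integrable_gauss u e0)).
  - exact: (integrableZl measurableT K (integrable_gauss u e20)).
  rewrite RintegralZl//; last exact: integrable_gauss.
  rewrite RintegralZl//; last exact: integrable_gauss.
  by rewrite !one// !mulr1.
have I3 : mu.-integrable setT (EFin \o (fun v => f v * gauss e (v - u) - c * gauss e (v - u))).
  exact: (integrableB measurableT I1 I2).
apply: (le_trans (le_normr_Rintegral _ I3)) => //.
apply: le_Rintegral => //.
- exact: integrable_norm I3.
- exact: (integrableD measurableT (integrableZl measurableT eta (integrable_gauss u e0))
    (integrableZl measurableT K (integrable_gauss u e20))).
move=> v _; rewrite -mulrBl normrM (ger0_norm (gauss_ge0 _ _)).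
have K0 : 0 <= K by rewrite /K !mulr_ge0 ?sqrtr_ge0 ?expR_ge0.
have [vd|vd] := ltP `|v - u| del.
  apply: ler_wpDr; first by rewrite mulr_ge0 ?gauss_ge0.
  by rewrite ler_wpM2r ?gauss_ge0 ?fc.
apply: ler_wpDl; first by rewrite mulr_ge0 ?gauss_ge0.
rewrite gauss_split// mulrA ler_wpM2r ?gauss_ge0// /K mulrA.
rewrite ler_pM ?mulr_ge0 ?expR_ge0 ?sqrtr_ge0//.
  rewrite ler_wpM2r ?sqrtr_ge0// (le_trans (ler_normB _ _))//.
  by have := fM v; lra.
rewrite ler_expR lerN2 ler_pM2r ?invr_gt0 ?mulr_gt0//.
by rewrite -(real_normK (num_real (v - u))) lerXn2r// nnegrE// ltW.
Qed.

Lemma gauss_approx_identity (f : R -> R) (M u : R) :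
  measurable_fun setT f -> (forall v, `|f v| <= M) -> {for u, continuous f} ->
  Rintegral mu setT (fun v => f v * gauss (n.+1%:R^-1) (v - u)) @[n --> \oo] --> f u.
Proof.
move=> mf fM cf.
have M0 : 0 <= M by exact: le_trans (normr_ge0 _) (fM u).
apply/cvgrPdist_le => eps eps0.
have e2 : 0 < eps / 2 by rewrite divr_gt0.
have [del /= d0 hd] := (cvgrPdist_le _ _).1 cf _ e2.
pose C := 2 * M * Num.sqrt 2.
have C0 : 0 <= C by rewrite /C !mulr_ge0 ?sqrtr_ge0.
near=> n.
have n0 : 0 < n.+1%:R^-1 :> R by rewrite invr_gt0.
rewrite distrC; apply: (le_trans (gauss_avg n0 d0 mf fM (fM u) _ (ltW e2))).
  by move=> v vu; rewrite distrC; apply: hd; rewrite /= distrC.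
rewrite -/C [leRHS](splitr eps) lerD2l.
rewrite expRN ler_pdivrMr ?expR_gt0//.
apply: (@le_trans _ _ (eps / 2 * (1 + del ^+ 2 / (4 / n.+1%:R)))); last first.
  by rewrite ler_wpM2l ?(ltW e2)// expR_ge1Dx.
have -> : eps / 2 * (1 + del ^+ 2 / (4 / n.+1%:R)) = eps / 2 + eps * del ^+ 2 / 8 * n.+1%:R.
  by field; rewrite nat1r pnatr_eq0.
apply: ler_wpDl; first exact: ltW.
rewrite mulrC -ler_pdivrMr ?divr_gt0 ?mulr_gt0 ?exprn_gt0//.
near: n; exists (Num.truncn (C / (eps * del ^+ 2 / 8))) => // n /= xn.
by rewrite ltW// (lt_le_trans (truncnS_gt _))// ler_nat ltnS.
Unshelve. all: end_near. Qed.

End gaussian_kernel.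

Section fourier.
Context {R : realType}.
Notation mu := (@lebesgue_measure R).
Implicit Types (e u : R) (g : R -> R[i]).

Lemma Cmeasurable_continuous g : continuous (fun v => complex.Re (g v)) ->
  continuous (fun v => complex.Im (g v)) -> Cmeasurable setT g.
Proof. by move=> c1 c2; split; exact: continuous_measurable_fun. Qed.

Lemma Cmeasurable_Cexp_i d (T : measurableType d) (D : set T) (f : T -> R) :
  measurable_fun D f -> Cmeasurable D (fun t => Cexp (0 +i* f t)).
Proof. by move=> mf; apply: Cmeasurable_Cexp; split. Qed.

Lemma normc_Cexp_i (x : R) : normc (Cexp (0 +i* x)) = 1.
Proof. by rewrite normc_Cexp expR0. Qed.

(** The damping factor makes the iterated integral absolutely convergent; exchanged,
    the inner integral is the transform of the damping factor.  The sign [s]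
    serves both directions of the Fourier transform. *)
Lemma fourier_gauss g (s u e : R) : s ^+ 2 = 1 -> 0 < e -> Cintegrable mu setT g ->
  Cintegral mu setT (fun t => (ghat e t)%:C *
    Cintegral mu setT (fun v => g v * Cexp (0 +i* (s * (v - u) * t)))) =
  Cintegral mu setT (fun v => g v * (2 * pi * gauss e (v - u))%:C).
Proof.
move=> s1 e0 Ig.
rewrite (@Cfubini_bounded _ _ _ _ R mu mu (fun t => (ghat e t)%:C) g
  (fun z => Cexp (0 +i* (s * (z.2 - u) * z.1))) 1)//.
- apply: eq_Cintegral => v _; rewrite /= Cintegral_ghat//.
  by rewrite /gauss exprMn s1 mul1r.
- exact/Cintegrable_real/integrable_ghat.
- apply: Cmeasurable_Cexp_i; apply: measurable_funM => //.
  by apply: measurable_funM => //; apply: measurable_funB.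
- by move=> z; rewrite normc_Cexp_i.
Qed.

Lemma Ccvg_gauss g (M u : R) : Cmeasurable setT g -> (forall v, normc (g v) <= M) ->
  {for u, continuous (fun v => complex.Re (g v))} ->
  {for u, continuous (fun v => complex.Im (g v))} ->
  Ccvg (fun n => Cintegral mu setT (fun v => g v * (2 * pi * gauss (n.+1%:R^-1) (v - u))%:C))
    ((2 * pi)%:C * g u).
Proof.
move=> [m1 m2] gM c1 c2.
have n0 n : 0 < n.+1%:R^-1 :> R by rewrite invr_gt0.
have key (h : R -> R) : measurable_fun setT h -> (forall v, `|h v| <= M) -> {for u, continuous h} ->
    Rintegral mu setT (fun v => h v * (2 * pi * gauss (n.+1%:R^-1) (v - u))) @[n --> \oo] --> 2 * pi * h u.
  move=> mh hM ch.
  rewrite [X in X @ _ --> _](_ : _ = (fun n => 2 * pi *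
      Rintegral mu setT (fun v => h v * gauss (n.+1%:R^-1) (v - u)))).
    by apply: cvgM; [exact: cvg_cst|exact: gauss_approx_identity].
  apply/funext => n; rewrite -RintegralZl//.
    by apply: eq_Rintegral => v _; rewrite mulrCA.
  have := integrableZl measurableT M (integrable_gauss u (n0 n)).
  apply: le_integrable => //.
    apply/measurable_EFinP/measurable_funM => //.
    apply: (@measurableT_comp _ _ _ _ _ _ (gauss _)); first exact: measurable_gauss.
    exact: measurable_funB.
  by move=> v _; rewrite /= lee_fin !normrM ler_wpM2r// (le_trans (hM v))// ler_norm.
split => /=.
  rewrite cReM/= mul0r subr0.
  under eq_fun => n do under eq_Rintegral => v _ do rewrite cReM /= mulr0 subr0.
  by apply: key => // v; rewrite (le_trans (Re_le_normc _)).
rewrite cImM/= mul0r addr0.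
under eq_fun => n do under eq_Rintegral => v _ do rewrite cImM /= mulr0 add0r.
by apply: key => // v; rewrite (le_trans (Im_le_normc _)).
Qed.

Lemma ghat_cvg (t : R) : ghat (n.+1%:R^-1) t @[n --> \oo] --> (1 : R).
Proof.
rewrite -[X in _ --> X]expR0.
apply: (@continuous_cvg _ _ _ _ _ (fun n => - (n.+1%:R^-1 * t ^+ 2 / 2)) (@expR R) 0).
  exact: continuous_expR.
rewrite -[X in _ --> X]oppr0; apply: cvgN.
rewrite -[X in _ --> X](mul0r (t ^+ 2 / 2)).
under eq_fun do rewrite -mulrA.
by apply: cvgM; [exact: cvg_harmonic|exact: cvg_cst].
Qed.

Lemma Ccvg_ghat (t : R) (z : R[i]) : Ccvg (fun n => (ghat (n.+1%:R^-1) t)%:C * z) z.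
Proof.
have h (x : R) : ghat (n.+1%:R^-1) t * x @[n --> \oo] --> x.
  by rewrite -[X in _ --> X]mul1r; apply: cvgM; [exact: ghat_cvg|exact: cvg_cst].
split.
  by under eq_fun do rewrite cReM /= mul0r subr0; exact: h.
by under eq_fun do rewrite cImM /= mul0r addr0; exact: h.
Qed.

Lemma measurable_ghat e : measurable_fun setT (ghat e).
Proof.
apply: measurableT_comp => //; apply: measurableT_comp => //.
by apply: measurable_funM => //; apply: measurable_funM.
Qed.

(** Insert the damping factor and let it tend to 1: one side converges by dominated
    convergence, the other is an average of [g] against ever narrower Gaussians. *)
Theorem fourier_inversion g (M u : R) :
  Cintegrable mu setT g -> (forall v, normc (g v) <= M) ->
  {for u, continuous (fun v => complex.Re (g v))} ->
  {for u, continuous (fun v => complex.Im (g v))} ->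
  let G t := Cintegral mu setT (fun v => g v * Cexp (0 +i* (v * t))) in
  Cintegrable mu setT G ->
  Cintegral mu setT (fun t => G t * Cexp (0 +i* (- (u * t)))) = (2 * pi)%:C * g u.
Proof.
move=> Ig gM c1 c2 G IG.
apply: (Ccvg_unique _ (Ccvg_gauss (Cintegrable_measurable Ig) gM c1 c2)).
have n0 n : 0 < n.+1%:R^-1 :> R by rewrite invr_gt0.
pose f t := G t * Cexp (0 +i* (- (u * t))).
have mf : Cmeasurable setT f.
  apply: CmeasurableM; first exact: Cintegrable_measurable IG.
  by apply: Cmeasurable_Cexp_i; apply: measurableT_comp => //; exact: measurable_funM.
have := @Cdominated _ _ _ mu setT measurableT (fun n t => (ghat (n.+1%:R^-1) t)%:C * f t) f
  (fun t => normc (G t)).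
rewrite [X in _ -> _ -> _ -> _ -> _ -> Ccvg X _](_ : _ = (fun n => Cintegral mu setT
   (fun v => g v * (2 * pi * gauss (n.+1%:R^-1) (v - u))%:C))); last first.
  apply/funext => n; rewrite -(@fourier_gauss g 1)//; last by rewrite expr1n.
  apply: eq_Cintegral => t _; congr (_ * _); rewrite /f /G mulrC.
  rewrite -CintegralZ//; last first.
    apply: (CintegrableM_bounded (M := 1)) => //.
      by apply: Cmeasurable_Cexp_i; exact: measurable_funM.
    by move=> v _; rewrite normc_Cexp_i.
  apply: eq_Cintegral => v _; rewrite mulrCA -CexpD; congr (_ * Cexp _).
  by apply: CeqP; rewrite ?cReD ?cImD /= ?addr0//; ring.
apply => //.
- move=> n; apply: CmeasurableM => //; apply: Cmeasurable_real; exact: measurable_ghat.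
- by move=> t _; exact: Ccvg_ghat.
- exact: Cintegrable_normc.
- move=> n t _; rewrite normcM normc_real ger0_norm ?ghat_ge0// /f normcM normc_Cexp_i mulr1.
  by rewrite ler_piMl ?normc_ge0// ghat_le1.
Qed.

(** For a nonnegative transform [F] no integrability is required in advance: the
    damped integrals of [F] are Gaussian averages of [g] at 0, so they are bounded by
    the sup of [g], and Fatou gives the integral of [F]. *)
Theorem fourier_positive g (F : R -> R) (M : R) :
  Cintegrable mu setT g -> (forall v, normc (g v) <= M) ->
  continuous (fun v => complex.Re (g v)) -> continuous (fun v => complex.Im (g v)) ->
  (forall t, (2 * pi * F t)%:C = Cintegral mu setT (fun v => g v * Cexp (0 +i* (- (v * t))))) ->
  (forall t, 0 <= F t) -> measurable_fun setT F ->
  mu.-integrable setT (EFin \o F) /\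
  forall u, Cintegral mu setT (fun t => (F t)%:C * Cexp (0 +i* (u * t))) = g u.
Proof.
move=> Ig gM c1 c2 FE F0 mF.
have n0 n : 0 < n.+1%:R^-1 :> R by rewrite invr_gt0.
have p0 := pi_gt0 R.
have p20 : 0 < 2 * pi :> R by rewrite mulr_gt0.
have M0 : 0 <= M by exact: le_trans (normc_ge0 _) (gM 0).
have E u n : Cintegral mu setT (fun t => (ghat (n.+1%:R^-1) t)%:C * ((2 * pi * F t)%:C * Cexp (0 +i* (u * t)))) =
    Cintegral mu setT (fun v => g v * (2 * pi * gauss (n.+1%:R^-1) (v - u))%:C).
  rewrite -(@fourier_gauss g (-1))//; last by rewrite sqrrN expr1n.
  apply: eq_Cintegral => t _; congr (_ * _); rewrite FE mulrC -CintegralZ//; last first.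
    apply: (CintegrableM_bounded (M := 1)) => //.
      by apply: Cmeasurable_Cexp_i; apply: measurableT_comp => //; exact: measurable_funM.
    by move=> v _; rewrite normc_Cexp_i.
  apply: eq_Cintegral => v _; rewrite mulrCA -CexpD; congr (_ * Cexp _).
  by apply: CeqP; rewrite ?cReD ?cImD /= ?addr0//; ring.
have IF : mu.-integrable setT (EFin \o F).
  have [] // := @Rfatou _ _ _ mu setT measurableT (fun n t => ghat (n.+1%:R^-1) t * F t) F M.
  - by move=> n; apply: measurable_funM => //; exact: measurable_ghat.
  - by move=> n t _; rewrite mulr_ge0 ?ghat_ge0.
  - move=> t _; rewrite -[X in _ --> X]mul1r; apply: cvgM; last exact: cvg_cst.
    exact: ghat_cvg.
  move=> n.
  have Fb t : F t <= (2 * pi)^-1 * (2 * Rintegral mu setT (fun v => normc (g v))).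
    rewrite ler_pdivlMl//; have <- : normc (2 * pi * F t)%:C = 2 * pi * F t.
      by rewrite normc_real ger0_norm// mulr_ge0// ltW.
    rewrite FE; apply: le_trans (normc_Cintegral_le _ _) _ => //.
      apply: (CintegrableM_bounded (M := 1)) => //.
        by apply: Cmeasurable_Cexp_i; apply: measurableT_comp => //; exact: measurable_funM.
      by move=> v _; rewrite normc_Cexp_i.
    rewrite le_eqVlt; apply/orP; left; apply/eqP; congr (_ * _).
    by apply: eq_Rintegral => v _; rewrite normcM normc_Cexp_i mulr1.
  have Ign : mu.-integrable setT (EFin \o (fun t => ghat (n.+1%:R^-1) t * F t)).
    have := integrableZl measurableT ((2 * pi)^-1 * (2 * Rintegral mu setT (fun v => normc (g v))))
      (integrable_ghat (n0 n)).
    apply: le_integrable => //.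
      by apply/measurable_EFinP; apply: measurable_funM => //; exact: measurable_ghat.
    move=> t _; rewrite /= lee_fin mulrC !normrM ler_wpM2r// ger0_norm//.
    by rewrite (le_trans (Fb t))// -!normrM ler_norm.
  rewrite -[X in (X <= _)%E]fineK; last exact: (integrable_fin_num measurableT Ign).
  rewrite lee_fin -[leLHS]/(Rintegral mu setT (fun t => ghat (n.+1%:R^-1) t * F t)).
  rewrite -(ler_pM2l p20).
  have := congr1 (@complex.Re R) (E 0 n) => /=.
  rewrite [X in X = _ -> _](_ : _ = 2 * pi * Rintegral mu setT (fun t => ghat (n.+1%:R^-1) t * F t)); last first.
    rewrite -RintegralZl//; apply: eq_Rintegral => t _.
    rewrite mul0r !(mul0r, mulr0, add0r, addr0, subr0, expR0, cos0, sin0, mul1r, mulr1).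
    by rewrite mulrCA.
  move=> ->.
  have IZ := integrableZl measurableT (2 * pi) (integrable_gauss 0 (n0 n)).
  have IMZ := integrableZl measurableT M IZ.
  have -> : 2 * pi * M = Rintegral mu setT (fun v => M * (2 * pi * gauss (n.+1%:R^-1) (v - 0))).
    rewrite RintegralZl// RintegralZl//; last exact: integrable_gauss.
    by rewrite [X in _ * (_ * X)]/Rintegral integral_gauss//= mulr1 mulrC.
  have ub v : `|complex.Re (g v * (2 * pi * gauss (n.+1%:R^-1) (v - 0))%:C)| <=
      M * (2 * pi * gauss (n.+1%:R^-1) (v - 0)).
    rewrite cReM /= mulr0 subr0 normrM.
    rewrite [X in _ * X]ger0_norm ?mulr_ge0 ?gauss_ge0 ?(ltW p0)//.
    rewrite ler_wpM2r ?mulr_ge0 ?gauss_ge0 ?(ltW p0)//.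
    by rewrite (le_trans (Re_le_normc _)).
  apply: le_Rintegral => //; last first.
    by move=> v _; rewrite (le_trans (ler_norm _))// ub.
  apply: le_integrable IMZ => //; last first.
    by move=> v _; rewrite /= lee_fin (le_trans (ub v))// ler_norm.
  apply/measurable_EFinP.
  under eq_fun do rewrite cReM /= mulr0 subr0.
  have [m1 _] := Cintegrable_measurable Ig.
  apply: measurable_funM => //; apply: measurable_funM => //.
  apply: (@measurableT_comp _ _ _ _ _ _ (gauss _)); first exact: measurable_gauss.
  exact: measurable_funB.
split=> // u.
apply: (@mulfI _ (2 * pi)%:C).
  by rewrite -normc_gt0 normc_real ger0_norm ?ltW.
apply: (Ccvg_unique _ (Ccvg_gauss (Cintegrable_measurable Ig) gM (c1 u) (c2 u))).
pose f t := (2 * pi * F t)%:C * Cexp (0 +i* (u * t)).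
have mf : Cmeasurable setT f.
  apply: CmeasurableM; first by apply: Cmeasurable_real; exact: measurable_funM.
  by apply: Cmeasurable_Cexp_i; exact: measurable_funM.
rewrite -CintegralZ//; last first.
  apply: (CintegrableM_bounded (M := 1)) => //; first exact: Cintegrable_real.
    by apply: Cmeasurable_Cexp_i; exact: measurable_funM.
  by move=> v _; rewrite normc_Cexp_i.
rewrite (_ : Cintegral mu setT _ = Cintegral mu setT f); last first.
  by apply: eq_Cintegral => t _; rewrite mulrA -rmorphM.
have := @Cdominated _ _ _ mu setT measurableT (fun n t => (ghat (n.+1%:R^-1) t)%:C * f t) f
  (fun t => 2 * pi * F t).
rewrite [X in _ -> _ -> _ -> _ -> _ -> Ccvg X _](_ : _ = (fun n => Cintegral mu setT
   (fun v => g v * (2 * pi * gauss (n.+1%:R^-1) (v - u))%:C))); last first.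
  by apply/funext => n; rewrite -E.
apply => //.
- move=> n; apply: CmeasurableM => //; apply: Cmeasurable_real; exact: measurable_ghat.
- by move=> t _; exact: Ccvg_ghat.
- exact: (integrableZl measurableT (2 * pi) IF).
- move=> n t _; rewrite normcM normc_real ger0_norm ?ghat_ge0// /f normcM normc_Cexp_i mulr1.
  rewrite normc_real ger0_norm ?mulr_ge0 ?(ltW p0)//.
  by rewrite ler_piMl ?mulr_ge0 ?(ltW p0)// ghat_le1.
Qed.

End fourier.

(** * The Euler integral *)
Section elementary.
Context {R : realType}.
Implicit Types x y z t : R.

Lemma MVT_is_derive (f df : R -> R) (a b : R) : a < b ->
  (forall x : R, a <= x <= b -> is_derive x 1 f (df x)) ->
  exists2 c, a < c < b & f b - f a = df c * (b - a).
Proof.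
move=> ab dF; have [|x|c] := @MVT R f df a b ab.
- by move=> x; rewrite in_itv/= => /andP[ax xb]; apply: dF; rewrite !ltW.
- apply: continuous_in_subspaceT => z; rewrite inE/= in_itv/= => zab.
  exact: d_continuous (dF z zab).
by rewrite in_itv/=; exists c.
Qed.

Lemma sin_le x : 0 <= x -> sin x <= x.
Proof.
rewrite le_eqVlt => /predU1P[<-|x0]; first by rewrite sin0.
have [c _] := @MVT_is_derive (@sin R) (@cos R) 0 x x0 (fun y _ => is_derive_sin y).
by rewrite sin0 !subr0 => ->; rewrite ler_piMl ?cos_le1// ltW.
Qed.

Lemma norm_sin_le x : `|sin x| <= `|x|.
Proof.
wlog x0 : x / 0 <= x => [h|].
  have [/h//|/ltW x0] := leP 0 x.
  by have := h (- x); rewrite sinN !normrN oppr_ge0; apply.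
rewrite (ger0_norm x0) ler_norml sin_le// andbT.
have [x1|x1] := leP x pi.
  by apply: le_trans (sin_ge0_pi _); rewrite ?oppr_le0// x0.
rewrite lerNl (le_trans _ (ltW x1))// (le_trans _ (pi_ge2 R))//.
by have := sin_geN1 x; lra.
Qed.

Lemma cos_ge x : 1 - x ^+ 2 / 2 <= cos x.
Proof.
have -> : cos x = 1 - 2 * sin (x / 2) ^+ 2.
  have {1}-> : x = x / 2 + x / 2 by rewrite -splitr.
  by rewrite cosD -!expr2 cos2sin2; ring.
rewrite lerD2l lerN2.
have : sin (x / 2) ^+ 2 <= (x / 2) ^+ 2.
  by rewrite -(real_normK (num_real (sin _))) -(real_normK (num_real (x / 2)))
     lerXn2r ?nnegrE// norm_sin_le.
by lra.
Qed.

Lemma ln_le_sub1 x : 0 < x -> ln x <= x - 1.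
Proof. by move=> x0; have := @le_ln1Dx R (x - 1); rewrite subrKC; apply; lra. Qed.

(** With [x = r^2] the right-hand side is [4 (r - r^-1)^2].  It is an affine function
    of [x] and [x^-1], so it integrates in closed form against Gamma densities. *)
Lemma sqr_ln_le x : 0 < x -> ln x ^+ 2 <= 4 * (x + x^-1 - 2).
Proof.
move=> x0; set u := ln x.
have xE : x = expR (u / 2) ^+ 2.
  by rewrite -expRM_natl -mulr_natl mulrCA divff ?mulr1// /u lnK.
set r := expR (u / 2) in xE.
have r0 : 0 < r by exact: expR_gt0.
have h1 : 1 + u / 2 <= r by exact: expR_ge1Dx.
have h2 : 1 - u / 2 <= r^-1 by rewrite -expRN; exact: expR_ge1Dx.
have -> : x + x^-1 - 2 = (r - r^-1) ^+ 2 by rewrite xE; field; rewrite gt_eqF.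
have ri : r * r^-1 = 1 by rewrite divff// gt_eqF.
have ri0 : 0 < r^-1 by rewrite invr_gt0.
have [u0|u0] := leP 0 u.
  have r1 : 1 <= r by lra.
  have ri1 : r^-1 <= 1 by rewrite invf_le1.
  by nra.
have ri1 : 1 <= r^-1 by lra.
have r1 : r <= 1 by rewrite -invf_ge1.
by nra.
Qed.

Lemma atan_le x : 0 <= x -> atan x <= x.
Proof.
rewrite le_eqVlt => /predU1P[<-|x0]; first by rewrite atan0.
have [c _] := @MVT_is_derive (@atan R) (fun y => (1 + y ^+ 2)^-1) 0 x x0 (fun y _ => is_derive1_atan y).
rewrite atan0 !subr0 => ->; rewrite ler_piMl ?(ltW x0)// invf_le1 ?lerDl ?sqr_ge0//.
by rewrite ltr_pwDl// sqr_ge0.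
Qed.

Lemma atan_ge0 x : 0 <= x -> 0 <= atan x.
Proof. by move=> x0; rewrite -atan0 le_atan. Qed.

(** [pi / 2 - atan x] is the arctangent of [x^-1]. *)
Lemma atan_ge x : 0 < x -> pi / 2 - x^-1 <= atan x.
Proof.
move=> x0; set al := pi / 2 - atan x.
have al0 : 0 < al by rewrite subr_gt0 atan_ltpi2.
have al1 : al < pi / 2 by rewrite ltrBlDr ltrDl -atan0 lt_atan.
have ta : tan al = x^-1.
  rewrite /tan sinB cosB cos_pihalf sin_pihalf !(mul0r, mul1r, subr0, add0r).
  by rewrite -[in RHS](atanK x) /tan invf_div.
have p0 := pi_gt0 R.
have -> : atan x = pi / 2 - al by rewrite /al; ring.
rewrite lerD2l lerN2 -ta -[leLHS]tanK; last by rewrite in_itv/= al1 andbT; lra.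
by rewrite atan_le// ta invr_ge0 ltW.
Qed.

Lemma powR_exp x a : 0 < x -> x `^ a = expR (a * ln x).
Proof. by move=> x0; rewrite /powR gt_eqF. Qed.

Lemma powRS x a : 0 < x -> x `^ (a + 1) = x * x `^ a.
Proof. by move=> x0; rewrite powRD ?(gt_eqF x0) ?implybT// powRr1 ?ltW// mulrC. Qed.

Lemma cvg_powR_inv (x : R) : 0 < x -> (n.+2%:R^-1) `^ x @[n --> \oo] --> 0.
Proof.
move=> x0; apply/cvgrPdist_le => e e0; near=> n.
have n0 : 0 < n.+2%:R :> R by [].
rewrite sub0r normrN ger0_norm ?powR_ge0// powR_exp ?invr_gt0// lnV//.
rewrite mulrN expRN -[leRHS]invrK lef_pV2 ?posrE ?expR_gt0 ?invr_gt0//.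
rewrite -[leLHS]lnK ?posrE ?invr_gt0// ler_expR mulrC -ler_pdivrMr//.
rewrite -[leLHS]expRK ler_ln ?posrE ?expR_gt0//.
near: n; exists (Num.truncn (expR (ln e^-1 / x))) => // n /= xn.
by rewrite ltW// (lt_le_trans (truncnS_gt _))// ler_nat ltnW.
Unshelve. all: end_near. Qed.

End elementary.

Section Euler.
Context {R : realType}.
Notation mu := (@lebesgue_measure R).
Notation D0 := (`]0, +oo[%classic : set (measurableTypeR R)).
Implicit Types (x y t c : R) (s : R[i]).

Let i0 t : D0 t -> 0 < t. Proof. by rewrite /= in_itv/= andbT. Qed.

Definition edens x t : R := t `^ (x - 1) * expR (- t).

Lemma edens_gt0 x t : 0 < t -> 0 < edens x t.
Proof. by move=> t0; rewrite mulr_gt0 ?powR_gt0 ?expR_gt0. Qed.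

Lemma continuous_edens x t : 0 < t -> {for t, continuous (edens x)}.
Proof. by move=> t0; apply: d_continuous; rewrite /edens; deriv_rules. Qed.

Lemma measurable_edens x : measurable_fun D0 (edens x).
Proof. by apply: measurable_0y => t t0; exact: continuous_edens. Qed.

(** The maximum of [y ln (1 + t) - t] is attained at [1 + t = y]. *)
Lemma powR_exp_bound (y : R) : 0 < y ->
  exists C, forall t, 0 < t -> (1 + t) `^ y * expR (- t) <= C.
Proof.
move=> y0; exists (expR (y * ln y + 1)) => t t0.
have t10 : 0 < 1 + t by lra.
rewrite powR_exp// -expRD ler_expR.
have := ln_le_sub1 (divr_gt0 t10 y0); rewrite lnM ?posrE ?invr_gt0// lnV ?posrE//.
move=> h.
have : y * (ln (1 + t) - ln y) <= y * ((1 + t) / y - 1) by rewrite ler_pM2l.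
rewrite mulrBr mulrBr mulrCA divff ?gt_eqF//; lra.
Qed.

(** Compared with the derivative of [(t / (1 + t))^x], which is of order [t^(x - 1)]
    at 0, decreases like [t^-2] at infinity, and has a bounded primitive. *)
Lemma integrable_edens x : 0 < x -> mu.-integrable D0 (EFin \o edens x).
Proof.
move=> x0.
pose F t : R := (t / (1 + t)) `^ x.
pose f t : R := x * (t / (1 + t)) `^ (x - 1) * (1 + t) ^- 2.
have q0 t : 0 < t -> 0 < t / (1 + t) by move=> t0; rewrite divr_gt0//; lra.
have t1 t : 0 < t -> 1 + t != 0 by move=> t0; rewrite gt_eqF//; lra.
have If : mu.-integrable D0 (EFin \o f).
  apply: (@improper_FTC_0y_integrable _ F f 1).
  - move=> t t0; rewrite /F; deriv; [exact: q0|exact: t1|].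
    by rewrite /f; field; exact: t1.
  - move=> t t0; apply: d_continuous; rewrite /f.
    by deriv_rules; rewrite /= ?q0 ?expf_neq0 ?t1.
  - by move=> t t0; rewrite /f !mulr_ge0 ?powR_ge0 ?(ltW x0)// invr_ge0 sqr_ge0.
  - move=> t t0; rewrite /F powR_ge0/= powR_exp ?q0// -[X in _ <= X]expR0 ler_expR.
    by rewrite mulr_ge0_le0 ?(ltW x0)// ln_le0// ler_pdivrMr; lra.
have x1 : 0 < x + 1 by lra.
have [C hC] := powR_exp_bound x1.
have := integrableZl _ (C / x) If; rewrite /=.
move=> /(_ (measurable_itv _)); apply: le_integrable => //.
  by apply/measurable_EFinP; exact: measurable_edens.
move=> t /i0 t0; rewrite /= lee_fin ger0_norm ?(ltW (edens_gt0 _ t0))//.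
apply: le_trans (ler_norm _).
have t10 : 0 < 1 + t by lra.
have -> : C / x * f t = C * ((t / (1 + t)) `^ (x - 1) * (1 + t) ^- 2).
  by rewrite /f; field; rewrite ?gt_eqF.
rewrite /edens powRM ?invr_ge0 ?(ltW t0) ?(ltW t10)// -[_ * _ / _]mulrA.
have -> : (1 + t)^-1 `^ (x - 1) * (1 + t) ^- 2 = ((1 + t) `^ (x + 1))^-1.
  rewrite -powR_inv1 ?(ltW t10)// -powRrM mulN1r -!powR_mulrn ?(ltW t10)// -powRN.
  rewrite -powRD ?(gt_eqF t10) ?implybT// -powRN; congr (_ `^ _); lra.
rewrite [leRHS]mulrCA ler_wpM2l ?powR_ge0//.
by rewrite ler_pdivlMr ?powR_gt0// mulrC hC.
Qed.

Definition eul x : R := Rintegral mu D0 (edens x).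

Lemma CpowE x y t : 0 < t ->
  Cpow t ((x +i* y) - 1) * (expR (- t))%:C =
  (edens x t * cos (y * ln t)) +i* (edens x t * sin (y * ln t)).
Proof.
move=> t0; rewrite /edens; apply: CeqP; rewrite ?(cReM, cImM) ?ReCpow ?ImCpow//=;
  rewrite (powR_exp _ t0) !(mulr0, subr0, addr0, add0r); ring.
Qed.

Lemma normc_Cpow_edens x y t : 0 < t ->
  normc (Cpow t ((x +i* y) - 1) * (expR (- t))%:C) = edens x t.
Proof.
by move=> t0; rewrite normcM normc_Cpow// normc_real ger0_norm ?expR_ge0.
Qed.

Lemma measurable_edens_cos x y c :
  measurable_fun D0 (fun t => edens x t * cos (y * ln t + c)).
Proof.
apply: measurable_0y => t t0; apply: d_continuous; rewrite /edens.
by deriv_rules.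
Qed.

Lemma integrable_edens_cos x y c : 0 < x ->
  mu.-integrable D0 (EFin \o (fun t => edens x t * cos (y * ln t + c))).
Proof.
move=> x0; apply: le_integrable (integrable_edens x0) => //.
  by apply/measurable_EFinP; exact: measurable_edens_cos.
move=> t _; rewrite /= lee_fin normrM ler_piMr//.
by rewrite ler_norml cos_geN1 cos_le1.
Qed.

(** The phase treats the real part ([c = 0]) and the imaginary part ([c = - pi/2]) of
    the Euler integral together. *)
Definition eulc x y c : R := Rintegral mu D0 (fun t => edens x t * cos (y * ln t + c)).

Lemma sin_shift (z : R) : sin z = cos (z - pi / 2).
Proof. by rewrite cosB cos_pihalf sin_pihalf; ring. Qed.

Lemma Euler_integralE x y : Euler_integral (x +i* y) = eulc x y 0 +i* eulc x y (- (pi / 2)).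
Proof.
rewrite /Euler_integral (@eq_Cintegral _ _ _ mu D0 _ (fun t => (edens x t * cos (y * ln t)) +i* (edens x t * sin (y * ln t)))).
  apply: CeqP => /=; apply: eq_Rintegral => t _; first by rewrite addr0.
  by rewrite sin_shift.
by move=> t /i0 t0; rewrite CpowE.
Qed.

Lemma Euler_integral_real x : Euler_integral (x%:C : R[i]) = (eul x)%:C.
Proof.
rewrite -complexr0 Euler_integralE; apply: CeqP => /=.
  by apply: eq_Rintegral => t _ /=; rewrite mul0r addr0 cos0 mulr1.
rewrite /eulc; under eq_Rintegral do rewrite mul0r add0r cosN cos_pihalf mulr0.
by rewrite /Rintegral integral0.
Qed.

Lemma Cintegrable_Euler x y : 0 < x ->
  Cintegrable mu D0 (fun t => Cpow t ((x +i* y) - 1) * (expR (- t))%:C).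
Proof.
move=> x0; apply: (@eq_Cintegrable _ _ _ mu D0 (fun t => (edens x t * cos (y * ln t)) +i* (edens x t * sin (y * ln t)))).
- exact: measurable_itv.
- by move=> t /i0 t0; rewrite CpowE.
split.
  have := integrable_edens_cos y 0 x0; apply: eq_integrable => // t _ /=.
  by rewrite addr0.
by have := integrable_edens_cos y (- (pi / 2)) x0; apply: eq_integrable => // t _ /=;
  rewrite sin_shift.
Qed.

(** Integration by parts. *)
Lemma eulcS x y c : 0 < x -> eulc (x + 1) y c = x * eulc x y c - y * eulc x y (c - pi / 2).
Proof.
move=> x0; have x10 : 0 < x + 1 by lra.
have mD : measurable D0 by exact: measurable_itv.
have I1 := integrable_edens_cos y c x10.
have I2 := integrable_edens_cos y c x0.
have I3 := integrable_edens_cos y (c - pi / 2) x0.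
pose F t := edens (x + 1) t * cos (y * ln t + c).
pose f t := x * (edens x t * cos (y * ln t + c)) - y * (edens x t * cos (y * ln t + (c - pi / 2)))
  - edens (x + 1) t * cos (y * ln t + c).
have Ix := integrableZl mD x I2; have Iy := integrableZl mD y I3.
have Ixy := integrableB mD Ix Iy.
suff h : Rintegral mu D0 f = 0.
  apply/eqP; rewrite eq_sym -subr_eq0 -h /eulc -!RintegralZl// -!RintegralB//.
have Fb t : 0 < t -> `|F t| <= edens (x + 1) t.
  move=> t0; rewrite normrM ger0_norm ?(ltW (edens_gt0 _ t0))// ler_piMr ?(ltW (edens_gt0 _ t0))//.
  by rewrite ler_norml cos_geN1 cos_le1.
apply: (@improper_FTC_0y _ F f).
- move=> t t0; rewrite /F /edens; deriv => //.
  rewrite /f /edens addrA cosB cos_pihalf sin_pihalf addrK powR_exp// powR_exp//.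
  have -> : expR (x * ln t) = t * expR ((x - 1) * ln t).
    by rewrite -[X in _ = X * _]lnK ?posrE// -expRD; congr expR; ring.
  by field; rewrite gt_eqF.
- move=> t t0; apply: d_continuous; rewrite /f /edens; deriv_rules => //.
- have [C hC] := powR_exp_bound x10.
  have C0 : 0 <= C by apply: le_trans (hC 1 ltr01); rewrite mulr_ge0 ?powR_ge0 ?expR_ge0.
  have b1 n : `|F n.+2%:R| <= C * n.+2%:R^-1 `^ 1.
    have n0 : 0 < n.+2%:R :> R by [].
    apply: le_trans (Fb _ n0) _.
    rewrite powRr1 ?invr_ge0// ler_pdivlMr// mulrC /edens mulrA addrK -powRS//.
    apply: le_trans (hC _ n0); rewrite ler_wpM2r ?expR_ge0//.
    by apply: ge0_ler_powR; rewrite ?nnegrE ?(ltW x10)//; lra.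
  have b2 n : `|F n.+2%:R^-1| <= n.+2%:R^-1 `^ x.
    have n0 : 0 < n.+2%:R^-1 :> R by rewrite invr_gt0.
    apply: le_trans (Fb _ n0) _; rewrite /edens addrK.
    by apply: ler_piMr; rewrite ?powR_ge0// expR_le1 oppr_le0 ltW.
  have H : C * n.+2%:R^-1 `^ 1 + n.+2%:R^-1 `^ x @[n --> \oo] --> C * 0 + 0.
    apply: cvgD; last exact: cvg_powR_inv.
    by apply: cvgM; [exact: cvg_cst|exact: cvg_powR_inv].
  rewrite mulr0 addr0 in H; apply/norm_cvg0P; apply: squeeze_cvgr (cvg_cst _) H.
  by apply: nearW => n; rewrite normr_ge0/= (le_trans (ler_normB _ _))// lerD.
- exact: (integrableB mD Ixy I1).
Qed.

Lemma Euler_integralS x y : 0 < x ->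
  Euler_integral ((x + 1) +i* y) = (x +i* y) * Euler_integral (x +i* y).
Proof.
move=> x0; rewrite !Euler_integralE !eulcS// sub0r.
apply: CeqP; rewrite ?(cReM, cImM)/=; first by ring.
suff -> : eulc x y (- (pi / 2) - pi / 2) = - eulc x y 0 by ring.
rewrite /eulc -[RHS]mulN1r -RintegralZl//; last exact: integrable_edens_cos.
apply: eq_Rintegral => t _; rewrite addr0.
have -> : y * ln t + (- (pi / 2) - pi / 2) = y * ln t - pi by field.
by rewrite cosB cospi sinpi; ring.
Qed.

(** The density is bounded below by a constant on [[1, 2]]. *)
Lemma eul_gt0 x : 0 < x -> 0 < eul x.
Proof.
move=> x0; pose m := expR (- (`|x| + 1) - 2).
have m0 : 0 < m by exact: expR_gt0.
have I := integrable_edens x0.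
have I12 : mu.-integrable D0 (EFin \o (\1_(`[1, 2]%classic : set R) : R -> R)).
  apply: (integrableS measurableT) => //.
  exact: (@integrable_indic_itv R 1 2 true false).
apply: (@lt_le_trans _ _ (Rintegral mu D0 (fun t => m * \1_(`[1, 2]%classic : set R) t))).
  rewrite RintegralZl//.
  rewrite mulr_gt0// /Rintegral integral_indic// setIidl.
    by have := lebesgue_measure_itv (`[1, 2] : interval R); rewrite /= lte_fin ltr1n -EFinB => ->/=; lra.
  by move=> t /=; rewrite !in_itv/= => /andP[h _]; rewrite andbT (lt_le_trans _ h).
apply: le_Rintegral => //.
  exact: (integrableZl _ m I12).
move=> t /i0 t0; rewrite indicE.
case: (boolP (t \in (`[1, 2]%classic : set R))) => [/set_mem /=|_]; last first.
  by rewrite mulr0 ltW// edens_gt0.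
rewrite in_itv/= mulr1 => /andP[t1 t2].
rewrite /edens powR_exp// -expRD ler_expR.
have l0 : 0 <= ln t by exact: ln_ge0.
have l1 : ln t <= 1 by have := ln_le_sub1 t0; lra.
have := ler_norm (- x); rewrite normrN => nx.
have : 0 <= `|x| by [].
by nra.
Qed.

Lemma eulS x : 0 < x -> eul (x + 1) = x * eul x.
Proof.
move=> x0; apply: complexI; rewrite -Euler_integral_real -complexr0 Euler_integralS//.
by rewrite complexr0 Euler_integral_real -rmorphM.
Qed.

Lemma normc_Euler_le x y : 0 < x -> normc (Euler_integral (x +i* y)) <= 2 * eul x.
Proof.
move=> x0; apply: le_trans (normc_Cintegral_le _ (Cintegrable_Euler y x0)) _ => //.
rewrite ler_pM2l// le_eqVlt; apply/orP; left; apply/eqP; apply: eq_Rintegral => t /set_mem/i0 t0.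
exact: normc_Cpow_edens.
Qed.

(** For large [v] the density [edens v] concentrates around [t = v], where
    [t^(i y)] hardly rotates away from [v^(i y)].  Turned by [v^(- i y)], the integral
    has a real part at least that of [edens v t * (1 - (y ln (t / v))^2 / 2)], which
    [sqr_ln_le] bounds below in terms of [eul (v + 1)] and [eul (v - 1)]. *)
Lemma normc_Euler_ge v y : 1 < v ->
  eul v * (1 - 2 * y ^+ 2 / (v - 1)) <= normc (Euler_integral (v +i* y)).
Proof.
move=> v1; have v0 : 0 < v by lra.
have v10 : 0 < v - 1 by lra.
have mD : measurable D0 by exact: measurable_itv.
set c := - (y * ln v).
have -> : normc (Euler_integral (v +i* y)) = normc (Euler_integral (v +i* y) * Cexp (0 +i* c)).
  by rewrite normcM normc_Cexp_i mulr1.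
apply: (@le_trans _ _ (complex.Re (Euler_integral (v +i* y) * Cexp (0 +i* c)))); last first.
  by rewrite (le_trans (ler_norm _))// Re_le_normc.
rewrite Euler_integralE cReM ReCexp ImCexp /= expR0 !mul1r.
have -> : eulc v y 0 * cos c - eulc v y (- (pi / 2)) * sin c = eulc v y c.
  rewrite /eulc -!RintegralZr//; try exact: integrable_edens_cos.
  rewrite -RintegralB//; last 2 first.
  - have := integrableZl mD (cos c) (integrable_edens_cos y 0 v0).
    by apply: eq_integrable => // t _; rewrite /= -EFinM mulrC.
  - have := integrableZl mD (sin c) (integrable_edens_cos y (- (pi / 2)) v0).
    by apply: eq_integrable => // t _; rewrite /= -EFinM mulrC.
  by apply: eq_Rintegral => t _; rewrite -sin_shift addr0 cosD; ring.
have I0 := integrable_edens v0.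
have Ip : mu.-integrable D0 (EFin \o edens (v + 1)) by apply: integrable_edens; lra.
have Im := integrable_edens v10.
pose k := 2 * y ^+ 2.
have Z (a : R) (g : R -> R) : mu.-integrable D0 (EFin \o g) ->
    mu.-integrable D0 (EFin \o (fun t => a * g t)).
  by move=> Ig; exact: (integrableZl mD a Ig).
have -> : eul v * (1 - 2 * y ^+ 2 / (v - 1)) = Rintegral mu D0 (fun t =>
    (1 + 2 * k) * edens v t - (k / v * edens (v + 1) t + k * v * edens (v - 1) t)).
  rewrite RintegralB//; [|exact: Z|exact: (integrableD mD (Z (k / v) _ Ip) (Z (k * v) _ Im))].
  rewrite RintegralD//; [|exact: Z|exact: Z].
  rewrite !RintegralZl//.
  have e1 : Rintegral mu D0 (edens (v + 1)) = v * eul v := eulS v0.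
  have e2 : eul v = (v - 1) * Rintegral mu D0 (edens (v - 1)) by rewrite -[in LHS](subrK 1 v) eulS.
  rewrite e1 -/(eul v) e2 /k; field.
  by rewrite !gt_eqF.
apply: le_Rintegral => //.
- exact: (integrableB mD (Z (1 + 2 * k) _ I0) (integrableD mD (Z (k / v) _ Ip) (Z (k * v) _ Im))).
- exact: integrable_edens_cos.
move=> t /i0 t0; rewrite /c.
have -> : y * ln t - y * ln v = y * ln (t / v).
  by rewrite lnM ?posrE ?invr_gt0// lnV ?posrE//; ring.
have tv0 : 0 < t / v by rewrite divr_gt0.
have -> : edens (v + 1) t = t * edens v t.
  by rewrite /edens addrAC powRS// mulrA.
have -> : edens (v - 1) t = t^-1 * edens v t.
  rewrite /edens -[in RHS](subrK 1 (v - 1)) powRS//.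
  by field; rewrite gt_eqF.
have e0 := edens_gt0 v t0.
have -> : (1 + 2 * k) * edens v t - (k / v * (t * edens v t) + k * v * (t^-1 * edens v t)) =
    edens v t * (1 - k * (t / v + (t / v)^-1 - 2)).
  by field; rewrite !gt_eqF.
rewrite ler_wpM2l ?(ltW e0)//.
apply: le_trans (cos_ge _); rewrite lerD2l lerN2 exprMn.
have := ler_wpM2l (sqr_ge0 y) (sqr_ln_le tv0); rewrite /k; lra.
Qed.

End Euler.

(** * Stirling bounds on vertical lines *)
Section stirling.
Context {R : realType}.
Implicit Types (x y v w t c : R).

(** Stirling's formula for [|Gamma (v + i y) / Gamma v|^2] is replaced by a
    telescoping argument.  The functional equation multiplies this ratio by
    [exp (sL y v)] when [v] increases by 1; [sA] is a primitive of [- sL], so the sum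
    of the [sL y (v + k)] is estimated by the trapezoidal rule, with the correction
    [sL / 2] in [sPhi] and an error controlled by the derivative [- sdl] of [sL]. *)
Definition sL y v : R := ln (1 + (y / v) ^+ 2).
Definition sA y v : R := - v * sL y v + 2 * y * atan (y / v).
Definition sdl y v : R := 2 * y ^+ 2 / (v * (v ^+ 2 + y ^+ 2)).
Definition sPhi y v : R := sA y v + sL y v / 2.

Let q_gt0 (z : R) : 0 < 1 + z ^+ 2. Proof. by rewrite ltr_pwDl// sqr_ge0. Qed.
Let r_gt0 y v : 0 < v -> 0 < v ^+ 2 + y ^+ 2.
Proof. by move=> v0; rewrite ltr_pwDl ?sqr_ge0// exprn_gt0. Qed.

Lemma d_sL y v : 0 < v -> is_derive v 1 (sL y) (- sdl y v).
Proof.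
move=> v0; rewrite /sL; deriv; rewrite /= ?q_gt0 ?gt_eqF//.
by rewrite /sdl; field; rewrite !gt_eqF//= r_gt0.
Qed.

Lemma d_sA y v : 0 < v -> is_derive v 1 (sA y) (- sL y v).
Proof.
move=> v0; have dL := d_sL y v0; rewrite /sA; deriv; rewrite /= ?gt_eqF//.
by rewrite /sdl; field; rewrite !gt_eqF//= r_gt0.
Qed.

Lemma sdl_ge0 y v : 0 < v -> 0 <= sdl y v.
Proof.
move=> v0; apply: divr_ge0; first by rewrite mulr_ge0 ?sqr_ge0.
by rewrite mulr_ge0 ?(ltW v0) ?(ltW (r_gt0 _ v0)).
Qed.

Lemma sdl_le y v w : 0 < v -> v <= w -> sdl y w <= sdl y v.
Proof.
move=> v0 vw; have w0 : 0 < w by exact: lt_le_trans vw.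
apply: ler_wpM2l; first by rewrite mulr_ge0 ?sqr_ge0.
rewrite lef_pV2 ?posrE ?mulr_gt0 ?r_gt0//.
rewrite ler_pM ?(ltW v0) ?(ltW (r_gt0 _ v0))// lerD2r.
by rewrite lerXn2r ?nnegrE ?(ltW v0) ?(ltW w0).
Qed.

Lemma sdl_ub y v : 0 < v -> sdl y v <= 2 / v.
Proof.
move=> v0; rewrite /sdl ler_pdivrMr ?mulr_gt0 ?r_gt0//.
have -> : 2 / v * (v * (v ^+ 2 + y ^+ 2)) = 2 * (v ^+ 2 + y ^+ 2) by field; rewrite gt_eqF.
by rewrite ler_pM2l// lerDr sqr_ge0.
Qed.

(** The error of the trapezoidal rule on [[v, v + 1]] for the convex function [sL y]:
    it is the increment of [E], whose derivative is a difference of two slopes. *)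
Lemma sPhi_step y v : 0 < v ->
  0 <= sL y v + sPhi y (v + 1) - sPhi y v <= (sdl y v - sdl y (v + 1)) / 2.
Proof.
move=> v0; have v01 : v < v + 1 by lra.
pose E w := (w - v) * (sL y v + sL y w) / 2 - (sA y v - sA y w).
pose dE w := (sL y v - sL y w - (w - v) * sdl y w) / 2.
have -> : sL y v + sPhi y (v + 1) - sPhi y v = E (v + 1) - E v.
  by rewrite /E /sPhi; field.
have [w|w /andP[vw wv1] ->] := @MVT_is_derive R E dE v (v + 1) v01.
  move=> /andP[vw _]; have w0 : 0 < w by exact: lt_le_trans vw.
  have d1 := d_sL y w0; have d2 := d_sA y w0.
  by rewrite /E; deriv; rewrite /dE; field.
have [z|z /andP[vz zw] ezw] := @MVT_is_derive R (sL y) (fun z => - sdl y z) v w vw.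
  by move=> /andP[vz _]; apply: d_sL; exact: lt_le_trans vz.
have z0 : 0 < z by lra. have w0 : 0 < w by lra.
have h1 := sdl_le y z0 (ltW zw).
have h2 := sdl_le y v0 (ltW vz).
have h3 := sdl_le y w0 (ltW wv1).
have -> : dE w * (v + 1 - v) = (w - v) * (sdl y z - sdl y w) / 2.
  by rewrite /dE; move: ezw; lra.
apply/andP; split; first by rewrite !mulr_ge0//; lra.
rewrite ler_pM2r ?invr_gt0//.
have : (w - v) * (sdl y z - sdl y w) <= 1 * (sdl y z - sdl y w).
  by rewrite ler_wpM2r//; lra.
by lra.
Qed.

Definition srat y v : R := (normc (Euler_integral (v +i* y)) / eul v) ^+ 2.

Lemma srat_step y v : 0 < v -> srat y (v + 1) = srat y v * expR (sL y v).
Proof.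
move=> v0; rewrite /srat Euler_integralS// normcM eulS// /sL lnK ?posrE ?q_gt0//.
have e0 := eul_gt0 v0.
rewrite !exprMn !exprVn !exprMn normc_sqr/=; field.
by rewrite !gt_eqF.
Qed.

Lemma srat_ge0 y v : 0 <= srat y v. Proof. exact: sqr_ge0. Qed.

(** Since [sL] is convex, its trapezoidal sums overestimate: [srat * exp sPhi] increases
    along [v + n]. *)
Lemma srat_up y v n : 0 < v ->
  srat y v * expR (sPhi y v) <= srat y (v + n%:R) * expR (sPhi y (v + n%:R)).
Proof.
move=> v0; elim: n => [|n IH]; first by rewrite addr0.
apply: le_trans IH _.
have vn0 : 0 < v + n%:R by rewrite ltr_pwDl.
rewrite -natr1 addrA srat_step// -mulrA ler_wpM2l ?srat_ge0// -expRD ler_expR.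
by have /andP[h _] := sPhi_step y vn0; lra.
Qed.

(** The errors telescope as well: with [sdl / 2] added, the sequence decreases. *)
Lemma srat_down y v n : 0 < v ->
  srat y (v + n%:R) * expR (sPhi y (v + n%:R) + sdl y (v + n%:R) / 2) <=
  srat y v * expR (sPhi y v + sdl y v / 2).
Proof.
move=> v0; elim: n => [|n IH]; first by rewrite addr0.
apply: le_trans _ IH.
have vn0 : 0 < v + n%:R by rewrite ltr_pwDl.
rewrite -natr1 addrA srat_step// -mulrA ler_wpM2l ?srat_ge0// -expRD ler_expR.
by have /andP[_ h] := sPhi_step y vn0; lra.
Qed.

Lemma y_atan_ge0 y v : 0 < v -> 0 <= y * atan (y / v).
Proof.
move=> v0; wlog y0 : y / 0 <= y => [h|].
  have [/h//|/ltW y0] := leP 0 y.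
  by have := h (- y); rewrite [- y / v]mulNr atanN mulrNN oppr_ge0; apply.
by rewrite mulr_ge0// atan_ge0// divr_ge0// ltW.
Qed.

Lemma y_atan_le y v : 0 < v -> y * atan (y / v) <= y ^+ 2 / v.
Proof.
move=> v0; wlog y0 : y / 0 <= y => [h|].
  have [/h//|/ltW y0] := leP 0 y.
  by have := h (- y); rewrite [- y / v]mulNr atanN mulrNN oppr_ge0 sqrrN; apply.
by rewrite expr2 -mulrA ler_wpM2l// atan_le// divr_ge0// ltW.
Qed.

Lemma y_atan_abs y v : 0 < v ->
  pi / 2 * `|y| - v <= y * atan (y / v) <= pi / 2 * `|y|.
Proof.
move=> v0; wlog y0 : y / 0 <= y => [h|].
  have [/h//|/ltW y0] := leP 0 y.
  by have := h (- y); rewrite [- y / v]mulNr atanN mulrNN oppr_ge0 normrN; apply.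
rewrite ger0_norm//; move: y0; rewrite le_eqVlt => /predU1P[<-|y0].
  by rewrite mulr0 mul0r sub0r oppr_le0 ltW/=.
rewrite [pi / 2 * y]mulrC; apply/andP; split; last first.
  by rewrite ler_wpM2l ?(ltW y0)// ltW// atan_ltpi2.
have := @atan_ge R (y / v) (divr_gt0 y0 v0) => h.
have -> : y * (pi / 2) - v = y * (pi / 2 - (y / v)^-1) by field; rewrite !gt_eqF.
by rewrite ler_wpM2l ?(ltW y0).
Qed.

Lemma sL_ge0 y v : 0 <= sL y v.
Proof. by rewrite ln_ge0// lerDl sqr_ge0. Qed.

Lemma sL_le y v : sL y v <= (y / v) ^+ 2.
Proof. by apply: le_ln1Dx; have := sqr_ge0 (y / v); lra. Qed.

(** All terms of [sPhi] are at most of order [y^2 / v]. *)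
Lemma sPhi_large y v : 1 <= v -> y ^+ 2 <= v -> -1 <= sPhi y v <= 2.
Proof.
move=> v1 yv; have v0 : 0 < v by lra.
have h1 := sL_ge0 y v; have h2 := y_atan_ge0 y v0; have h3 := y_atan_le y v0.
have h4 : v * sL y v <= y ^+ 2 / v.
  apply: le_trans (ler_wpM2l (ltW v0) (sL_le y v)) _.
  by rewrite le_eqVlt; apply/orP; left; apply/eqP; field; rewrite gt_eqF.
have h5 : y ^+ 2 / v <= 1 by rewrite ler_pdivrMr// mul1r.
have h6 : sL y v <= v * sL y v by rewrite ler_peMl.
by rewrite /sPhi /sA mulNr; apply/andP; split; lra.
Qed.

(** Move to [w = v + n] with [4 y^2 + 2 < n]: there the ratio lies between [1/4] and [4]
    by [normc_Euler_ge] and the triangle inequality, and [srat_up] and [srat_down]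
    bring the bounds back to [v]. *)
Lemma srat_bounds y v : 0 < v ->
  expR (- 1 - v^-1) / 4 <= srat y v * expR (sPhi y v) <= 4 * expR 2.
Proof.
move=> v0.
have half z : 4 * y ^+ 2 + 2 <= z -> 2^-1 <= 1 - 2 * y ^+ 2 / (z - 1).
  move=> yz; have y2 := sqr_ge0 y; have z1 : 0 < z - 1 by lra.
  have : 2 * y ^+ 2 / (z - 1) <= 1 / 2 by rewrite ler_pdivrMr//; lra.
  lra.
pose n := (Num.truncn (4 * y ^+ 2 + 2)).+1.
have nE : 4 * y ^+ 2 + 2 < n%:R by exact: truncnS_gt.
have y20 := sqr_ge0 y.
set w := v + n%:R.
have w0 : 0 < w by rewrite /w; lra.
have w1 : 1 < w by rewrite /w; lra.
have /andP[p1 p2] : -1 <= sPhi y w <= 2 by apply: sPhi_large; rewrite /w; lra.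
have ew := eul_gt0 w0.
apply/andP; split; last first.
  apply: le_trans (srat_up y n v0) _; rewrite -/w ler_pM ?expR_ge0 ?srat_ge0 ?ler_expR//.
  have -> : 4 = 2 ^+ 2 :> R by ring.
  rewrite lerXn2r ?nnegrE ?divr_ge0 ?normc_ge0 ?(ltW ew)//.
  by rewrite ler_pdivrMr// normc_Euler_le.
have h := srat_down y n v0; rewrite -/w in h.
have s1 : 4^-1 <= srat y w.
  have -> : 4^-1 = (2^-1) ^+ 2 :> R by field.
  rewrite lerXn2r ?nnegrE ?divr_ge0 ?normc_ge0 ?(ltW ew)//.
  rewrite ler_pdivlMr// mulrC; apply: le_trans (normc_Euler_ge y w1).
  by rewrite ler_wpM2l ?(ltW ew)//; apply: half; rewrite /w; lra.
have k1 : 4^-1 * expR (- 1) <= srat y v * expR (sPhi y v + sdl y v / 2).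
  apply: le_trans h; rewrite ler_pM ?invr_ge0 ?expR_ge0// ler_expR.
  by have := sdl_ge0 y w0; lra.
have k2 : srat y v * expR (sPhi y v + sdl y v / 2) <= srat y v * expR (sPhi y v) * expR (v^-1).
  rewrite -mulrA ler_wpM2l ?srat_ge0// -expRD ler_expR lerD2l.
  by rewrite ler_pdivrMr// [leRHS]mulrC sdl_ub.
have -> : expR (- 1 - v^-1) / 4 = 4^-1 * expR (- 1) / expR (v^-1).
  by rewrite expRD [expR (- v^-1)]expRN; ring.
by rewrite ler_pdivrMr ?expR_gt0//; exact: le_trans k1 k2.
Qed.

(** [(1 + t^2)^e exp (- k |t|)], as an exponential so that products add exponents. *)
Definition stir (e k t : R) : R := expR (e * ln (1 + t ^+ 2) - k * `|t|).

Lemma stir_gt0 e k t : 0 < stir e k t. Proof. exact: expR_gt0. Qed.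

Lemma stirM e k e' k' t : stir e k t * stir e' k' t = stir (e + e') (k + k') t.
Proof. by rewrite /stir -expRD; congr expR; ring. Qed.

Lemma ln_compare (k t : R) : 0 < k ->
  `|ln (1 + k * t ^+ 2) - ln (1 + t ^+ 2)| <= `|ln k|.
Proof.
move=> k0; have t0 := sqr_ge0 t.
have q1 : 0 < 1 + t ^+ 2 by exact: q_gt0.
have kt : 0 <= k * t ^+ 2 by rewrite mulr_ge0// ltW.
have q2 : 0 < 1 + k * t ^+ 2 by lra.
have [k1|k1] := leP 1 k.
  have a1 : ln (1 + t ^+ 2) <= ln (1 + k * t ^+ 2).
    by rewrite ler_ln ?posrE// lerD2l ler_peMl.
  have a2 : ln (1 + k * t ^+ 2) <= ln k + ln (1 + t ^+ 2).
    rewrite -lnM ?posrE// ler_ln ?posrE ?mulr_gt0//; nra.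
  by rewrite ger0_norm ?ger0_norm ?ln_ge0//; lra.
have a1 : ln (1 + k * t ^+ 2) <= ln (1 + t ^+ 2).
  by rewrite ler_ln ?posrE// lerD2l ler_piMl// ltW.
have a2 : ln k + ln (1 + t ^+ 2) <= ln (1 + k * t ^+ 2).
  rewrite -lnM ?posrE// ler_ln ?posrE ?mulr_gt0//; nra.
have : ln k <= 0 by apply: ln_le0; exact: ltW.
by move=> h; rewrite (ler0_norm h) ler0_norm; lra.
Qed.

(** [v] fixed and [y] large: [2 y atan (y / v)] is [pi |y|] up to a bounded term. *)
Lemma sPhi_approx x be : 0 < x -> 0 < be -> exists C, forall t,
  `|sPhi (be * t) x - (pi * be * `|t| - (x - 2^-1) * ln (1 + t ^+ 2))| <= C.
Proof.
move=> x0 b0; exists (`|x - 2^-1| * `|ln ((be / x) ^+ 2)| + 2 * x) => t.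
have k0 : 0 < (be / x) ^+ 2 by rewrite exprn_gt0// divr_gt0.
have := ln_compare t k0.
have -> : 1 + (be / x) ^+ 2 * t ^+ 2 = 1 + (be * t / x) ^+ 2 by field; rewrite gt_eqF.
rewrite -/(sL _ _) => h.
have /andP[h1 h2] := y_atan_abs (be * t) x0.
rewrite normrM (gtr0_norm b0) in h1 h2.
set l := ln (1 + t ^+ 2) in h *.
have -> : sPhi (be * t) x - (pi * be * `|t| - (x - 2^-1) * l) =
  - (x - 2^-1) * (sL (be * t) x - l) + 2 * (be * t * atan (be * t / x) - pi / 2 * (be * `|t|)).
  by rewrite /sPhi /sA; field.
apply: le_trans (ler_normD _ _) _; apply: lerD.
  by rewrite normrM normrN ler_wpM2l.
by rewrite normrM ger0_norm// ler_pM2l// ler_norml; lra.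
Qed.

Definition decays (e k : R) (f : R -> R[i]) :=
  exists2 C, 0 < C & forall t, normc (f t) <= C * stir e k t.

Lemma decaysM e k e' k' f g : decays e k f -> decays e' k' g ->
  decays (e + e') (k + k') (fun t => f t * g t).
Proof.
move=> [C C0 hf] [C' C'0 hg]; exists (C * C'); first exact: mulr_gt0.
move=> t; rewrite normcM -stirM mulrACA ler_pM ?normc_ge0//.
Qed.

Lemma decays1 : decays 0 0 (fun=> 1).
Proof.
by exists 1 => // t; rewrite normc1 /stir !mul0r subr0 expR0 mulr1.
Qed.

Lemma decays_prod (I : Type) (r : seq I) (e k : I -> R) (f : I -> R -> R[i]) :
  (forall i, decays (e i) (k i) (f i)) ->
  decays (\sum_(i <- r) e i) (\sum_(i <- r) k i) (fun t => \prod_(i <- r) f i t).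
Proof.
move=> hf; elim: r => [|i r IH].
  rewrite !big_nil; case: decays1 => C C0 h; exists C => // t.
  by rewrite big_nil.
rewrite !big_cons; have [C C0 h] := decaysM (hf i) IH; exists C => // t.
by rewrite big_cons.
Qed.

Lemma Euler_neq0 x y : 0 < x -> Euler_integral (x +i* y) != 0.
Proof.
move=> x0; have /andP[h _] := srat_bounds y x0.
apply/eqP => e0; move: h; rewrite /srat e0 normc0 mul0r expr0n/= mul0r leNgt.
by rewrite divr_gt0 ?expR_gt0.
Qed.

(** Square roots of [srat_bounds], with [sPhi] replaced by its asymptotics. *)
Lemma Euler_decays x be : 0 < x -> 0 < be ->
  decays ((x - 2^-1) / 2) (pi * be / 2) (fun t => Euler_integral (x +i* (be * t))) /\
  decays (- ((x - 2^-1) / 2)) (- (pi * be / 2)) (fun t => (Euler_integral (x +i* (be * t)))^-1).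
Proof.
move=> x0 b0; have [C hC] := sPhi_approx x0 b0.
have e0 := eul_gt0 x0.
pose M t := pi * be * `|t| - (x - 2^-1) * ln (1 + t ^+ 2).
have stE t : stir ((x - 2^-1) / 2) (pi * be / 2) t ^+ 2 = expR (- M t).
  by rewrite /stir -expRM_natl; congr expR; rewrite /M; field.
have stI t : stir (- ((x - 2^-1) / 2)) (- (pi * be / 2)) t = (stir ((x - 2^-1) / 2) (pi * be / 2) t)^-1.
  by rewrite /stir -expRN; congr expR; ring.
have nE t : normc (Euler_integral (x +i* (be * t))) ^+ 2 = eul x ^+ 2 * srat (be * t) x.
  by rewrite /srat exprMn; field; rewrite gt_eqF.
split.
  exists (eul x * 2 * expR 1 * expR (C / 2)); first by rewrite !mulr_gt0 ?expR_gt0.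
  move=> t; rewrite -ler_sqr ?nnegrE ?normc_ge0 ?mulr_ge0 ?expR_ge0 ?(ltW e0)//.
  rewrite nE [leRHS]exprMn stE.
  have -> : (eul x * 2 * expR 1 * expR (C / 2)) ^+ 2 * expR (- M t) =
    eul x ^+ 2 * (4 * (expR 1 ^+ 2 * expR (C / 2) ^+ 2 * expR (- M t))) by ring.
  rewrite -[expR 1 ^+ 2]expRM_natl -[expR (C / 2) ^+ 2]expRM_natl.
  rewrite ler_wpM2l ?sqr_ge0//.
  have /andP[_ h] := srat_bounds (be * t) x0.
  rewrite -(ler_pM2r (expR_gt0 (sPhi (be * t) x))) (le_trans h)//.
  have := hC t; rewrite -/(M t) ler_norml => /andP[h1 h2].
  rewrite -[leRHS]mulrA -!expRD.
  by rewrite ler_pM2l// ler_expR; lra.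
exists ((eul x)^-1 * 2 * expR (2^-1 * (1 + x^-1)) * expR (C / 2)).
  by rewrite !mulr_gt0 ?expR_gt0 ?invr_gt0.
move=> t; rewrite stI normcV.
set N := normc _; have N0 : 0 < N by rewrite normc_gt0 Euler_neq0.
set S := stir _ _ _; have S0 : 0 < S by exact: expR_gt0.
rewrite ler_pdivlMr// mulrC ler_pdivrMr// mulrC -ler_sqr ?nnegrE ?mulr_ge0 ?expR_ge0 ?invr_ge0 ?(ltW e0) ?(ltW S0) ?(ltW N0)//.
rewrite stE exprMn nE !exprMn exprVn -!expRM_natl.
set r := srat _ _; have r0 : 0 <= r by exact: srat_ge0.
have -> : expR (2%:R * (2^-1 * (1 + x^-1))) = expR (1 + x^-1).
  by congr expR; field; rewrite gt_eqF.
have -> : expR (2%:R * (C / 2)) = expR C by congr expR; field.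
have -> : eul x ^+ 2 * r * ((eul x ^+ 2)^-1 * 2 ^+ 2 * expR (1 + x^-1) * expR C) =
    r * 4 * expR (1 + x^-1 + C).
  by rewrite [expR (_ + C)]expRD; move: r r0 => r r0; field; rewrite gt_eqF.
have /andP[h _] := srat_bounds (be * t) x0.
rewrite -/r ler_pdivrMr// in h.
have := hC t; rewrite -/(M t) ler_norml => /andP[h1 h2].
have h3 := ler_wpM2r (expR_ge0 (1 + x^-1 + C - sPhi (be * t) x)) h.
rewrite -expRD in h3.
apply: (@le_trans _ _ (expR (-1 - x^-1 + (1 + x^-1 + C - sPhi (be * t) x)))).
  by rewrite ler_expR; lra.
apply: le_trans h3 _; rewrite le_eqVlt; apply/orP; left; apply/eqP.
by rewrite [expR (1 + x^-1 + C - _)]expRD expRN; field; rewrite gt_eqF// expR_gt0.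
Qed.

End stirling.

(** * Quotients of Gamma functions on vertical lines *)
Section Gamma_lines.
Context {R : realType}.
Notation mu := (@lebesgue_measure R).
Implicit Types (x y t c e k : R) (s z : R[i]).

Lemma ReDn s (n : nat) : complex.Re (s + n%:R) = complex.Re s + n%:R.
Proof. by rewrite cReD -(rmorph_nat (real_complex R)). Qed.

Lemma GammaE s : 0 < complex.Re s -> Gamma s = Euler_integral s.
Proof. by rewrite /Gamma => ->. Qed.

Lemma EulerS s : 0 < complex.Re s -> Euler_integral (s + 1) = s * Euler_integral s.
Proof.
case: s => x y /= x0; rewrite -Euler_integralS//; congr Euler_integral.
by apply: CeqP; rewrite ?cReD ?cImD/= ?addr0.
Qed.

Lemma Euler_integral_neq0 s : 0 < complex.Re s -> Euler_integral s != 0.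
Proof. by case: s => x y x0; exact: Euler_neq0. Qed.

Lemma Re_neq0 s : 0 < complex.Re s -> s != 0.
Proof. by move=> s0; apply/eqP => s00; move: s0; rewrite s00 /= ltxx. Qed.

(** The choice of [N] is immaterial by the functional equation.  At a pole of [Gamma]
    both sides are 0, the product having a zero factor. *)
Lemma inv_Gamma s (N : nat) : 0 < complex.Re s + N%:R ->
  (Gamma s)^-1 = (\prod_(k < N) (s + k%:R)) / Euler_integral (s + N%:R).
Proof.
have key (n m : nat) : 0 < complex.Re s + n%:R ->
    (\prod_(k < n + m) (s + k%:R)) / Euler_integral (s + (n + m)%:R) =
    (\prod_(k < n) (s + k%:R)) / Euler_integral (s + n%:R).
  move=> sn; elim: m => [|m IH]; first by rewrite addn0.
  rewrite -IH addnS big_ord_recr/=.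
  have h : 0 < complex.Re (s + (n + m)%:R).
    by rewrite ReDn natrD addrA ltr_wpDr.
  rewrite -natr1 addrA EulerS//.
  move: (s + (n + m)%:R) h => w h; have w0 := Re_neq0 h; have E0 := Euler_integral_neq0 h.
  by field; rewrite w0 E0.
move=> sN; rewrite /Gamma; case: ifPn => [s0|]; last rewrite -leNgt => s0.
  by rewrite -[N]add0n key ?addr0// big_ord0 div1r.
set n := (Num.truncn (- complex.Re s)).+1.
have sn : 0 < complex.Re s + n%:R.
  by rewrite -ltrBlDl sub0r truncnS_gt.
have nN : (n <= N)%N.
  rewrite /n -(ltr_nat R); apply: le_lt_trans (_ : - complex.Re s < _); last by lra.
  by rewrite truncn_le// oppr_ge0.
by rewrite -(subnKC nN) key// invf_div.
Qed.

Definition Ccontinuous (f : R -> R[i]) :=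
  continuous (fun t => complex.Re (f t)) /\ continuous (fun t => complex.Im (f t)).

Lemma CcontinuousM f g : Ccontinuous f -> Ccontinuous g -> Ccontinuous (fun t => f t * g t).
Proof.
move=> [f1 f2] [g1 g2]; split => t.
  under eq_fun do rewrite cReM.
  by apply: cvgB; apply: cvgM; [exact: f1|exact: g1|exact: f2|exact: g2].
under eq_fun do rewrite cImM.
by apply: cvgD; apply: cvgM; [exact: f1|exact: g2|exact: f2|exact: g1].
Qed.

Lemma Ccontinuous_cst z : Ccontinuous (fun=> z).
Proof. by split => t; exact: cvg_cst. Qed.

Lemma Ccontinuous_prod (I : Type) (r : seq I) (f : I -> R -> R[i]) :
  (forall i, Ccontinuous (f i)) -> Ccontinuous (fun t => \prod_(i <- r) f i t).
Proof.
move=> cf; elim: r => [|i r IH].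
  by rewrite (_ : (fun t => _) = fun=> 1); [exact: Ccontinuous_cst|apply/funext => t; rewrite big_nil].
rewrite (_ : (fun t => _) = fun t => f i t * \prod_(i <- r) f i t); first exact: CcontinuousM.
by apply/funext => t; rewrite big_cons.
Qed.

Lemma Ccontinuous_inv f : (forall t, f t != 0) -> Ccontinuous f ->
  Ccontinuous (fun t => (f t)^-1).
Proof.
move=> f0 [f1 f2].
have n0 t : complex.Re (f t) ^+ 2 + complex.Im (f t) ^+ 2 != 0.
  by rewrite -normc_sqr expf_neq0// gt_eqF// normc_gt0.
have nc : continuous (fun t => (complex.Re (f t) ^+ 2 + complex.Im (f t) ^+ 2)^-1).
  move=> t; apply: cvgV; first exact: n0.
  by apply: cvgD; apply: cvgM; [exact: f1|exact: f1|exact: f2|exact: f2].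
split => t.
  rewrite (_ : (fun t => _) = fun t => complex.Re (f t) *
      (complex.Re (f t) ^+ 2 + complex.Im (f t) ^+ 2)^-1).
    by apply: cvgM; [exact: f1|exact: nc].
  by apply/funext => u; case: (f u).
rewrite (_ : (fun t => _) = fun t => - complex.Im (f t) *
    (complex.Re (f t) ^+ 2 + complex.Im (f t) ^+ 2)^-1).
  by apply: cvgM; [apply: cvgN; exact: f2|exact: nc].
by apply/funext => u; case: (f u) => a b /=; rewrite mulNr.
Qed.

Lemma Ccontinuous_measurable f : Ccontinuous f -> Cmeasurable setT f.
Proof. by move=> [f1 f2]; exact: Cmeasurable_continuous. Qed.

Lemma Ccontinuous_Euler x be : 0 < x -> Ccontinuous (fun t => Euler_integral (x +i* (be * t))).
Proof.
move=> x0.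
have key c : continuous (fun t => eulc x (be * t) c).
  apply: (@continuous_Rintegral _ _ R mu _ _ (fun t u => edens x u * cos (be * t * ln u + c)) (edens x)).
  - exact: measurable_itv.
  - by move=> t; exact: measurable_edens_cos.
  - exact: integrable_edens.
  - move=> t u; rewrite /= in_itv/= andbT => u0.
    rewrite normrM ger0_norm ?(ltW (edens_gt0 _ u0))// ler_piMr ?(ltW (edens_gt0 _ u0))//.
    by rewrite ler_norml cos_geN1 cos_le1.
  - by move=> u _ t; apply: d_continuous; deriv_rules.
by split => t; under eq_fun do rewrite Euler_integralE /=; exact: key.
Qed.

Lemma lineE (b be c t : R) : b%:C + be%:C * (c +i* t) = (b + be * c) +i* (be * t).
Proof. by apply: CeqP; rewrite ?cReD ?cImD ?cReM ?cImM/=; ring. Qed.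

Lemma Gamma_line (b be c : R) : 0 < be -> 0 < b + be * c ->
  let f t := Gamma (b%:C + be%:C * (c +i* t)) in
  Ccontinuous f /\ decays ((b + be * c - 2^-1) / 2) (pi * be / 2) f.
Proof.
move=> be0 x0 f.
have -> : f = fun t => Euler_integral ((b + be * c) +i* (be * t)).
  by apply/funext => t; rewrite /f lineE GammaE.
split; first exact: Ccontinuous_Euler.
by have [] := Euler_decays x0 be0.
Qed.

(** Each linear factor contributes 1/2 to the exponent of [1 + t^2]. *)
Lemma affine_decays (a al : R) : 
  let f t := a +i* (al * t) in
  Ccontinuous f /\ decays 2^-1 0 f.
Proof.
split.
  by split => t /=; [exact: cvg_cst|apply: d_continuous; deriv_rules].
exists (`|a| + `|al| + 1); first by rewrite ltr_wpDl// addr_ge0.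
move=> t; rewrite /stir mul0r subr0 (le_trans (normc_le_ReIm _))//=.
have q0 : 0 < 1 + t ^+ 2 by rewrite ltr_pwDl// sqr_ge0.
have s1 : 1 <= expR (2^-1 * ln (1 + t ^+ 2)).
  rewrite -[X in X <= _]expR0 ler_expR mulr_ge0// ln_ge0// lerDl sqr_ge0//.
have s2 : `|t| <= expR (2^-1 * ln (1 + t ^+ 2)).
  rewrite -ler_sqr ?nnegrE ?expR_ge0// -expRM_natl mulrA mulfV// mul1r lnK ?posrE//.
  by rewrite real_normK ?num_real// lerDr.
set E := expR _ in s1 s2 *; rewrite normrM !mulrDl mul1r -addrA.
apply: lerD; first by rewrite ler_peMr.
apply: ler_wpDr; first exact: expR_ge0.
by rewrite ler_wpM2l.
Qed.

Lemma inv_Gamma_line (a al c : R) : 0 < al ->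
  let f t := (Gamma (a%:C + al%:C * (c +i* t)))^-1 in
  Ccontinuous f /\ decays (- ((a + al * c - 2^-1) / 2)) (- (pi * al / 2)) f.
Proof.
move=> al0 f; set x := a + al * c.
pose N := (Num.truncn (- x)).+1.
have xN : 0 < x + N%:R.
  have [x0|x0] := ltP 0 x; first by rewrite addr_gt0.
  by rewrite -ltrBlDl sub0r truncnS_gt.
have -> : f = fun t => (\prod_(k < N) ((x + k%:R) +i* (al * t))) *
    (Euler_integral ((x + N%:R) +i* (al * t)))^-1.
  apply/funext => t; rewrite /f lineE (@inv_Gamma _ N)//.
  have e (n : nat) : x +i* (al * t) + n%:R = (x + n%:R) +i* (al * t).
    by apply: CeqP; rewrite -(rmorph_nat (real_complex R)) ?cReD ?cImD/= ?addr0.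
  by rewrite e; congr (_ / _); apply: eq_bigr => k _; rewrite e.
split.
  apply: CcontinuousM.
    by apply: Ccontinuous_prod => k; have [] := affine_decays (x + (nat_of_ord k)%:R) al.
  by apply: Ccontinuous_inv => [t|]; [exact: Euler_neq0|exact: Ccontinuous_Euler].
have h1 := @decays_prod R _ (index_enum 'I_N) _ _ _
  (fun k : 'I_N => (affine_decays (x + (nat_of_ord k)%:R) al).2).
have [_ h2] := Euler_decays xN al0.
have := decaysM h1 h2; rewrite !sumr_const card_ord mul0rn add0r.
have -> // : 2^-1 *+ N - (x + N%:R - 2^-1) / 2 = - ((x - 2^-1) / 2).
by rewrite -mulr_natl; field.
Qed.

Section quotient.
Variables (p m : nat) (a alpha : 'I_p -> R) (b beta : 'I_m -> R) (c : R).
Hypothesis al0 : forall i, 0 < alpha i.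
Hypothesis be0 : forall j, 0 < beta j.
Hypothesis bc0 : forall j, 0 < b j + beta j * c.

Definition a_star : R := \sum_(j < m) beta j - \sum_(i < p) alpha i.
Definition mu_par : R := \sum_(j < m) b j - \sum_(i < p) a i + (p%:R - m%:R) / 2.

(** The exponents of the factors add up. *)
Lemma Gamma_quotient_line :
  let f t := Gamma_quotient a alpha b beta (c +i* t) in
  Ccontinuous f /\ decays ((mu_par + c * a_star) / 2) (pi * a_star / 2) f.
Proof.
rewrite /Gamma_quotient /=.
have -> : (fun t : R => (\prod_(j < m) Gamma ((b j)%:C + (beta j)%:C * (c +i* t))) /
    (\prod_(i < p) Gamma ((a i)%:C + (alpha i)%:C * (c +i* t)))) =
  (fun t : R => (\prod_(j < m) Gamma ((b j)%:C + (beta j)%:C * (c +i* t))) *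
    (\prod_(i < p) (Gamma ((a i)%:C + (alpha i)%:C * (c +i* t)))^-1)).
  by apply/funext => t; rewrite prodfV.
have N j := Gamma_line (be0 j) (bc0 j).
have D i := inv_Gamma_line (a i) c (al0 i).
split.
  apply: CcontinuousM.
    by apply: Ccontinuous_prod => j; have [] := N j.
  by apply: Ccontinuous_prod => i; have [] := D i.
have h1 := @decays_prod R _ (index_enum 'I_m) _ _ _ (fun j => (N j).2).
have h2 := @decays_prod R _ (index_enum 'I_p) _ _ _ (fun i => (D i).2).
have := decaysM h1 h2.
have -> : \sum_(j < m) (b j + beta j * c - 2^-1) / 2 + \sum_(i < p) - ((a i + alpha i * c - 2^-1) / 2) =
    (mu_par + c * a_star) / 2.
  rewrite sumrN -!mulr_suml !(sumrB, big_split)/= -!mulr_suml !sumr_const !card_ord.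
  by rewrite /mu_par /a_star -!(mulr_natl 2^-1); field.
have -> // : \sum_(j < m) pi * beta j / 2 + \sum_(i < p) - (pi * alpha i / 2) = pi * a_star / 2.
rewrite sumrN -!mulr_suml -!mulr_sumr /a_star; ring.
Qed.

End quotient.

Lemma integrable_stir e : e < - 2^-1 -> mu.-integrable setT (EFin \o stir e 0).
Proof.
move=> e2; pose ep := - 2 * e - 1; have ep0 : 0 < ep by rewrite /ep; lra.
have cf : continuous (stir e 0).
  rewrite (_ : stir e 0 = fun t => expR (e * ln (1 + t ^+ 2))); last first.
    by apply/funext => t; rewrite /stir mul0r subr0.
  move=> t; apply: d_continuous; deriv_rules => /=.
  by rewrite ltr_pwDl// sqr_ge0.
apply/integrableP; split.
  by apply/measurable_EFinP; exact: continuous_measurable_fun.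
under eq_integral => t _ do rewrite /= ger0_norm ?(ltW (stir_gt0 _ _ _))//.
rewrite ge0_symfun_integralT//; last 2 first.
- by move=> t; exact/ltW/stir_gt0.
- by move=> t; rewrite /stir /= sqrrN !mul0r.
rewrite lte_mul_pinfty// ?lee_fin//.
rewrite -set_itvcy -integral_itv_obnd_cbnd//; last first.
  by apply/measurable_EFinP/measurable_funTS; exact: continuous_measurable_fun.
pose F t : R := 1 - (1 + t) `^ (- ep).
pose f t : R := ep * (1 + t) `^ (- ep - 1).
have If : mu.-integrable `]0, +oo[ (EFin \o f).
  apply: (@improper_FTC_0y_integrable _ F f 1).
  - move=> t t0; have t10 : 0 < 1 + t by lra.
    by rewrite /F; deriv => //; rewrite /f; ring.
  - move=> t t0; have t10 : 0 < 1 + t by lra.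
    exact: d_continuous (d_mul (d_cst ep t) (d_powR (- ep - 1) t10 (d_add (d_cst 1 t) (d_id t)))).
  - by move=> t t0; rewrite /f mulr_ge0 ?powR_ge0// ltW.
  - move=> t t0; rewrite /F gerBl powR_ge0 andbT subr_ge0.
    rewrite powR_exp; last by lra.
    rewrite -[X in _ <= X]expR0 ler_expR mulNr oppr_le0 mulr_ge0 ?(ltW ep0)// ln_ge0//; lra.
have mD : measurable (`]0, +oo[%classic : set (measurableTypeR R)) by exact: measurable_itv.
have I2 : mu.-integrable `]0, +oo[ (EFin \o stir e 0).
  have := integrableZl mD (expR (- e * ln 2) / ep) If.
  apply: le_integrable => //.
    by apply/measurable_EFinP/measurable_funTS; exact: continuous_measurable_fun.
  move=> t; rewrite /= in_itv/= andbT => t0; rewrite lee_fin ger0_norm ?(ltW (stir_gt0 _ _ _))//.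
  apply: le_trans (ler_norm _).
  have t10 : 0 < 1 + t by lra.
  have q0 : 0 < 1 + t ^+ 2 by rewrite ltr_pwDl// sqr_ge0.
  rewrite /f mulrA divfK ?gt_eqF// powR_exp// -expRD ler_expR /stir mul0r subr0.
  have : 2 * ln (1 + t) <= ln 2 + ln (1 + t ^+ 2).
    rewrite -lnM ?posrE// mulr_natl mulr2n -lnM ?posrE// ler_ln ?posrE ?mulr_gt0//.
    by have := sqr_ge0 (t - 1); lra.
  by rewrite /ep; nra.
exact: (integrable_lty mD I2).
Qed.

Lemma stir_le1 e t : e <= 0 -> stir e 0 t <= 1.
Proof.
move=> e0; rewrite -expR0 ler_expR mul0r subr0 mulr_le0_ge0// ln_ge0//.
by rewrite lerDl sqr_ge0.
Qed.

(** The exponential absorbs the power: [q ln (1 + |t|) <= k |t| + const] for every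
    [q]. *)
Lemma stir_dominated e k : 0 < k \/ k = 0 /\ e < - 2^-1 ->
  exists C e', [/\ 0 < C, e' < - 2^-1 & forall t, stir e k t <= C * stir e' 0 t].
Proof.
move=> [k0|[-> e0]]; last first.
  by exists 1, e; split => // t; rewrite mul1r.
pose q := 2 * (`|e + 1| + 1); have q0 : 0 < q by rewrite /q mulr_gt0// ltr_wpDl.
exists (expR (k - q + q * ln (q / k))), (-1); split; [exact: expR_gt0|lra|].
move=> t; rewrite /stir -expRD ler_expR mul0r subr0.
set l := ln _.
have t0 : 0 <= `|t| by [].
have t10 : 0 < 1 + `|t| by lra.
have q1 : 0 < 1 + t ^+ 2 by rewrite ltr_pwDl// sqr_ge0.
have l0 : 0 <= l by rewrite ln_ge0// lerDl sqr_ge0.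
have l2 : l <= 2 * ln (1 + `|t|).
  rewrite mulr_natl mulr2n -lnM ?posrE// ler_ln ?posrE ?mulr_gt0//.
  rewrite -(real_normK (num_real t)); nra.
have A0 : 0 < q / k by rewrite divr_gt0.
have := ln_le_sub1 (divr_gt0 t10 A0).
rewrite lnM ?posrE ?invr_gt0// lnV ?posrE// => h.
have h2 : q * (ln (1 + `|t|) - ln (q / k)) <= k * (1 + `|t|) - q.
  have -> : k * (1 + `|t|) - q = q * ((1 + `|t|) / (q / k) - 1) by field; rewrite !gt_eqF.
  by rewrite ler_pM2l.
have h3 : (e + 1) * l <= q * ln (1 + `|t|).
  apply: (@le_trans _ _ ((`|e + 1| + 1) * l)).
    by rewrite ler_wpM2r// (le_trans (ler_norm _))// lerDl.
  rewrite /q mulrAC [leRHS]mulrC ler_wpM2l// addr_ge0//.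
lra.
Qed.

Lemma decays_integrable e k f : 0 < k \/ k = 0 /\ e < - 2^-1 ->
  Ccontinuous f -> decays e k f ->
  Cintegrable mu setT f /\ exists M, forall t, normc (f t) <= M.
Proof.
move=> ek cf [C C0 hC]; have [C' [e' [C'0 e'2 h]]] := stir_dominated ek.
have ub t : normc (f t) <= C * C' * stir e' 0 t.
  by rewrite (le_trans (hC t))// -mulrA ler_wpM2l ?(ltW C0).
split.
  apply: (@Cintegrable_le _ _ R mu setT f (fun t => C * C' * stir e' 0 t)) => //.
    exact: Ccontinuous_measurable.
  exact: (integrableZl measurableT (C * C') (integrable_stir e'2)).
exists (C * C') => t; apply: le_trans (ub t) _.
rewrite -[leRHS]mulr1 ler_wpM2l ?mulr_ge0 ?(ltW C0) ?(ltW C'0)//; apply: stir_le1; lra.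
Qed.

End Gamma_lines.

(** * Images of weighted measures *)
Section weighted_pushforward.
Local Open Scope ereal_scope.
Context d d' (T : measurableType d) (T' : measurableType d') (R : realType).
Variables (mu : {measure set T -> \bar R}) (w : T -> R) (X : T -> T').

(** The image under [X] of the measure with density [w]. *)
Definition wpush (Iw : mu.-integrable setT (EFin \o w)) (w0 : forall x, (0 <= w x)%R)
    (mX : measurable_fun setT X) : set T' -> \bar R :=
  fun A => \int[mu]_(x in X @^-1` A) (w x)%:E.

Hypotheses (Iw : mu.-integrable setT (EFin \o w)) (w0 : forall x, (0 <= w x)%R)
  (mX : measurable_fun setT X).

Let nu := wpush Iw w0 mX.

Let mw : measurable_fun setT (EFin \o w). Proof. exact: measurable_int Iw. Qed.

Let mXA A : measurable A -> measurable (X @^-1` A).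
Proof. by move=> mA; rewrite -[X @^-1` A]setTI; exact: mX. Qed.

Let nu0 : nu set0 = 0.
Proof. by rewrite /nu /wpush preimage_set0 integral_set0. Qed.

Let nu_ge0 A : 0 <= nu A.
Proof. by apply: integral_ge0 => x _; rewrite lee_fin. Qed.

Let nu_sigma_additive : semi_sigma_additive nu.
Proof.
move=> F mF tF mUF; rewrite /nu /wpush preimage_bigcup.
apply: (semi_sigma_additive_nng_induced (f := EFin \o w)) => //.
- by move=> k; exact: mXA.
- apply/trivIsetP => /= i j _ _ ij; rewrite -preimage_setI.
  by move/trivIsetP : tF => /(_ _ _ _ _ ij) ->//; rewrite preimage_set0.
- by rewrite -preimage_bigcup; exact: mXA.
Qed.

HB.instance Definition _ := isMeasure.Build _ _ _ (wpush Iw w0 mX) nu0 nu_ge0 nu_sigma_additive.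

Let nu_finite : fin_num_fun (wpush Iw w0 mX).
Proof.
move=> A mA; rewrite /wpush; apply: integrable_fin_num; first exact: mXA.
by apply: integrableS Iw => //; exact: mXA.
Qed.

HB.instance Definition _ := Measure_isFinite.Build _ _ _ (wpush Iw w0 mX) nu_finite.

Definition wpush_measure : {finite_measure set T' -> \bar R} := wpush Iw w0 mX.

Import HBNNSimple.

Let nnsfun_wpush (h : {nnsfun T' >-> R}) :
  \int[wpush Iw w0 mX]_y (h y)%:E = \int[mu]_x ((h (X x))%:E * (w x)%:E).
Proof.
rewrite integralT_nnsfun sintegralE.
have mi r : measurable_fun setT (fun x => \1_(h @^-1` [set r]) (X x) : R).
  apply: (measurableT_comp (measurable_indic _)) => //.
transitivity (\int[mu]_x (\sum_(r \in range h) (r%:E * ((\1_(h @^-1` [set r]) (X x))%:E * (w x)%:E)))).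
  rewrite ge0_integral_fsum//; last 2 first.
  - move=> r; apply: measurable_funeM; apply: emeasurable_funM => //.
    exact/measurable_EFinP.
  - move=> r x _; have [h0|hr] := leP 0%R r.
      by rewrite !mule_ge0// lee_fin.
    rewrite indicE (_ : (X x \in _) = false) ?mul0e ?mule0//.
    apply/negbTE/negP => /set_mem /= e.
    by move: hr; rewrite -e ltNge fun_ge0.
  apply: eq_fsbigr => r /set_mem [y _ hy].
  have r0 : (0 <= r)%R by rewrite -hy fun_ge0.
  rewrite ge0_integralZl//; last 2 first.
  - apply: emeasurable_funM => //; exact/measurable_EFinP.
  - by move=> x _; rewrite mule_ge0 ?lee_fin.
  congr (_ * _); transitivity (\int[mu]_(x in X @^-1` (h @^-1` [set r])) (w x)%:E); first by [].
  rewrite integral_mkcond; apply: eq_integral => x _; rewrite patchE indicE.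
  have -> : (x \in X @^-1` (h @^-1` [set r])) = (X x \in h @^-1` [set r]).
    by apply/idP/idP => /set_mem e; apply/mem_set.
  by case: ifP => _; rewrite ?mul1e ?mul0e.
apply: eq_integral => x _.
transitivity (\sum_(r \in range h) ((r * \1_(h @^-1` [set r]) (X x))%:E * (w x)%:E)).
  by apply: eq_fsbigr => r _; rewrite muleA [r%:E * _]EFinM.
rewrite -ge0_mule_fsuml; last by move=> r; exact: nnfun_muleindic_ge0.
by rewrite fsumEFin// -(fimfunE _ (X x)).
Qed.

(** Monotone limit of the case of simple functions. *)
Lemma ge0_integral_wpush (f : T' -> \bar R) : measurable_fun setT f -> (forall y, 0 <= f y) ->
  \int[wpush Iw w0 mX]_y f y = \int[mu]_x (f (X x) * (w x)%:E).
Proof.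
move=> mf f0; pose h := nnsfun_approx measurableT mf.
have cf y : (EFin \o h n) y @[n --> \oo] --> f y.
  by apply: cvg_nnsfun_approx => // z _; exact: f0.
have nd y : {homo (fun n => (h n y)%:E) : a b / (a <= b)%N >-> a <= b}.
  by move=> a b ab; rewrite lee_fin; exact/lefP/nd_nnsfun_approx.
have -> : \int[wpush Iw w0 mX]_y f y =
    lim ((\int[wpush Iw w0 mX]_y (h n y)%:E) @[n --> \oo]).
  under eq_integral => y _ do rewrite -(cvg_lim _ (cf y))//.
  apply: monotone_convergence => //.
  - by move=> n; apply/measurable_EFinP.
  - by move=> n y _; rewrite lee_fin.
  - by move=> y _; exact: nd.
have -> : (fun n => \int[wpush Iw w0 mX]_y (h n y)%:E) =
    (fun n => \int[mu]_x ((h n (X x))%:E * (w x)%:E)).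
  by apply/funext => n; rewrite nnsfun_wpush.
rewrite -monotone_convergence//.
- apply: eq_integral => x _; apply/cvg_lim => //.
  by apply: cvgeZr => //; exact: cf.
- move=> n; apply: emeasurable_funM => //; apply/measurable_EFinP.
  exact: (measurableT_comp (@measurable_funP _ _ _ _ _ (h n))).
- by move=> n x _; rewrite mule_ge0 ?lee_fin.
- by move=> x _ a b ab; rewrite lee_wpmul2r ?lee_fin//; exact: nd.
Qed.

End weighted_pushforward.

(** * Uniqueness of a finite measure with given Fourier transform *)
Section ray_uniqueness.
Context {R : realType} d (T : measurableType d).
Notation leb := (@lebesgue_measure R).
Implicit Types (M N : {finite_measure set T -> \bar R}) (X : T -> R) (Z : T -> R[i]).

(** The indicator of the ray [x < c] is smoothed with a Gaussian of variance [eps n].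
    It is first cut at [- n], to be integrable, and moved to the left by [del n], which
    is much larger than the square root of [eps n], so that the limit at [c] is 0. *)
Let del n : R := n.+1%:R^-1.
Let eps n : R := n.+1%:R^-1 ^+ 3.
Let ray (c : R) n : R -> R := \1_(`[- n%:R, c - del n]%classic : set R).
Let smooth c n (x : R) : R := Rintegral leb setT (fun v => ray c n v * gauss (eps n) (v - x)).

Let n0 n : 0 < n.+1%:R :> R. Proof. by []. Qed.
Let eps_gt0 n : 0 < eps n. Proof. by rewrite exprn_gt0// invr_gt0. Qed.
Let del_gt0 n : 0 < del n. Proof. by rewrite invr_gt0. Qed.

Let ray_le1 c n v : `|ray c n v| <= 1.
Proof. by rewrite /ray indicE; case: (_ \in _); rewrite ?normr1 ?normr0. Qed.

Let mray c n : measurable_fun setT (ray c n).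
Proof. by apply: measurable_indic; exact: measurable_itv. Qed.

Let tail n : expR (- (del n ^+ 2 / (4 * eps n))) <= 4 / n.+1%:R.
Proof.
have -> : del n ^+ 2 / (4 * eps n) = n.+1%:R / 4.
  by rewrite /del /eps; field; rewrite nat1r pnatr_eq0.
rewrite expRN -[leRHS]invrK lef_pV2 ?posrE ?expR_gt0 ?invr_gt0 ?divr_gt0// invf_div.
by have := expR_ge1Dx (n.+1%:R / 4 : R); lra.
Qed.

Let near_case c x : \forall n \near \oo, forall v, `|v - x| < del n ->
  `|ray c n v - (x < c)%R%:R| <= 0.
Proof.
have [xc|cx] := ltP x c.
  near=> n => v; rewrite ltr_norml => /andP[h1 h2].
  have k1 : 2 * del n <= c - x.
    near: n; exists (Num.truncn (2 / (c - x))) => // n /= xn.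
    have h : 2 / (c - x) < n.+1%:R.
      by rewrite (lt_le_trans (truncnS_gt _))// ler_nat ltnS.
    rewrite ltr_pdivrMr ?subr_gt0// in h.
    by rewrite /del ler_pdivrMr// mulrC ltW.
  have k2 : 1 - x <= n%:R.
    near: n; exists (Num.truncn (1 - x)).+1 => // n /= xn.
    by rewrite ltW// (lt_le_trans (truncnS_gt _))// ler_nat.
  have k3 : del n <= 1 by rewrite invf_le1// ler1n.
  rewrite /ray indicE mem_set ?subrr ?normr0//= in_itv/=; lra.
near=> n => v; rewrite ltr_norml => /andP[h1 h2].
rewrite /ray indicE memNset ?subrr ?normr0//= in_itv/= => /andP[_ h].
have hv : c - del n < v by lra.
by have := le_lt_trans h hv; rewrite ltxx.
Unshelve. all: end_near. Qed.

Let smooth_cvg c x : smooth c n x @[n --> \oo] --> ((x < c)%R%:R : R).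
Proof.
apply/cvgrPdist_le => e e0; near=> n.
rewrite distrC; apply: (le_trans (gauss_avg (eps_gt0 n) (del_gt0 n) (mray c n) (ray_le1 c n) (c := (x < c)%R%:R) _ _ (lexx 0))).
- by case: (x < c); rewrite ?normr1 ?normr0.
- by near: n; exact: near_case.
rewrite add0r mulr1; set K := 2 * Num.sqrt 2.
have K0 : 0 <= K by rewrite mulr_ge0 ?sqrtr_ge0.
apply: (le_trans (ler_wpM2l K0 (tail n))).
rewrite mulrA ler_pdivrMr// -ler_pdivrMl//.
near: n; exists (Num.truncn (e^-1 * (K * 4))) => // n /= xn.
by rewrite ltW// (lt_le_trans (truncnS_gt _))// ler_nat ltnS.
Unshelve. all: end_near. Qed.

Let smooth_le1 c n x : `|smooth c n x| <= 1.
Proof.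
have I := integrable_gauss x (eps_gt0 n).
have Ig : leb.-integrable setT (EFin \o (fun v => ray c n v * gauss (eps n) (v - x))).
  apply: le_integrable I => //.
    apply/measurable_EFinP/measurable_funM; first exact: mray.
    apply: (@measurableT_comp _ _ _ _ _ _ (gauss _)); first exact: measurable_gauss.
    exact: measurable_funB.
  by move=> v _; rewrite /= lee_fin normrM ler_piMl.
rewrite (le_trans (le_normr_Rintegral _ Ig))//.
have -> : 1 = Rintegral leb setT (fun v => gauss (eps n) (v - x)).
  by rewrite /Rintegral integral_gauss.
apply: le_Rintegral => //; first exact: integrable_norm Ig.
by move=> v _; rewrite normrM (ger0_norm (gauss_ge0 _ _)) ler_piMl ?gauss_ge0.
Qed.

(** A smoothed ray is a superposition of characters, so its integral only depends
    on the Fourier transform. *)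
Let smooth_swap M X Z c n : measurable_fun setT X -> Cmeasurable setT Z ->
  (forall x, normc (Z x) <= 1) ->
  Cintegral M setT (fun x => Z x * (2 * pi * smooth c n (X x))%:C) =
  Cintegral leb setT (fun v => (ray c n v)%:C * Cintegral leb setT (fun t =>
    (ghat (eps n) t)%:C * (Cexp (0 +i* (v * t)) * Cintegral M setT (fun x => Z x * Cexp (0 +i* (- t * X x)))))).
Proof.
move=> mX mZ Z1.
have IZ : Cintegrable M setT Z.
  apply: (@Cintegrable_le _ _ R M setT Z (fun=> 1)) => //.
  exact: finite_measure_integrable_cst.
have mC1 (f : T -> R) : measurable_fun setT f -> Cmeasurable setT (fun x : T => Cexp (0 +i* f x)).
  exact: Cmeasurable_Cexp_i.
have inner v : Cintegral leb setT (fun t => (ghat (eps n) t)%:C *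
    (Cexp (0 +i* (v * t)) * Cintegral M setT (fun x => Z x * Cexp (0 +i* (- t * X x))))) =
    Cintegral M setT (fun x => Z x * (2 * pi * gauss (eps n) (v - X x))%:C).
  transitivity (Cintegral leb setT (fun t => (ghat (eps n) t)%:C *
      Cintegral M setT (fun x => Z x * Cexp (0 +i* ((v - X x) * t))))).
    apply: eq_Cintegral => t _; congr (_ * _); rewrite -CintegralZ//; last first.
      apply: (CintegrableM_bounded (M := 1)) => //.
        by apply: mC1; exact: measurable_funM.
      by move=> x _; rewrite normc_Cexp_i.
    apply: eq_Cintegral => x _; rewrite mulrCA -CexpD; congr (_ * Cexp _).
    by apply: CeqP; rewrite ?cReD ?cImD /= ?addr0//; ring.
  rewrite (@Cfubini_bounded _ _ _ _ R leb M (fun t => (ghat (eps n) t)%:C) Z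
    (fun z => Cexp (0 +i* ((v - X z.2) * z.1))) 1)//.
  - by apply: eq_Cintegral => x _; rewrite /= Cintegral_ghat.
  - exact/Cintegrable_real/integrable_ghat.
  - apply: Cmeasurable_Cexp_i; apply: measurable_funM => //.
    by apply: measurable_funB => //; exact: (measurableT_comp mX).
  - by move=> z; rewrite normc_Cexp_i.
under [RHS]eq_Cintegral => v _ do rewrite inner.
have Ir : leb.-integrable setT (EFin \o ray c n).
  exact: (@integrable_indic_itv R _ _ true false).
rewrite (@Cfubini_bounded _ _ _ _ R leb M (fun v => (ray c n v)%:C) Z
    (fun z => (2 * pi * gauss (eps n) (z.1 - X z.2))%:C) (2 * pi * (Num.sqrt (2 * pi * eps n))^-1))//.
- apply: eq_Cintegral => x _; congr (_ * _) => /=.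
  under [RHS]eq_Cintegral => v _ do rewrite -rmorphM/= mulrCA.
  rewrite Cintegral_real RintegralZl//.
  apply: le_integrable (integrable_gauss (X x) (eps_gt0 n)) => //.
    apply/measurable_EFinP/measurable_funM; first exact: mray.
    apply: (@measurableT_comp _ _ _ _ _ _ (gauss _)); first exact: measurable_gauss.
    exact: measurable_funB.
  by move=> v _; rewrite /= lee_fin normrM ler_piMl.
- exact: Cintegrable_real.
- apply: Cmeasurable_real; apply: measurable_funM => //.
  apply: (@measurableT_comp _ _ _ _ _ _ (gauss _)); first exact: measurable_gauss.
  by apply: measurable_funB => //; exact: (measurableT_comp mX).
- move=> z; rewrite normc_real ger0_norm ?mulr_ge0 ?gauss_ge0 ?pi_ge0//.
  by rewrite ler_wpM2l ?mulr_ge0 ?pi_ge0// gauss_le.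
Qed.

(** If two measures, weighted by [Z], have the same transform along [X], then they give
    the same value to the rays of [X]. *)
Lemma trig_ray M N X Z : measurable_fun setT X -> Cmeasurable setT Z ->
  (forall x, normc (Z x) <= 1) ->
  (forall y : R, Cintegral M setT (fun x => Z x * Cexp (0 +i* (y * X x))) =
                 Cintegral N setT (fun x => Z x * Cexp (0 +i* (y * X x)))) ->
  forall c, Cintegral M setT (fun x => Z x * ((X x < c)%R%:R : R)%:C) =
            Cintegral N setT (fun x => Z x * ((X x < c)%R%:R : R)%:C).
Proof.
move=> mX mZ Z1 MN c.
have ms n : measurable_fun setT (smooth c n).
  have mg : measurable_fun setT (fun z : R * R => (ray c n z.2 * gauss (eps n) (z.2 - z.1))%:E).
    apply/measurable_EFinP/measurable_funM; first exact: (measurableT_comp (mray c n)).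
    apply: (@measurableT_comp _ _ _ _ _ _ (gauss _)); first exact: measurable_gauss.
    exact: measurable_funB.
  have g0 (z : R * R) : (0 <= (ray c n z.2 * gauss (eps n) (z.2 - z.1))%:E)%E.
    by rewrite lee_fin mulr_ge0 ?gauss_ge0.
  have := @measurable_fun_fubini_tonelli_F _ _ _ _ R leb _ mg g0.
  by move/(measurableT_comp (@fine_measurable R setT measurableT)).
have mi : measurable_fun setT (fun x => (X x < c)%R%:R : R).
  rewrite (_ : (fun x => _) = \1_(X @^-1` `]-oo, c[%classic)).
    by apply: measurable_indic; rewrite -[X in measurable X]setTI; apply: mX => //; exact: measurable_itv.
  apply/funext => x; rewrite indicE; congr (_%:R); congr nat_of_bool.
  by apply/idP/idP => [h|/set_mem]; [apply/mem_set|]; rewrite /= in_itv.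
have lim (L : {finite_measure set T -> \bar R}) :
    Ccvg (fun n => Cintegral L setT (fun x => Z x * (2 * pi * smooth c n (X x))%:C))
      (Cintegral L setT (fun x => Z x * (2 * pi * ((X x < c)%R%:R : R))%:C)).
  apply: (@Cdominated _ _ _ L setT measurableT _ _ (fun=> 2 * pi)).
  - move=> n; apply: CmeasurableM => //; apply: Cmeasurable_real.
    by apply: measurable_funM => //; exact: (measurableT_comp (ms n)).
  - apply: CmeasurableM => //; apply: Cmeasurable_real; exact: measurable_funM.
  - move=> x _; have h := @smooth_cvg c (X x).
    have h2 : 2 * pi * smooth c n (X x) @[n --> \oo] --> 2 * pi * ((X x < c)%R%:R : R).
      by apply: cvgM => //; exact: cvg_cst.
    split.
      under eq_fun do rewrite cReM /= mulr0 subr0; rewrite cReM/= mulr0 subr0.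
      by apply: cvgM => //; exact: cvg_cst.
    under eq_fun do rewrite cImM /= mulr0 add0r; rewrite cImM/= mulr0 add0r.
    by apply: cvgM => //; exact: cvg_cst.
  - exact: finite_measure_integrable_cst.
  - move=> n x _; rewrite normcM normc_real normrM.
    rewrite (ger0_norm (mulr_ge0 _ (pi_ge0 R)))//.
    by rewrite mulrCA -[leRHS]mulr1 ler_wpM2l ?mulr_ge0 ?pi_ge0// mulr_ile1 ?normc_ge0.
have E : (fun n => Cintegral M setT (fun x => Z x * (2 * pi * smooth c n (X x))%:C)) =
    (fun n => Cintegral N setT (fun x => Z x * (2 * pi * smooth c n (X x))%:C)).
  apply/funext => n; rewrite (smooth_swap M c n mX mZ Z1) (smooth_swap N c n mX mZ Z1).
  apply: eq_Cintegral => v _; congr (_ * _); apply: eq_Cintegral => t _; congr (_ * (_ * _)).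
  exact: MN.
have := lim M; rewrite E => /(Ccvg_unique (lim N)).
have IZ (L : {finite_measure set T -> \bar R}) : Cintegrable L setT (fun x => Z x * ((X x < c)%R%:R : R)%:C).
  apply: (@Cintegrable_le _ _ R L setT _ (fun=> 1)) => //.
  - apply: CmeasurableM => //; apply: Cmeasurable_real; exact: mi.
  - exact: finite_measure_integrable_cst.
  - move=> x _; rewrite normcM mulr_ile1 ?normc_ge0// normc_real.
    by case: (_ < _); rewrite ?normr1 ?normr0.
have pull (L : {finite_measure set T -> \bar R}) :
    Cintegral L setT (fun x => Z x * (2 * pi * ((X x < c)%R%:R : R))%:C) =
    (2 * pi)%:C * Cintegral L setT (fun x => Z x * ((X x < c)%R%:R : R)%:C).
  rewrite -CintegralZ//; apply: eq_Cintegral => x _.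
  by rewrite rmorphM/= mulrCA.
rewrite !pull => /mulfI ->//.
by rewrite -normc_gt0 normc_real normr_gt0 gt_eqF// mulr_gt0// pi_gt0.
Qed.

End ray_uniqueness.

Section uniqueness.
Context {R : realType} d (T : measurableType d) (n : nat) (X : 'I_n -> T -> R).
Hypothesis mX : forall i, measurable_fun setT (X i).
Implicit Types (M N : {finite_measure set T -> \bar R}).

Let ind c i x : R := (X i x < c)%R%:R.
Let box (c : 'I_n -> R) : set T := [set x | forall i, X i x < c i].
Let fac k (c y : 'I_n -> R) (i : 'I_n) x : R[i] :=
  if (i < k)%N then (ind (c i) i x)%:C else Cexp (0 +i* (y i * X i x)).

Let mind c i : measurable_fun setT (ind c i).
Proof.
rewrite (_ : ind c i = \1_(X i @^-1` `]-oo, c[%classic)).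
  by apply: measurable_indic; rewrite -[X in measurable X]setTI; apply: mX => //; exact: measurable_itv.
apply/funext => x; rewrite indicE; congr (_%:R); congr nat_of_bool.
by apply/idP/idP => [h|/set_mem]; [apply/mem_set|]; rewrite /= in_itv.
Qed.

Let mfac k c y i : Cmeasurable setT (fac k c y i).
Proof.
rewrite /fac; case: (i < k)%N; first exact: Cmeasurable_real.
by apply: Cmeasurable_Cexp_i; exact: measurable_funM.
Qed.

Let fac_le1 k c y i x : normc (fac k c y i x) <= 1.
Proof.
rewrite /fac; case: ifP => _; last by rewrite normc_Cexp_i.
by rewrite normc_real /ind; case: (_ < _); rewrite ?normr1 ?normr0.
Qed.

Let mfacs k c y (P : pred 'I_n) : Cmeasurable setT (fun x => \prod_(i < n | P i) fac k c y i x).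
Proof.
have -> : (fun x => \prod_(i < n | P i) fac k c y i x) =
  fun x => \prod_(i <- [seq i <- enum 'I_n | P i]) fac k c y i x.
  by apply/funext => x; rewrite big_filter big_enum_cond.
elim: [seq _ <- _ | _] => [|i s IH].
  by under eq_fun do rewrite big_nil; exact: Cmeasurable_cst.
by under eq_fun do rewrite big_cons; apply: CmeasurableM => //; exact: mfac.
Qed.

Let facs_le1 k c y (P : pred 'I_n) x : normc (\prod_(i < n | P i) fac k c y i x) <= 1.
Proof.
elim/big_rec : _ => [|i z _ z1]; first by rewrite (normc_real 1) normr1.
by rewrite normcM mulr_ile1 ?normc_ge0.
Qed.

Let Cexp_sum (y : 'I_n -> R) x :
  Cexp (0 +i* \sum_(i < n) y i * X i x) = \prod_(i < n) Cexp (0 +i* (y i * X i x)).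
Proof.
rewrite (big_morph (fun t : R => Cexp (0 +i* t)) (id1 := 1) (op1 := *%R))//.
  by move=> u v; rewrite -CexpD; congr Cexp; apply: CeqP; rewrite ?cReD ?cImD/= ?addr0.
exact: Cexp0.
Qed.

Let box_prod c x : \prod_(i < n) (ind (c i) i x)%:C = (\1_(box c) x : R)%:C.
Proof.
rewrite indicE; have [/set_mem h|/negP h] := boolP (x \in box c).
  by rewrite big1// => i _; rewrite /ind h.
have [i /negbTE hi] : exists i, ~~ (X i x < c i).
  by apply: contra_notP h => /forallNP h; apply/mem_set => i; move/negP/negPn: (h i).
by rewrite (bigD1 i)//= /ind hi mul0r.
Qed.

Let mbox c : measurable (box c).
Proof.
rewrite (_ : box c = \bigcap_(i in [set: 'I_n]) (X i @^-1` `]-oo, c i[%classic)).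
  apply: fin_bigcap_measurable => // i _; rewrite -[X in measurable X]setTI.
  by apply: mX => //; exact: measurable_itv.
by apply/seteqP; split => x h i => [_|]; [|have := h i Logic.I]; rewrite /= in_itv/=.
Qed.

(** The characters of the coordinates are replaced by rays one at a time: [fac k] has
    rays in the first [k] coordinates, and the other factors serve as weight. *)
Lemma charfun_boxes M N :
  (forall y : 'I_n -> R, Cintegral M setT (fun x => Cexp (0 +i* \sum_(i < n) y i * X i x)) =
                         Cintegral N setT (fun x => Cexp (0 +i* \sum_(i < n) y i * X i x))) ->
  forall c, M (box c) = N (box c).
Proof.
move=> MN c.
have H k : (k <= n)%N -> forall y, Cintegral M setT (fun x => \prod_(i < n) fac k c y i x) =
                        Cintegral N setT (fun x => \prod_(i < n) fac k c y i x).
  elim: k => [_ y|k IH kn y].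
    by have := MN y; under eq_Cintegral do rewrite Cexp_sum; under [RHS]eq_Cintegral do rewrite Cexp_sum.
  pose i0 := Ordinal kn.
  have E (L : {finite_measure set T -> \bar R}) :
      Cintegral L setT (fun x => \prod_(i < n) fac k.+1 c y i x) =
      Cintegral L setT (fun x => \prod_(i < n | i != i0) fac k.+1 c y i x * ((X i0 x < c i0)%R%:R : R)%:C).
    by apply: eq_Cintegral => x _; rewrite (bigD1 i0)//= mulrC {2}/fac /= ltnSn.
  rewrite !E; apply: (trig_ray (mX i0) (mfacs k.+1 c y (fun i => i != i0)) (facs_le1 k.+1 c y _)).
  move=> t; have := IH (ltnW kn) (fun i => if i == i0 then t else y i).
  have E2 (L : {finite_measure set T -> \bar R}) :
      Cintegral L setT (fun x => \prod_(i < n) fac k c (fun i => if i == i0 then t else y i) i x) =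
      Cintegral L setT (fun x => \prod_(i < n | i != i0) fac k.+1 c y i x * Cexp (0 +i* (t * X i0 x))).
    apply: eq_Cintegral => x _; rewrite (bigD1 i0)//= mulrC {2}/fac /= ltnn eqxx; congr (_ * _).
    apply: eq_bigr => i /negbTE ii; rewrite /fac ii ltnS [in RHS]leq_eqVlt.
    by rewrite (_ : (i == k :> nat) = false).
  by rewrite !E2.
have fM (L : {finite_measure set T -> \bar R}) :
    Cintegral L setT (fun x => \prod_(i < n) fac n c c i x) = (fine (L (box c)))%:C.
  under eq_Cintegral => x _.
    rewrite (eq_bigr (fun i => (ind (c i) i x)%:C)); last by move=> i _; rewrite /fac ltn_ord.
    rewrite box_prod; over.
  by rewrite Cintegral_real /Rintegral integral_indic// setIT.
have := H n (leqnn n) c; rewrite !fM => -[e].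
by rewrite -[LHS]fineK ?fin_num_measure// e fineK// fin_num_measure.
Qed.

(** The boxes are closed under intersection and cover [T].  The first hypothesis says
    that the coordinates [X] generate the sigma-algebra of [T]: it is applied to the
    identity from [T] with the sigma-algebra generated by the boxes. *)
Lemma charfun_unique M N :
  (forall d' (T' : measurableType d') (f : T' -> T),
     (forall i, measurable_fun setT (X i \o f)) -> measurable_fun setT f) ->
  (forall y : 'I_n -> R, Cintegral M setT (fun x => Cexp (0 +i* \sum_(i < n) y i * X i x)) =
                         Cintegral N setT (fun x => Cexp (0 +i* \sum_(i < n) y i * X i x))) ->
  forall A, measurable A -> M A = N A.
Proof.
move=> gen /charfun_boxes MN A mA.
pose G : set (set T) := [set B | exists c, B = box c].
have Gm : G `<=` measurable by move=> _ [c ->]; exact: mbox.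
have bound x : exists k : nat, forall i, X i x < k%:R.
  exists (\max_(i < n) (Num.truncn (X i x)).+1)%N => i.
  rewrite (lt_le_trans (truncnS_gt _))// ler_nat.
  exact: (leq_bigmax (F := fun i => (Num.truncn (X i x)).+1)).
apply: (@g_sigma_algebra_measure_unique _ _ _ G Gm (fun k => box (fun=> k%:R))).
- by move=> k; eexists.
- by apply/seteqP; split => x _ //; have [k hk] := bound x; exists k.
- move=> _ _ [c1 ->] [c2 ->]; exists (fun i => Num.min (c1 i) (c2 i)).
  apply/seteqP; split => x /=; first by move=> [h1 h2] i; rewrite lt_min h1 h2.
  by move=> h; split=> i; have := h i; rewrite lt_min => /andP[].
- by move=> _ [c ->]; exact: MN.
- by move=> k; rewrite ltey_eq fin_num_measure//; exact: mbox.
- have mid : measurable_fun setT (id : g_sigma_algebraType G -> T).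
    apply: gen => i; apply: (measurability _ (@RGenInftyO.measurableE R)) => _ [_ [x ->] <-].
    rewrite setTI; rewrite (_ : _ @^-1` _ = \bigcup_k box (fun j => if j == i then x else k%:R)).
      by apply: bigcup_measurable => k _; apply: sub_sigma_algebra; eexists.
    apply/seteqP; split => t /=; rewrite in_itv/=.
      by move=> tx; have [k hk] := bound t; exists k => // j; case: eqP => [->|].
    by move=> [k _ /(_ i)]; rewrite eqxx.
  by have := mid measurableT _ mA; rewrite setTI preimage_id.
Qed.

End uniqueness.

Section integral_wpush.
Context d d' (T : measurableType d) (T' : measurableType d') (R : realType).
Variables (mu : {measure set T -> \bar R}) (w : T -> R) (X : T -> T').
Variables (Iw : mu.-integrable setT (EFin \o w)) (w0 : forall x, 0 <= w x)
  (mX : measurable_fun setT X).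
Notation nu := (wpush_measure Iw w0 mX).

Lemma integrable_wpush (f : T' -> R) : measurable_fun setT f ->
  nu.-integrable setT (EFin \o f) <-> mu.-integrable setT (fun x => (f (X x) * w x)%:E).
Proof.
move=> mf; have mfw : measurable_fun setT (fun x => (f (X x) * w x)%:E).
  apply/measurable_EFinP/measurable_funM; first exact: measurableT_comp.
  exact/measurable_EFinP/(measurable_int _ Iw).
have E : (\int[nu]_y `|(EFin \o f) y| = \int[mu]_x `|(f (X x) * w x)%:E|)%E.
  rewrite ge0_integral_wpush//.
    by apply: eq_integral => x _; rewrite /= normrM (ger0_norm (w0 x)).
  by apply/measurable_EFinP; exact: measurableT_comp.
split=> /integrableP[_ h]; apply/integrableP; split => //.
- by rewrite -E.
- exact/measurable_EFinP.
- by rewrite E.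
Qed.

Lemma Rintegral_wpush (f : T' -> R) : measurable_fun setT f ->
  Rintegral nu setT f = Rintegral mu setT (fun x => f (X x) * w x).
Proof.
move=> mf; rewrite /Rintegral; congr fine.
rewrite integralE [RHS]integralE !ge0_integral_wpush//.
- congr (_ - _)%E; apply: eq_integral => x _.
    by rewrite !funeposE -!EFin_max -EFinM mulrC maxr_pMr// mulr0 mulrC.
  by rewrite !funenegE -!EFinN -!EFin_max -EFinM mulrC maxr_pMr// mulr0 -mulNr mulrC.
- exact/measurable_funeneg/measurable_EFinP.
- exact/measurable_funepos/measurable_EFinP.
Qed.

Lemma Cintegrable_wpush (f : T' -> R[i]) : Cmeasurable setT f ->
  Cintegrable nu setT f <-> Cintegrable mu setT (fun x => (w x)%:C * f (X x)).
Proof.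
move=> [m1 m2]; have E1 : (fun x => complex.Re ((w x)%:C * f (X x))) =
    fun x => complex.Re (f (X x)) * w x.
  by apply/funext => x; rewrite cReM /= mul0r subr0 mulrC.
have E2 : (fun x => complex.Im ((w x)%:C * f (X x))) =
    fun x => complex.Im (f (X x)) * w x.
  by apply/funext => x; rewrite cImM /= mul0r addr0 mulrC.
have r1 := integrable_wpush m1; have r2 := integrable_wpush m2.
rewrite /Cintegrable; split=> -[i1 i2]; split.
- by have := r1.1 i1; under [X in integrable _ _ X -> _]eq_fun => x do rewrite -(congr1 (@^~ x) E1).
- by have := r2.1 i2; under [X in integrable _ _ X -> _]eq_fun => x do rewrite -(congr1 (@^~ x) E2).
- by apply: r1.2; under [X in integrable _ _ X]eq_fun => x do rewrite -(congr1 (@^~ x) E1).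
- by apply: r2.2; under [X in integrable _ _ X]eq_fun => x do rewrite -(congr1 (@^~ x) E2).
Qed.

Lemma Cintegral_wpush (f : T' -> R[i]) : Cmeasurable setT f ->
  Cintegral nu setT f = Cintegral mu setT (fun x => (w x)%:C * f (X x)).
Proof.
move=> [m1 m2]; apply: CeqP => /=; rewrite Rintegral_wpush//; apply: eq_Rintegral => x _.
  by rewrite cReM /= mul0r subr0 mulrC.
by rewrite cImM /= mul0r addr0 mulrC.
Qed.

End integral_wpush.

(** * Sums and convolutions of finite measures *)
Section product_integral.
Context d1 d2 (T1 : measurableType d1) (T2 : measurableType d2) (R : realType).
Variables (m1 : {sigma_finite_measure set T1 -> \bar R})
          (m2 : {sigma_finite_measure set T2 -> \bar R}).

Lemma Cfubini12 (f : T1 * T2 -> R[i]) :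
  Cintegrable (m1 \x m2)%E setT f ->
  (forall x, Cintegrable m2 setT (fun y => f (x, y))) ->
  Cintegral m1 setT (fun x => Cintegral m2 setT (fun y => f (x, y))) =
  Cintegral (m1 \x m2)%E setT f.
Proof.
have key (g : T1 * T2 -> R) : (m1 \x m2)%E.-integrable setT (EFin \o g) ->
    (forall x, m2.-integrable setT (EFin \o (fun y => g (x, y)))) ->
    Rintegral m1 setT (fun x => Rintegral m2 setT (fun y => g (x, y))) =
    Rintegral (m1 \x m2)%E setT g.
  move=> Ig I1; rewrite /Rintegral; congr fine.
  under eq_integral => x _.
    rewrite fineK; last by apply: (integrable_fin_num _ (I1 x)).
    over.
  exact: integral12_prod_meas1 Ig.
move=> [If1 If2] I1; apply: CeqP => /=; apply: key => // x; by have [] := I1 x.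
Qed.

End product_integral.

Section operations.
Context d (T : measurableType d) (R : realType).

Section sum.
Variables M N : {finite_measure set T -> \bar R}.

Let summand (n : nat) : {measure set T -> \bar R} := if n is 0%N then M else N.

Let add_finite : fin_num_fun (msum summand 2).
Proof. by move=> A mA; rewrite /msum !big_ord_recl big_ord0 adde0 fin_numD !fin_num_measure. Qed.

HB.instance Definition _ := Measure_isFinite.Build _ _ _ (msum summand 2) add_finite.

Definition finite_add : {finite_measure set T -> \bar R} := msum summand 2.

Let finite_addE : finite_add = measure_add M N :> (set T -> \bar R). Proof. by []. Qed.

Lemma ge0_integral_add f : (forall x, 0 <= f x)%E -> measurable_fun setT f ->
  (\int[finite_add]_x f x = \int[M]_x f x + \int[N]_x f x)%E.
Proof. by move=> f0 mf; rewrite -ge0_integral_measure_add. Qed.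

Lemma Cintegrable_add f : Cintegrable M setT f -> Cintegrable N setT f ->
  Cintegrable finite_add setT f.
Proof.
have key (g : T -> R) : M.-integrable setT (EFin \o g) -> N.-integrable setT (EFin \o g) ->
    finite_add.-integrable setT (EFin \o g).
  move=> /integrableP[mg h1] /integrableP[_ h2]; apply/integrableP; split => //.
  by rewrite ge0_integral_add//; [rewrite lte_add_pinfty|exact: measurableT_comp].
by move=> [f1 f2] [g1 g2]; split; exact: key.
Qed.

Lemma Cintegral_add f : Cintegrable M setT f -> Cintegrable N setT f ->
  Cintegral finite_add setT f = Cintegral M setT f + Cintegral N setT f.
Proof.
have key (g : T -> R) : M.-integrable setT (EFin \o g) -> N.-integrable setT (EFin \o g) ->
    Rintegral finite_add setT g = Rintegral M setT g + Rintegral N setT g.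
  move=> I1 I2; rewrite /Rintegral -fineD; try exact: integrable_fin_num.
  by congr fine; rewrite -integral_measure_add.
by move=> [f1 f2] [g1 g2]; apply: CeqP; rewrite ?cReD ?cImD /= key.
Qed.

End sum.
End operations.

Section convolution.
Context {R : realType}.
Notation RR := (measurableTypeR R).
Implicit Types M N : {finite_measure set RR -> \bar R}.

Section conv.
Variables M N : {finite_measure set RR -> \bar R}.

Let I1 : (M \x N)%E.-integrable setT (EFin \o fun _ : RR * RR => 1).
Proof.
apply/integrableP; split; first exact/measurable_EFinP.
under eq_integral do rewrite /= normr1.
rewrite integral_cst// mul1e -setXTT.
have h : ((M \x N)%E (setT `*` setT) < +oo)%E.
  by rewrite product_measure1E// ltey_eq fin_numM// fin_num_measure.
exact: h.
Qed.

Let madd : measurable_fun setT (fun z : RR * RR => z.1 + z.2 : RR).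
Proof. exact: measurable_funD. Qed.

Definition convolve : {finite_measure set RR -> \bar R} :=
  wpush_measure I1 (fun _ => ler01) madd.

Lemma ge0_integral_convolve (f : RR -> R) : measurable_fun setT f -> (forall x, 0 <= f x) ->
  (forall x y, f (x + y) = f x * f y) ->
  (\int[convolve]_x (f x)%:E = \int[M]_x (f x)%:E * \int[N]_x (f x)%:E)%E.
Proof.
move=> mf f0 fD; have mEf : measurable_fun setT (EFin \o f) by exact/measurable_EFinP.
rewrite /convolve ge0_integral_wpush//.
under eq_integral do rewrite /= mule1 fD EFinM.
have m1 : measurable_fun setT (fun z : RR * RR => ((f z.1)%:E * (f z.2)%:E)%E).
  by apply: emeasurable_funM; exact: (measurableT_comp mEf).
rewrite fubini_tonelli1//; last by move=> z; rewrite mule_ge0// lee_fin.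
rewrite /fubini_F -ge0_integralZr//; last first.
- by apply: integral_ge0 => y _; rewrite lee_fin.
- by move=> x _; rewrite lee_fin.
by apply: eq_integral => x _ /=; rewrite ge0_integralZl// ?lee_fin// => y _; rewrite lee_fin.
Qed.

Lemma Cintegral_convolve (f : RR -> R[i]) : (forall x y, f (x + y) = f x * f y) ->
  Cintegrable M setT f -> Cintegrable N setT f ->
  Cintegrable convolve setT f /\ Cintegral convolve setT f = Cintegral M setT f * Cintegral N setT f.
Proof.
move=> fD IM IN; have mf := Cintegrable_measurable IM.
have If : Cintegrable (M \x N)%E setT (fun z => f z.1 * f z.2 * 1).
  apply: (@Cintegrable_prod _ _ _ _ R M N f f (fun=> 1) 1) => //.
  by move=> z; rewrite (normc_real 1) normr1.
have If2 : Cintegrable (M \x N)%E setT (fun z => f z.1 * f z.2).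
  by apply: eq_Cintegrable If => // z _; rewrite mulr1.
split.
  rewrite /convolve Cintegrable_wpush//.
  by apply: eq_Cintegrable If2 => // z _; rewrite fD mul1r.
rewrite /convolve Cintegral_wpush//.
transitivity (Cintegral (M \x N)%E setT (fun z : RR * RR => f z.1 * f z.2)).
  by apply: eq_Cintegral => z _; rewrite fD mul1r.
rewrite -Cfubini12//; last by move=> x; apply: (@CintegrableZ _ _ R N setT f (f x)).
rewrite [RHS]mulrC -CintegralZ//; apply: eq_Cintegral => x _.
by rewrite /= CintegralZ// mulrC.
Qed.

End conv.
End convolution.

(** * Two-sided Laplace transforms of finite measures *)
Section log_gamma.
Context {R : realType}.
Notation mu := (@lebesgue_measure R).

Lemma log_gamma_integrable (x : R) : 0 < x ->
  mu.-integrable setT (EFin \o (fun u => expR (x * u - expR u))).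
Proof.
move=> x0.
have cf t : 0 < t -> {for t, continuous (edens x : R -> R)}.
  by move=> t0; exact: continuous_edens.
have f0 t : 0 < t -> 0 <= edens x t by move=> t0; rewrite ltW// edens_gt0.
have := integrable_exp cf f0 (integrable_edens x0); apply: eq_integrable => // u _.
rewrite /= /edens powR_exp ?expR_gt0// expRK -!expRD; congr (expR _)%:E; ring.
Qed.

(** The Euler integral after [t = exp u]. *)
Lemma Euler_exp (s : R[i]) : 0 < complex.Re s ->
  Cintegrable mu setT (fun u => (expR (- expR u))%:C * Cexp (s * u%:C)) /\
  Cintegral mu setT (fun u => (expR (- expR u))%:C * Cexp (s * u%:C)) = Euler_integral s.
Proof.
case: s => x y /= x0.
have E u c : edens x (expR u) * cos (y * ln (expR u) + c) * expR u =
    expR (x * u - expR u) * cos (y * u + c).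
  rewrite /edens powR_exp ?expR_gt0// expRK mulrAC -!expRD; congr (expR _ * _); ring.
have I c : mu.-integrable setT (EFin \o (fun u => expR (x * u - expR u) * cos (y * u + c))).
  apply: le_integrable (log_gamma_integrable x0) => //.
    apply/measurable_EFinP; apply: continuous_measurable_fun => u.
    by apply: d_continuous; deriv_rules.
  move=> u _; rewrite /= lee_fin normrM ler_piMr//.
  by rewrite ler_norml cos_geN1 cos_le1.
have V c : Rintegral mu setT (fun u => expR (x * u - expR u) * cos (y * u + c)) = eulc x y c.
  rewrite /eulc (@Rintegral_exp R (fun t => edens x t * cos (y * ln t + c))).
  - by apply: eq_Rintegral => u _; rewrite E.
  - by move=> t t0; apply: d_continuous; rewrite /edens; deriv_rules.
  - exact: integrable_edens_cos.
  - by under [X in integrable _ _ X]eq_fun => u do rewrite /= E; exact: I.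
have W u : (expR (- expR u))%:C * Cexp ((x +i* y) * u%:C) =
    (expR (x * u - expR u) * cos (y * u + 0)) +i* (expR (x * u - expR u) * cos (y * u - pi / 2)).
  have -> : (x +i* y) * u%:C = (x * u) +i* (y * u).
    by apply: CeqP; rewrite ?cReM ?cImM /= mulr0 ?subr0 ?add0r.
  have -> : x * u - expR u = - expR u + x * u by rewrite addrC.
  apply: CeqP; rewrite ?cReM ?cImM ?ReCexp ?ImCexp /= ?mul0r ?subr0 ?addr0 mulrA -expRD ?sin_shift ?mul0r ?subr0 ?addr0//.
split; last first.
  by under eq_Cintegral do rewrite W; rewrite Euler_integralE -!V.
apply: (@eq_Cintegrable _ _ _ mu setT (fun u => (expR (x * u - expR u) * cos (y * u + 0)) +i* (expR (x * u - expR u) * cos (y * u - pi / 2)))) => //.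
by split; exact: I.
Qed.

End log_gamma.

Section transforms.
Context {R : realType}.
Notation RR := (measurableTypeR R).
Notation fmeas := {finite_measure set RR -> \bar R}.
Notation leb := (@lebesgue_measure R).
Variable D : set R.
Hypothesis D0 : D 0.
Implicit Types (rho : fmeas) (phi psi : R[i] -> R[i]).

(** [D] is a set of abscissas containing 0, so that the transform restricts to the
    Fourier transform. *)
Definition has_transform rho phi := forall z, D (complex.Re z) ->
  Cintegrable rho setT (fun u : RR => Cexp (z * (u : R)%:C)) /\
  Cintegral rho setT (fun u : RR => Cexp (z * (u : R)%:C)) = phi z.

Lemma measurable_Cexp_lin (z : R[i]) : Cmeasurable setT (fun u : RR => Cexp (z * (u : R)%:C)).
Proof.
apply: Cmeasurable_Cexp; apply: CmeasurableM; first exact: Cmeasurable_cst.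
exact: Cmeasurable_real.
Qed.

Lemma transform_conv rho1 rho2 phi psi : has_transform rho1 phi -> has_transform rho2 psi ->
  has_transform (convolve rho1 rho2) (fun z => phi z * psi z).
Proof.
move=> h1 h2 z Dz; have [I1 <-] := h1 z Dz; have [I2 <-] := h2 z Dz.
by apply: Cintegral_convolve => // x y; rewrite rmorphD/= mulrDr CexpD.
Qed.

Lemma transform_add rho1 rho2 phi psi : has_transform rho1 phi -> has_transform rho2 psi ->
  has_transform (finite_add rho1 rho2) (fun z => phi z + psi z).
Proof.
move=> h1 h2 z Dz; have [I1 <-] := h1 z Dz; have [I2 <-] := h2 z Dz.
by split; [exact: Cintegrable_add|exact: Cintegral_add].
Qed.

Lemma transform_scale rho phi (c : R) : 0 <= c -> has_transform rho phi ->
  exists rho', has_transform rho' (fun z => c%:C * phi z).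
Proof.
move=> c0 h.
have Ic : rho.-integrable setT (EFin \o (fun _ : RR => c)) by exact: finite_measure_integrable_cst.
exists (wpush_measure Ic (fun _ => c0) (@measurable_id _ RR setT)) => z Dz.
have [I1 <-] := h z Dz; split.
  by apply/Cintegrable_wpush; [exact: measurable_Cexp_lin|exact: CintegrableZ].
by rewrite Cintegral_wpush ?CintegralZ//; exact: measurable_Cexp_lin.
Qed.

(** The image under [u |-> be * u] of the law of the logarithm of a Gamma variable. *)
Lemma transform_gamma (w be : R) : (forall r, D r -> 0 < w + be * r) ->
  exists rho, has_transform rho (fun z => Gamma (w%:C + be%:C * z)).
Proof.
move=> Dw; have w0 : 0 < w by have := Dw 0 D0; rewrite mulr0 addr0.
have mX : measurable_fun setT (fun u : RR => be * u : RR) by exact: measurable_funM.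
exists (wpush_measure (log_gamma_integrable w0) (fun _ => expR_ge0 _) mX) => z Dz.
have Rw : complex.Re (w%:C + be%:C * z) = w + be * complex.Re z.
  by rewrite cReD cReM /= mul0r subr0.
have s0 : 0 < complex.Re (w%:C + be%:C * z) by rewrite Rw; exact: Dw.
have [I1 I2] := Euler_exp s0; rewrite GammaE// -I2.
have E u : (expR (- expR u))%:C * Cexp ((w%:C + be%:C * z) * u%:C) =
    (expR (w * u - expR u))%:C * Cexp (z * (be * u)%:C).
  rewrite expRD [(_ * _)%:C]rmorphM/= mulrAC mulrC; congr (_ * _).
  transitivity (Cexp ((w * u)%:C + z * (be * u)%:C)); last by rewrite CexpD Cexp_real.
  by congr Cexp; case: z {Dz Rw s0 I1 I2} => zr zi; apply: CeqP => /=; ring.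
split.
  apply/Cintegrable_wpush; first exact: measurable_Cexp_lin.
  by apply: eq_Cintegrable I1 => // u _; exact: E.
rewrite Cintegral_wpush; last exact: measurable_Cexp_lin.
by apply: eq_Cintegral => u _; rewrite E.
Qed.

Lemma transform_one : exists rho, has_transform rho (fun=> 1).
Proof.
exists (\d_(0 : RR) : fmeas) => z _.
have m := measurable_Cexp_lin z.
have I1 (f : RR -> R) : measurable_fun setT f -> (\d_(0 : RR)).-integrable setT (EFin \o f).
  move=> mf; apply/integrableP; split; first exact/measurable_EFinP.
  rewrite integral_dirac//; first by rewrite diracT mul1e ltry.
  by apply: measurableT_comp => //; exact/measurable_EFinP.
have V1 (f : RR -> R) : measurable_fun setT f -> Rintegral \d_(0 : RR) setT f = f 0.
  move=> mf; rewrite /Rintegral integral_dirac ?diracT ?mul1e//.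
  exact/measurable_EFinP.
case: m => m1 m2; split; first by split; exact: I1.
by rewrite /Cintegral !V1// mulr0 Cexp0.
Qed.

Lemma transform_prod n (w be : 'I_n -> R) (P : pred 'I_n) :
  (forall i r, D r -> 0 < w i + be i * r) ->
  exists rho, has_transform rho (fun z => \prod_(i < n | P i) Gamma ((w i)%:C + (be i)%:C * z)).
Proof.
move=> Dw.
have [rho h] : exists rho, has_transform rho
    (fun z => \prod_(i <- enum P) Gamma ((w i)%:C + (be i)%:C * z)).
  elim: (enum P) => [|i s [rho IH]].
    by have [rho h] := transform_one; exists rho => z Dz; rewrite big_nil; exact: h.
  have [rho' h] := transform_gamma (Dw i).
  by exists (convolve rho' rho) => z Dz; rewrite big_cons; exact: (transform_conv h IH Dz).
by exists rho => z Dz; rewrite -big_enum; exact: h.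
Qed.

Definition signed_transform phi := exists rho1 rho2 phi1 phi2,
  [/\ has_transform rho1 phi1, has_transform rho2 phi2 &
      forall z, D (complex.Re z) -> phi z = phi1 z - phi2 z].

Lemma signed_scale phi (c : R) : signed_transform phi -> signed_transform (fun z => c%:C * phi z).
Proof.
move=> [r1 [r2 [p1 [p2 [h1 h2 e]]]]].
have [c0|/ltW c0] := leP 0 c.
  have [s1 g1] := transform_scale c0 h1; have [s2 g2] := transform_scale c0 h2.
  exists s1, s2, (fun z => c%:C * p1 z), (fun z => c%:C * p2 z).
  by split => // z Dz; rewrite e// mulrBr.
have c1 : 0 <= - c by rewrite oppr_ge0.
have [s1 g1] := transform_scale c1 h1; have [s2 g2] := transform_scale c1 h2.
exists s2, s1, (fun z => (- c)%:C * p2 z), (fun z => (- c)%:C * p1 z).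
by split => // z Dz; rewrite e// rmorphN/= !mulNr opprK mulrBr addrC.
Qed.

Lemma signed_add phi psi : signed_transform phi -> signed_transform psi ->
  signed_transform (fun z => phi z + psi z).
Proof.
move=> [r1 [r2 [p1 [p2 [h1 h2 e]]]]] [s1 [s2 [q1 [q2 [g1 g2 e']]]]].
exists (finite_add r1 s1), (finite_add r2 s2), (fun z => p1 z + q1 z), (fun z => p2 z + q2 z).
split; [exact: transform_add|exact: transform_add|].
by move=> z Dz; rewrite e// e'// opprD addrACA.
Qed.

(** One linear factor at a time: with [s = w + k + be z], a linear factor is
    [(B / be) s] plus a constant, and [s Gamma s = Gamma (s + 1)] absorbs [s] by
    raising [k].  The coefficients may be negative, hence differences. *)
Lemma signed_poly (L : seq (R * R)) (w be : R) rho phi (k : nat) :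
  0 < be -> (forall r, D r -> 0 < w + be * r) -> has_transform rho phi ->
  signed_transform (fun z => \prod_(q <- L) (q.1%:C + q.2%:C * z) *
    (Gamma ((w + k%:R)%:C + be%:C * z) * phi z)).
Proof.
move=> be0 Dw h; elim: L k => [|[A B] L IH] k.
  have Dk r : D r -> 0 < (w + k%:R) + be * r.
    by move=> /Dw Dr; rewrite addrAC ltr_wpDr.
  have [rho1 h1] := transform_gamma Dk; have h2 := transform_conv h1 h.
  have [rho0 h0] := transform_scale (lexx 0) h2.
  exists (convolve rho1 rho), rho0; do 2 eexists; split; [exact: h2|exact: h0|].
  by move=> z Dz; rewrite big_nil mul1r mul0r subr0.
have := signed_add (signed_scale (B / be) (IH k.+1)) (signed_scale (A - B / be * (w + k%:R)) (IH k)).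
move=> [r1 [r2 [p1 [p2 [h1 h2 e]]]]]; exists r1, r2, p1, p2; split => // z Dz.
rewrite -e// big_cons/=.
have s0 : 0 < complex.Re ((w + k%:R)%:C + be%:C * z).
  rewrite cReD cReM/= mul0r subr0 addrAC ltr_wpDr//; exact: Dw.
have -> : (w + k.+1%:R)%:C + be%:C * z = ((w + k%:R)%:C + be%:C * z) + 1.
  by rewrite -natr1 addrA (rmorphD _ _ 1)/= rmorph1 addrAC.
rewrite [Gamma (_ + 1)]GammaE; last by rewrite cReD ltr_wpDr.
rewrite EulerS// -GammaE//.
have -> : A%:C + B%:C * z = (B / be)%:C * ((w + k%:R)%:C + be%:C * z) + (A - B / be * (w + k%:R))%:C.
  by case: z {Dz s0} => zr zi; apply: CeqP => /=; field; rewrite gt_eqF.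
set G := Gamma _; set Q := \prod_(_ <- _) _; set s := _ + be%:C * z; set c1 := (B / be)%:C; set c2 := (A - _)%:C; ring.
Qed.

End transforms.

Section quotient_transform.
Context {R : realType}.
Notation RR := (measurableTypeR R).
Notation fmeas := {finite_measure set RR -> \bar R}.
Implicit Types (rho : fmeas) (phi psi : R[i] -> R[i]).

Lemma charfun_unique1 rho1 rho2 :
  (forall t : R, Cintegral rho1 setT (fun u : RR => Cexp ((0 +i* t) * (u : R)%:C)) =
                 Cintegral rho2 setT (fun u : RR => Cexp ((0 +i* t) * (u : R)%:C))) ->
  forall A, measurable A -> rho1 A = rho2 A.
Proof.
move=> h; apply: (@charfun_unique R _ RR 1 (fun _ => id)).
- by move=> _; exact: measurable_id.
- by move=> d' T' f /(_ ord0).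
- move=> y; have E (rho : fmeas) : Cintegral rho setT (fun x : RR => Cexp (0 +i* \sum_(i < 1) y i * x)) =
      Cintegral rho setT (fun u : RR => Cexp ((0 +i* y ord0) * (u : R)%:C)).
    apply: eq_Cintegral => u _; congr Cexp; rewrite big_ord1; apply: CeqP => /=; ring.
  by rewrite !E.
Qed.

(** The hypothesis says that [nu * kappa + rho2] and [rho1] have the same Fourier
    transform, so they are equal.  For nonnegative integrands the product formula
    for convolutions holds without any assumption, so
    [int exp (x u) nu(du) * int exp (x u) kappa(du)] is at most the moment of [rho1];
    as the second factor is positive, [nu] has the exponential moment too. *)
Lemma transform_extend (D : set R) (nu kappa rho1 rho2 : fmeas) (K p1 p2 : R[i] -> R[i]) : D 0 ->
  has_transform D kappa K -> has_transform D rho1 p1 -> has_transform D rho2 p2 ->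
  (forall z, D (complex.Re z) -> K z != 0) ->
  (forall t : R, Cintegral nu setT (fun u : RR => Cexp ((0 +i* t) * (u : R)%:C)) * K (0 +i* t) =
     p1 (0 +i* t) - p2 (0 +i* t)) ->
  has_transform D nu (fun z => (p1 z - p2 z) / K z).
Proof.
move=> D0 hK h1 h2 K0 e.
have nu0 : has_transform [set 0] nu (fun z => Cintegral nu setT (fun u : RR => Cexp (z * (u : R)%:C))).
  move=> [x y] /= x0; split => //; apply: (@Cintegrable_le _ _ R nu setT _ (fun=> 1)) => //.
  - exact: measurable_Cexp_lin.
  - exact: finite_measure_integrable_cst.
  - by move=> u _; rewrite normc_Cexp cReM /= x0 mul0r mulr0 subr0 expR0.
have E A : measurable A -> finite_add (convolve nu kappa) rho2 A = rho1 A.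
  apply: charfun_unique1 => t.
  have [I1 V1] := @nu0 (0 +i* t) erefl; have [IK VK] := hK (0 +i* t) D0.
  have [I2 V2] := h2 (0 +i* t) D0; have [I3 V3] := h1 (0 +i* t) D0.
  have fD (x y : RR) : Cexp ((0 +i* t) * ((x : R) + (y : R))%:C) =
      Cexp ((0 +i* t) * (x : R)%:C) * Cexp ((0 +i* t) * (y : R)%:C) :> R[i].
    by rewrite rmorphD/= mulrDr CexpD.
  have [Ic Vc] := Cintegral_convolve fD I1 IK.
  by rewrite Cintegral_add// Vc VK V2 V3 e subrK.
move=> z Dz; set g : RR -> R[i] := fun u => Cexp (z * (u : R)%:C).
have mg : Cmeasurable setT g by exact: measurable_Cexp_lin.
have [IK VK] := hK z Dz; have [I2 V2] := h2 z Dz; have [I1 V1] := h1 z Dz.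
pose x := complex.Re z; pose f (u : RR) : R := expR (x * (u : R)).
have fg u : f u = normc (g u) by rewrite normc_Cexp cReM /= mulr0 subr0.
have mf : measurable_fun setT f.
  by rewrite (funext fg); exact: Cmeasurable_normc.
have f0 u : 0 <= f u by exact: expR_ge0.
have f1 rho : Cintegrable rho setT g -> (\int[rho]_u (f u)%:E < +oo)%E.
  move=> /(Cintegrable_normc measurableT)/integrableP[_]; congr (_ < _)%E.
  by apply: eq_integral => u _; rewrite fg /= ger0_norm ?normc_ge0.
have fD u v : f (u + v) = f u * f v by rewrite /f mulrDr expRD.
have Ez : (\int[nu]_u (f u)%:E * \int[kappa]_u (f u)%:E + \int[rho2]_u (f u)%:E = \int[rho1]_u (f u)%:E)%E.
  rewrite -ge0_integral_convolve// -ge0_integral_add//; last exact/measurable_EFinP.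
  by apply: eq_measure_integral => A mA _; exact: E.
have k0 : (0 < \int[kappa]_u (f u)%:E)%E.
  rewrite lt_neqAle integral_ge0 ?andbT; last by move=> u _; rewrite lee_fin.
  apply/eqP => k0; have := K0 x%:C Dz; have [_ <-] := hK x%:C Dz.
  have Exp (u : RR) : Cexp (x%:C * (u : R)%:C) = (f u)%:C :> R[i].
    by rewrite -Cexp_real rmorphM.
  by under eq_Cintegral do rewrite Exp; rewrite Cintegral_real /Rintegral -k0 eqxx.
have nf : (\int[nu]_u (f u)%:E < +oo)%E.
  rewrite ltey; apply/eqP => h; have := f1 _ I1.
  rewrite -Ez h gt0_mulye// addye// gt_eqF//.
  by rewrite (@lt_le_trans _ _ 0%E)// integral_ge0// => u _; rewrite lee_fin.
have In : Cintegrable nu setT g.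
  apply: (@Cintegrable_le _ _ R nu setT _ f) => //; last by move=> u _; rewrite fg.
  apply/integrableP; split; first exact/measurable_EFinP.
  by under eq_integral => u _ do rewrite /= ger0_norm//.
split => //.
have gD (u v : RR) : g (u + v) = g u * g v by rewrite /g rmorphD/= mulrDr CexpD.
have [Ic Vc] := Cintegral_convolve gD In IK.
have : Cintegral (finite_add (convolve nu kappa) rho2) setT g = Cintegral rho1 setT g.
  rewrite /Cintegral /Rintegral.
  by congr (fine _ +i* fine _); apply: eq_measure_integral => A mA _; exact: E.
rewrite Cintegral_add// Vc VK V2 V1 => <-.
by rewrite addrK mulfK// K0.
Qed.

End quotient_transform.

(** * The Mellin transform of the Fox function *)
Section Mellin_Barnes.
Context {R : realType}.
Notation leb := (@lebesgue_measure R).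

Lemma Mellin_BarnesE (c : R) (f : R[i] -> R[i]) :
  Cintegrable leb setT (fun t => f (c +i* t)) ->
  Mellin_Barnes c f = ((2 * pi)^-1)%:C * Cintegral leb setT (fun t => f (c +i* t)).
Proof.
move=> If; have i0 : 'i%C != 0 :> R[i].
  by rewrite -normc_gt0 /= expr0n expr1n add0r sqrtr1.
rewrite /Mellin_Barnes; under eq_Cintegral do rewrite mulrC.
by rewrite CintegralZ// mulrA invfM mulfVK// fmorphV.
Qed.

(** The integral of [h] along a vertical line, as a Fourier transform. *)
Definition line_ft (h : R -> R[i]) (u : R) : R[i] :=
  Cintegral leb setT (fun t => h t * Cexp (0 +i* (- (t * u)))).

Lemma line_ft_integrable h (u : R) : Cintegrable leb setT h ->
  Cintegrable leb setT (fun t => h t * Cexp (0 +i* (- (t * u)))).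
Proof.
move=> Ih; apply: (CintegrableM_bounded (M := 1)) => //.
  apply: Cmeasurable_Cexp_i; apply: measurableT_comp => //; exact: measurable_funM.
by move=> t _; rewrite normc_Cexp_i.
Qed.

Lemma continuous_line_ft h : Cintegrable leb setT h -> Ccontinuous (line_ft h).
Proof.
move=> Ih; have In := Cintegrable_normc measurableT Ih.
have cu (t c : R) : continuous (fun u : R => cos (c - t * u)).
  by move=> u; apply: d_continuous; deriv_rules.
have cs (t c : R) : continuous (fun u : R => sin (c - t * u)).
  by move=> u; apply: d_continuous; deriv_rules.
split; apply: (@continuous_Rintegral _ _ R leb setT measurableT _ (fun t => normc (h t))) => //.
- by move=> u; have [] := Cintegrable_measurable (line_ft_integrable u Ih).
- by move=> u t _; rewrite (le_trans (Re_le_normc _))// normcM normc_Cexp_i mulr1.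
- move=> t _ u; under eq_fun do rewrite cReM ReCexp ImCexp /= expR0 !mul1r -[- (t * _)]add0r.
  by apply: cvgB; (apply: cvgM; [exact: cvg_cst|]); [exact: cu|exact: cs].
- by move=> u; have [] := Cintegrable_measurable (line_ft_integrable u Ih).
- by move=> u t _; rewrite (le_trans (Im_le_normc _))// normcM normc_Cexp_i mulr1.
- move=> t _ u; under eq_fun do rewrite cImM ReCexp ImCexp /= expR0 !mul1r -[- (t * _)]add0r.
  by apply: cvgD; (apply: cvgM; [exact: cvg_cst|]); [exact: cs|exact: cu].
Qed.

Lemma Mellin_Barnes_exp (c u : R) (h : R[i] -> R[i]) : Cintegrable leb setT (fun t => h (c +i* t)) ->
  Mellin_Barnes c (fun s => h s * Cpow (expR u) (- s)) =
  ((2 * pi)^-1 * expR (- (c * u)))%:C * line_ft (fun t => h (c +i* t)) u.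
Proof.
move=> Ih; have E t : h (c +i* t) * Cpow (expR u) (- (c +i* t)) =
    (expR (- (c * u)))%:C * (h (c +i* t) * Cexp (0 +i* (- (t * u)))).
  rewrite [RHS]mulrCA Cpow_exp -Cexp_real -CexpD; congr (_ * _).
  by congr Cexp; apply: CeqP => /=; ring.
have I2 := line_ft_integrable u Ih.
rewrite Mellin_BarnesE; last first.
  apply: (@eq_Cintegrable _ _ R leb setT (fun t => (expR (- (c * u)))%:C * (h (c +i* t) * Cexp (0 +i* (- (t * u)))))) => //.
  exact: CintegrableZ.
by under eq_Cintegral do rewrite E; rewrite CintegralZ// mulrA rmorphM.
Qed.

(** Fourier inversion for [u |-> exp (c u - exp u)], whose transform is
    [Gamma (c + i t)]. *)
Lemma Cahen_Mellin (c v : R) : 0 < c ->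
  Cintegral leb setT (fun t => Gamma (c +i* t) * Cexp (- (c +i* t) * v%:C)) =
  (2 * pi * expR (- expR v))%:C.
Proof.
move=> c0.
pose g u : R[i] := (expR (c * u - expR u))%:C.
have Ig : Cintegrable leb setT g.
  by apply: Cintegrable_real; exact: log_gamma_integrable.
have GE t : Gamma (c +i* t) = Cintegral leb setT (fun u => g u * Cexp (0 +i* (u * t))).
  rewrite GammaE//; have [_ <-] := @Euler_exp R (c +i* t) c0.
  apply: eq_Cintegral => u _; rewrite /g addrC expRD rmorphM/= -mulrA; congr (_ * _).
  by rewrite -Cexp_real -CexpD; congr Cexp; apply: CeqP => /=; ring.
have c1 : 0 < 0 + 1 * c by rewrite mul1r add0r.
have [cG dG] := @Gamma_line R 0 1 c ltr01 c1.
have GE1 t : Gamma (0%:C + 1%:C * (c +i* t)) = Gamma (c +i* t) by rewrite add0r mul1r.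
have [IG _] : Cintegrable leb setT (fun t => Gamma (0%:C + 1%:C * (c +i* t))) /\
    exists M, forall t, normc (Gamma (0%:C + 1%:C * (c +i* t))) <= M.
  by apply: decays_integrable cG dG; left; rewrite mulr1 divr_gt0// pi_gt0.
have IG' : Cintegrable leb setT (fun t => Cintegral leb setT (fun u => g u * Cexp (0 +i* (u * t)))).
  by apply: eq_Cintegrable IG => // t _; rewrite GE1 GE.
have cg : continuous (fun u => expR (c * u - expR u)).
  by move=> u; apply: d_continuous; deriv_rules.
have gM u : normc (g u) <= expR (c * ln c - c).
  rewrite /g normc_real ger0_norm ?expR_ge0// ler_expR.
  have := expR_ge1Dx (u - ln c); rewrite expRB lnK ?posrE// ler_pdivlMr//; lra.
have cI : {for v, continuous (fun u => complex.Im (g u))} by exact: cvg_cst.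
have := @fourier_inversion R g _ v Ig gM (@cg v) cI IG'.
move=> /(congr1 (fun z => (expR (- (c * v)))%:C * z)); rewrite -CintegralZ//; last first.
  apply: (@eq_Cintegrable _ _ R leb setT (fun t => Cintegral leb setT (fun u => g u * Cexp (0 +i* (u * t))) * Cexp (0 +i* (- (t * v))))) => //.
    by move=> t _; rewrite [t * v]mulrC.
  exact: line_ft_integrable.
have -> : (expR (- (c * v)))%:C * ((2 * pi)%:C * g v) = (2 * pi * expR (- expR v))%:C.
  rewrite /g mulrCA -!rmorphM/= -expRD; congr (_ * expR _)%:C; ring.
move=> <-; apply: eq_Cintegral => t _; rewrite -GE [RHS]mulrCA -Cexp_real -CexpD; congr (_ * Cexp _).
by apply: CeqP => /=; ring.
Qed.

End Mellin_Barnes.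

Section fox.
Context {R : realType}.
Notation RR := (measurableTypeR R).
Notation leb := (@lebesgue_measure R).
Variables (p m : nat) (a alpha : 'I_p -> R) (b beta : 'I_m -> R) (c : R).
Hypothesis al0 : forall i, 0 < alpha i.
Hypothesis be0 : forall j, 0 < beta j.
Hypothesis bc0 : forall j, 0 < b j + beta j * c.
Hypothesis pars : 0 < a_star alpha beta \/ (a_star alpha beta = 0 /\ mu_par a b < -1).
Hypothesis fox_ge0 : forall tau, 0 < tau -> 0 <= FoxH a alpha b beta c tau.

Let h t := Gamma_quotient a alpha b beta (c +i* t).

Let h_facts : [/\ Ccontinuous h, Cintegrable leb setT h & exists M, forall t, normc (h t) <= M].
Proof.
have [ch dh] := Gamma_quotient_line a al0 be0 bc0.
suff [Ih [M hM]] : Cintegrable leb setT h /\ exists M, forall t, normc (h t) <= M.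
  by split => //; exists M.
apply: decays_integrable ch dh.
case: pars => [a0|[a0 m1]]; [left|right]; first by rewrite divr_gt0// mulr_gt0// pi_gt0.
by rewrite a0 !mulr0 mul0r; split => //; lra.
Qed.

Let Ih : Cintegrable leb setT h. Proof. by case: h_facts. Qed.

(** The Fox function on the logarithmic scale.  It is real by [foxE]. *)
Definition fox (u : R) : R := complex.Re (FoxH a alpha b beta c (expR u)).

Lemma foxE u : FoxH a alpha b beta c (expR u) = (fox u)%:C.
Proof.
have := fox_ge0 (expR_gt0 u); rewrite lecE => /andP[/eqP i0 _].
by apply: CeqP => //=; rewrite -i0.
Qed.

Lemma fox_nonneg u : 0 <= fox u.
Proof. by have := fox_ge0 (expR_gt0 u); rewrite foxE lecR. Qed.

Let F u := expR (c * u) * fox u.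

Let FE u : (2 * pi * F u)%:C = line_ft h u.
Proof.
rewrite /F !rmorphM/= -foxE /FoxH Mellin_Barnes_exp// -/h !mulrA -!rmorphM/=.
have -> : 2 * pi * expR (c * u) * ((2 * pi)^-1 * expR (- (c * u))) = 1 :> R.
  by rewrite mulrACA -expRD subrr expR0 mulr1 mulfV// gt_eqF// mulr_gt0// pi_gt0.
by rewrite mul1r.
Qed.

Let cF : continuous F.
Proof.
have [c1 _] := continuous_line_ft Ih.
have -> : F = fun u => (2 * pi)^-1 * complex.Re (line_ft h u).
  by apply/funext => u; rewrite -FE/= mulrA mulVf ?mul1r// gt_eqF// mulr_gt0// pi_gt0.
by move=> u; apply: cvgM; [exact: cvg_cst|exact: c1].
Qed.

Lemma continuous_fox : continuous fox.
Proof.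
have -> : fox = fun u => expR (- (c * u)) * F u.
  by apply/funext => u; rewrite /F mulrA -expRD addNr expR0 mul1r.
have ce : continuous (fun u : R => expR (- (c * u))).
  by move=> u; apply: d_continuous; deriv_rules.
by move=> u; apply: cvgM; [exact: ce|exact: cF].
Qed.

Let F_facts : leb.-integrable setT (EFin \o F) /\
  forall u, Cintegral leb setT (fun t => (F t)%:C * Cexp (0 +i* (u * t))) = h u.
Proof.
have [[c1 c2] _ [M hM]] := h_facts.
apply: (fourier_positive Ih hM) => //.
- by move=> t; rewrite mulr_ge0 ?expR_ge0 ?fox_nonneg.
- exact: continuous_measurable_fun.
Qed.

(** Without numerator, [a_star] would be negative, or [p = 0] and [mu = 0]. *)
Lemma numerator_gt0 : (0 < m)%N.
Proof.
rewrite lt0n; apply/negP => /eqP m0.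
have b0 (f : 'I_m -> R) : \sum_(j < m) f j = 0 by rewrite big1// => j _; exfalso; have := leq_ltn_trans (leq0n j) (ltn_ord j); rewrite m0.
case: pars => [|[]]; rewrite /a_star /mu_par !b0 sub0r.
  by rewrite ltNge oppr_le0 sumr_ge0// => i _; rewrite ltW.
move=> /eqP; rewrite oppr_eq0 psumr_eq0; last by move=> i _; rewrite ltW.
have [p0|p0] := posnP p.
  have a0 (f : 'I_p -> R) : \sum_(j < p) f j = 0 by rewrite big1// => j _; exfalso; have := leq_ltn_trans (leq0n j) (ltn_ord j); rewrite p0.
  have -> : (p%:R - m%:R) / 2 = 0 :> R by rewrite p0 m0 subrr mul0r.
  by rewrite a0 => _; lra.
by move=> /allP/(_ (Ordinal p0)); rewrite mem_index_enum gt_eqF// => /(_ isT).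
Qed.

(** The shifts [N] are large enough to replace each [1 / Gamma] by [inv_Gamma]. *)
Lemma Gamma_quotient_mul (N : 'I_p -> nat) (s : R[i]) :
  (forall i, 0 < a i + (N i)%:R + alpha i * complex.Re s) ->
  Gamma_quotient a alpha b beta s * \prod_(i < p) Gamma ((a i + (N i)%:R)%:C + (alpha i)%:C * s) =
  \prod_(i < p) \prod_(k < N i) ((a i)%:C + (alpha i)%:C * s + k%:R) *
  \prod_(j < m) Gamma ((b j)%:C + (beta j)%:C * s).
Proof.
move=> aN; rewrite /Gamma_quotient -prodfV -mulrA mulrC; congr (_ * _); rewrite -big_split/=.
apply: eq_bigr => i _.
have R1 : complex.Re ((a i)%:C + (alpha i)%:C * s) = a i + alpha i * complex.Re s.
  by rewrite cReD cReM /= mul0r subr0.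
have s0 : 0 < complex.Re ((a i)%:C + (alpha i)%:C * s) + (N i)%:R.
  by rewrite R1 addrAC.
rewrite (inv_Gamma s0).
have -> : (a i + (N i)%:R)%:C + (alpha i)%:C * s = (a i)%:C + (alpha i)%:C * s + (N i)%:R.
  by rewrite rmorphD/= rmorph_nat addrAC.
rewrite [Gamma _]GammaE ?ReDn// mulfVK//.
by apply: Euler_integral_neq0; rewrite ReDn.
Qed.

(** The measure [F du] is known on the line [Re s = c]; [transform_extend] carries the
    identity over to the line of [s].  Abscissas are measured from [c], so [D] has to
    contain 0 and [Re s - c]. *)
Theorem fox_mellin (s : R[i]) : (forall j, 0 < b j + beta j * complex.Re s) ->
  Cintegrable leb setT (fun u => (fox u)%:C * Cexp (s * u%:C)) /\
  Cintegral leb setT (fun u => (fox u)%:C * Cexp (s * u%:C)) = Gamma_quotient a alpha b beta s.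
Proof.
move=> bs.
have [IF VF] := F_facts.
have F0 u : 0 <= F u by rewrite mulr_ge0 ?expR_ge0 ?fox_nonneg.
pose nu := wpush_measure IF F0 (@measurable_id _ RR setT).
(* large enough for the abscissas [c] and [Re s] *)
pose N i := (Num.truncn (- a i + alpha i * (`|c| + `|complex.Re s|))).+1.
pose D : set R := [set r | (forall j, 0 < b j + beta j * (c + r)) /\
                           (forall i, 0 < a i + (N i)%:R + alpha i * (c + r))].
have hN i r : - r <= `|c| + `|complex.Re s| -> 0 < a i + (N i)%:R + alpha i * r.
  move=> rr; have h1 := truncnS_gt (- a i + alpha i * (`|c| + `|complex.Re s|)).
  have h2 : alpha i * - r <= alpha i * (`|c| + `|complex.Re s|) by rewrite ler_wpM2l// ltW.
  rewrite /N; lra.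
have D0 : D 0.
  split=> [j|i]; rewrite addr0//; apply: hN.
  by rewrite (le_trans (ler_norm _))// normrN lerDl.
have Ds : D (complex.Re s - c).
  split=> [j|i]; rewrite [c + _]addrC subrK//; apply: hN.
  by rewrite (le_trans (ler_norm _))// normrN lerDr.
have [kap hK] := @transform_prod R D D0 p (fun i => a i + (N i)%:R + alpha i * c) alpha xpredT
  (fun i r Dr => ltac:(rewrite -addrA -mulrDr; exact: (Dr.2 i))).
pose j0 := Ordinal numerator_gt0.
have [rho h0] := @transform_prod R D D0 m (fun j => b j + beta j * c) beta (fun j => j != j0)
  (fun j r Dr => ltac:(rewrite -addrA -mulrDr; exact: (Dr.1 j))).
pose L := [seq ((a i + alpha i * c + k%:R), alpha i) | i <- index_enum 'I_p, k <- iota 0 (N i)].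
have [r1 [r2 [p1 [p2 [h1 h2 e]]]]] := @signed_poly R D D0 L (b j0 + beta j0 * c) (beta j0) rho _ 0%N
  (be0 j0) (fun r Dr => ltac:(rewrite -addrA -mulrDr; exact: (Dr.1 j0))) h0.
have lin (x y : R) (z : R[i]) : (x + y * c)%:C + y%:C * z = x%:C + y%:C * (c%:C + z).
  by case: z => zr zi; apply: CeqP => /=; ring.
have key z : D (complex.Re z) -> p1 z - p2 z =
    Gamma_quotient a alpha b beta (c%:C + z) * \prod_(i < p) Gamma ((a i + (N i)%:R + alpha i * c)%:C + (alpha i)%:C * z).
  move=> Dz; rewrite -e//.
  rewrite [X in _ = _ * X](eq_bigr (fun i => Gamma ((a i + (N i)%:R)%:C + (alpha i)%:C * (c%:C + z)))); last first.
    by move=> i _; rewrite lin.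
  rewrite Gamma_quotient_mul; last by move=> i; rewrite cReD/=; exact: Dz.2.
  congr (_ * _).
    rewrite /L big_allpairs_dep; apply: eq_bigr => i _.
    rewrite -[iota _ _]/(index_iota 0 (N i)) -[N i]subn0 big_mkord; apply: eq_bigr => k _ /=.
    by rewrite addrAC lin rmorphD/= rmorph_nat addrAC.
  rewrite [RHS](bigD1 j0)//= mulr0n addr0 lin; congr (_ * _).
  by apply: eq_bigr => j _; rewrite lin.
have K0 z : D (complex.Re z) ->
    \prod_(i < p) Gamma ((a i + (N i)%:R + alpha i * c)%:C + (alpha i)%:C * z) != 0.
  move=> Dz; apply/prodf_neq0 => i _.
  have r0 : 0 < complex.Re ((a i + (N i)%:R + alpha i * c)%:C + (alpha i)%:C * z).
    by rewrite cReD cReM/= mul0r subr0 -addrA -mulrDr; exact: Dz.2.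
  by rewrite GammaE//; exact: Euler_integral_neq0.
have nuT t : Cintegral nu setT (fun u : RR => Cexp ((0 +i* t) * (u : R)%:C)) = h t.
  rewrite Cintegral_wpush; last exact: measurable_Cexp_lin.
  rewrite -VF; apply: eq_Cintegral => u _; congr (_ * Cexp _).
  by apply: CeqP => /=; ring.
have := @transform_extend R D nu kap r1 r2 _ p1 p2 D0 hK h1 h2 K0.
have e0 t : Cintegral nu setT (fun u : RR => Cexp ((0 +i* t) * (u : R)%:C)) *
    \prod_(i < p) Gamma ((a i + (N i)%:R + alpha i * c)%:C + (alpha i)%:C * (0 +i* t)) =
    p1 (0 +i* t) - p2 (0 +i* t).
  have hz : c%:C + (0 +i* t) = c +i* t by apply: CeqP => /=; rewrite ?addr0 ?add0r.
  by rewrite (nuT t) (key (0 +i* t) D0) hz.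
have sc : complex.Re (s - c%:C) = complex.Re s - c by rewrite cReD cReN.
move=> /(_ e0 (s - c%:C)); rewrite sc => /(_ Ds)[I1 V1].
have mg : Cmeasurable setT (fun u : RR => Cexp ((s - c%:C) * (u : R)%:C)) by exact: measurable_Cexp_lin.
have E u : (fox u)%:C * Cexp (s * u%:C) = (F u)%:C * Cexp ((s - c%:C) * u%:C).
  rewrite /F rmorphM/= mulrAC [RHS]mulrC -Cexp_real -CexpD; congr (_ * Cexp _).
  by case: (s) => sr si; apply: CeqP => /=; ring.
split.
  apply: (@eq_Cintegrable _ _ R leb setT (fun u => (F u)%:C * Cexp ((s - c%:C) * u%:C))) => //.
  exact: (Cintegrable_wpush IF F0 (@measurable_id _ RR setT) mg).1 I1.
under eq_Cintegral do rewrite E.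
transitivity (Cintegral nu setT (fun u : RR => Cexp ((s - c%:C) * (u : R)%:C))).
  by rewrite Cintegral_wpush.
rewrite V1 key ?sc// addrC subrK mulfK// K0// sc//.
Qed.

End fox.

(** * The Wright function and G_d as integrals of the Fox function *)
Section laplace_forms.
Context {R : realType}.
Notation RR := (measurableTypeR R).
Notation leb := (@lebesgue_measure R).
Variables (p m : nat) (a alpha : 'I_p -> R) (b beta : 'I_m -> R) (c : R).
Hypothesis al0 : forall i, 0 < alpha i.
Hypothesis be0 : forall j, 0 < beta j.
Hypothesis bc0 : forall j, 0 < b j + beta j * c.
Hypothesis pars : 0 < a_star alpha beta \/ (a_star alpha beta = 0 /\ mu_par a b < -1).
Hypothesis fox_ge0 : forall tau, 0 < tau -> 0 <= FoxH a alpha b beta c tau.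
Notation fox := (fox a alpha b beta c).
Notation GQ := (Gamma_quotient a alpha b beta).

Let foxM (s : R[i]) : (forall j, 0 < b j + beta j * complex.Re s) ->
  Cintegrable leb setT (fun u => (fox u)%:C * Cexp (s * u%:C)) /\
  Cintegral leb setT (fun u => (fox u)%:C * Cexp (s * u%:C)) = GQ s.
Proof. exact: fox_mellin. Qed.

Let fox0 u : 0 <= fox u. Proof. exact: fox_nonneg. Qed.

Let mfox : measurable_fun setT fox.
Proof. by apply: continuous_measurable_fun; exact: continuous_fox. Qed.

Let foxR (sig u : R) : (fox u)%:C * Cexp (sig%:C * u%:C) = (fox u * expR (sig * u))%:C :> R[i].
Proof. by rewrite [RHS]rmorphM/= -Cexp_real rmorphM. Qed.

Lemma fox_integrable (sig : R) : (forall j, 0 < b j + beta j * sig) ->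
  leb.-integrable setT (EFin \o (fun u => fox u * expR (sig * u))).
Proof.
move=> bs; have [[I1 _] _] := @foxM sig%:C bs.
by apply: eq_integrable I1 => // u _; rewrite foxR.
Qed.

Lemma fox_integral (sig : R) : (forall j, 0 < b j + beta j * sig) ->
  GQ sig%:C = (Rintegral leb setT (fun u => fox u * expR (sig * u)))%:C.
Proof.
move=> bs; have [_ <-] := @foxM sig%:C bs.
by under eq_Cintegral do rewrite foxR; rewrite Cintegral_real.
Qed.

(** Write [Q] as the Mellin transform of the Fox function and exchange: the inner
    integral is the Cahen-Mellin integral for [exp (- exp (v - eps u))].  The case
    [eps = 1] is that of [G_d], [eps = -1] that of the Wright function. *)
Lemma Mellin_Barnes_laplace (sig eps c' v : R) (Q : R[i] -> R[i]) :
  0 < c' -> (forall j, 0 < b j + beta j * sig) ->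
  (forall j, 0 < b j + beta j * (sig + eps * c')) -> (forall s, Q s = GQ (sig%:C + eps%:C * s)) ->
  Mellin_Barnes c' (fun s => Gamma s * Q s * Cpow (expR v) (- s)) =
  (Rintegral leb setT (fun u => fox u * expR (sig * u) * expR (- expR (v - eps * u))))%:C.
Proof.
move=> c0 bsig bs QE.
pose g1 t : R[i] := Gamma (c' +i* t).
pose g2 u : R[i] := (fox u * expR ((sig + eps * c') * u))%:C.
pose k (z : R * R) : R[i] := (expR (- (c' * v)))%:C * Cexp (0 +i* (z.1 * (eps * z.2 - v))).
have mk : Cmeasurable setT k.
  apply: CmeasurableM; first exact: Cmeasurable_cst.
  apply: Cmeasurable_Cexp_i; apply: measurable_funM => //.
  by apply: measurable_funB => //; exact: measurable_funM.
have kM z : normc (k z) <= expR (- (c' * v)).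
  by rewrite /k normcM normc_Cexp_i mulr1 normc_real ger0_norm ?expR_ge0.
have c1 : 0 < 0 + 1 * c' by rewrite mul1r add0r.
have [cG dG] := @Gamma_line R 0 1 c' ltr01 c1.
have GE1 t : Gamma (0%:C + 1%:C * (c' +i* t)) = g1 t by rewrite add0r mul1r.
have Ig1 : Cintegrable leb setT g1.
  have [I1 _] : Cintegrable leb setT (fun t => Gamma (0%:C + 1%:C * (c' +i* t))) /\
      exists M, forall t, normc (Gamma (0%:C + 1%:C * (c' +i* t))) <= M.
    by apply: decays_integrable cG dG; left; rewrite mulr1 divr_gt0// pi_gt0.
  by apply: eq_Cintegrable I1 => // t _; rewrite GE1.
have Ig2 : Cintegrable leb setT g2 by apply: Cintegrable_real; exact: fox_integrable.
have hk t : Q (c' +i* t) * Cpow (expR v) (- (c' +i* t)) = Cintegral leb setT (fun u => g2 u * k (t, u)).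
  have bs' j : 0 < b j + beta j * complex.Re (sig%:C + eps%:C * (c' +i* t)).
    by rewrite cReD cReM /= mul0r subr0.
  have [I1 V1] := foxM bs'; rewrite QE -V1 mulrC -CintegralZ//; apply: eq_Cintegral => u _.
  rewrite /g2 /k Cpow_exp mulrCA -CexpD rmorphM/= -mulrA; congr (_ * _).
  rewrite -Cexp_real -(Cexp_real (- (c' * v))) -!CexpD; congr Cexp.
  by apply: CeqP => /=; ring.
have Ik t : Cintegrable leb setT (fun u => g2 u * k (t, u)).
  apply: (CintegrableM_bounded (M := expR (- (c' * v)))) => //.
  apply: CmeasurableM; first exact: Cmeasurable_cst.
  apply: Cmeasurable_Cexp_i; apply: measurable_funM => //=.
  by apply: measurable_funB => //; exact: measurable_funM.
have If : Cintegrable leb setT (fun t => g1 t * Cintegral leb setT (fun u => g2 u * k (t, u))).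
  apply: (CintegrableM_bounded (M := 2 * Rintegral leb setT (fun u => expR (- (c' * v)) * normc (g2 u)))) => //.
    rewrite (_ : (fun t => _) = fun t => Q (c' +i* t) * Cpow (expR v) (- (c' +i* t))); last first.
      by apply/funext => t; rewrite hk.
    apply: CmeasurableM.
      rewrite (_ : (fun t => _) = fun t => GQ ((sig + eps * c') +i* (eps * t))); last first.
        apply/funext => t; rewrite QE; congr (Gamma_quotient _ _ _ _ _).
        by apply: CeqP => /=; ring.
      have [[q1 q2] _] := Gamma_quotient_line a al0 be0 bs.
      have me : measurable_fun setT (fun t : R => eps * t) by exact: measurable_funM.
      split.
        apply: (@measurableT_comp _ _ _ _ _ _ (fun t => complex.Re (GQ ((sig + eps * c') +i* t)))) => //.
        exact: continuous_measurable_fun.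
      apply: (@measurableT_comp _ _ _ _ _ _ (fun t => complex.Im (GQ ((sig + eps * c') +i* t)))) => //.
      exact: continuous_measurable_fun.
    under eq_fun do rewrite Cpow_exp; apply: Cmeasurable_Cexp.
    split => /=; under eq_fun do rewrite ?cReM ?cImM /=; last first.
      by apply: measurable_funD; apply: measurable_funM => //; exact: measurableT_comp.
    by apply: measurable_funB; apply: measurable_funM => //; exact: measurableT_comp.
  move=> t _; rewrite (le_trans (normc_Cintegral_le _ (Ik t)))//.
  rewrite ler_wpM2l//; have In := Cintegrable_normc measurableT Ig2.
  apply: le_Rintegral => //; first exact: (Cintegrable_normc measurableT (Ik t)).
    exact: (integrableZl measurableT (expR (- (c' * v))) In).
  by move=> u _; rewrite normcM mulrC ler_wpM2r// normc_ge0.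
rewrite Mellin_BarnesE; last by apply: eq_Cintegrable If => // t _; rewrite -hk mulrA.
under eq_Cintegral do rewrite -mulrA hk.
rewrite (Cfubini_bounded Ig1 Ig2 mk kM).
transitivity (((2 * pi)^-1)%:C * Cintegral leb setT (fun u =>
   (fox u * expR (sig * u))%:C * (2 * pi * expR (- expR (v - eps * u)))%:C)).
  congr (_ * _); apply: eq_Cintegral => u _; rewrite -(Cahen_Mellin _ c0).
  have -> : g2 u = (fox u * expR (sig * u))%:C * (expR (eps * c' * u))%:C.
    by rewrite /g2 [(sig + _) * u]mulrDl expRD mulrA [LHS]rmorphM.
  rewrite -[LHS]mulrA; congr (_ * _).
  rewrite -CintegralZ.
    apply: eq_Cintegral => t _; rewrite mulrCA; congr (_ * _); rewrite /k -!Cexp_real -!CexpD.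
    by congr Cexp; apply: CeqP => /=; ring.
    by [].
  apply: (CintegrableM_bounded (M := expR (- (c' * v)))) => //.
  apply: CmeasurableM; first exact: Cmeasurable_cst.
  by apply: Cmeasurable_Cexp_i => /=; apply: measurable_funM.
have p2 : 2 * pi != 0 :> R by rewrite gt_eqF// mulr_gt0// pi_gt0.
under eq_Cintegral do rewrite -rmorphM/=.
rewrite Cintegral_real -rmorphM/= -RintegralZl//.
  congr (_%:C); apply: eq_Rintegral => u _.
  by rewrite [LHS]mulrCA mulKf.
have I0 := integrableZl measurableT (2 * pi) (fox_integrable bsig).
apply: le_integrable I0 => //.
  apply/measurable_EFinP; apply: measurable_funM.
    by apply: measurable_funM => //; apply: measurableT_comp => //; exact: measurable_funM.
  apply: measurable_funM => //; apply: measurableT_comp => //; apply: measurableT_comp => //.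
  by apply: measurableT_comp => //; apply: measurable_funB => //; exact: measurable_funM.
move=> u _; rewrite /= lee_fin mulrCA !normrM ler_wpM2l// -[leRHS]mulr1 ler_wpM2l//.
by rewrite ger0_norm ?expR_ge0// expR_le1 oppr_le0 expR_ge0.
Qed.

Hypothesis al1 : forall i, 0 < a i + alpha i.
Hypothesis be1 : forall j, 0 < b j + beta j.

Let bone j : 0 < b j + beta j * 1. Proof. by rewrite mulr1. Qed.

(** The total mass of the Fox function, [exp u] being the Jacobian of [tau = exp u]. *)
Definition Wright_mass : R := Rintegral leb setT (fun u => fox u * expR u).

Lemma Wright_massE : Wright_const a alpha b beta = Wright_mass%:C.
Proof.
transitivity (GQ 1%:C).
  rewrite /Wright_const /Gamma_quotient; congr (_ / _); apply: eq_bigr => i _;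
  by congr Gamma; rewrite mulr1 rmorphD.
rewrite (fox_integral bone); congr (_%:C); apply: eq_Rintegral => u _; by rewrite mul1r.
Qed.

Lemma Wright_mass_gt0 : 0 < Wright_mass.
Proof.
have W0 : Wright_const a alpha b beta != 0.
  have G0 (x : R) : 0 < x -> Gamma (x%:C : R[i]) != 0.
    by move=> x0; rewrite GammaE//; exact: Euler_integral_neq0.
  rewrite /Wright_const mulf_neq0// ?invr_neq0//; apply/prodf_neq0 => i _; exact: G0.
rewrite lt_neqAle Rintegral_ge0 ?andbT; last first.
  by move=> u _; rewrite mulr_ge0 ?expR_ge0.
by apply: contra W0 => /eqP e; rewrite Wright_massE -e.
Qed.

Lemma WrightE (cPsi x : R) : 0 < cPsi -> (forall j, cPsi < (b j + beta j) / beta j) -> 0 <= x ->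
  Wright a alpha b beta cPsi (- x) =
  (Rintegral leb setT (fun u => fox u * expR u * expR (- (x * expR u))))%:C.
Proof.
move=> c0 cb; rewrite /Wright oppr_eq0; have [->|x0] := eqVneq x 0 => [_|].
  rewrite Wright_massE; congr (_%:C); apply: eq_Rintegral => u _.
  by rewrite mul0r oppr0 expR0 mulr1.
rewrite le_eqVlt eq_sym (negbTE x0)/= opprK => {}x0.
rewrite -{1}[x]lnK ?posrE//.
rewrite (@Mellin_Barnes_laplace 1 (-1) cPsi (ln x) _ c0 bone).
- congr (_%:C); apply: eq_Rintegral => u _; rewrite mul1r; congr (_ * expR (- _)).
  by rewrite mulN1r opprK expRD lnK.
- by move=> j; have := cb j; rewrite ltr_pdivlMr//; lra.
- move=> s; rewrite /Gamma_quotient; congr (_ / _); apply: eq_bigr => i _; congr Gamma;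
  by case: s => sr si; apply: CeqP => /=; ring.
Qed.

Variable d : nat.
Let sig : R := 1 - d%:R / 2.
Hypothesis bd : forall j, beta j * d%:R < 2 * (b j + beta j).

Let bsig j : 0 < b j + beta j * sig.
Proof. by have := bd j; rewrite /sig; lra. Qed.

(** The integral of [tau^(- d/2) exp (- z / tau) H tau]. *)
Definition mixG (z : R) : R :=
  Rintegral leb setT (fun u => fox u * expR (sig * u) * expR (- (z * expR (- u)))).

Lemma FoxG_posE (cG z : R) : 0 < cG -> 0 < z ->
  FoxG_pos a alpha b beta d cG z = (mixG z)%:C.
Proof.
move=> c0 z0; rewrite /FoxG_pos -/sig -{1}[z]lnK ?posrE//.
rewrite (@Mellin_Barnes_laplace sig 1 cG (ln z) _ c0 bsig).
- congr (_%:C); apply: eq_Rintegral => u _; congr (_ * expR (- _)).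
  by rewrite mul1r expRD lnK.
- by move=> j; rewrite mul1r mulrDr addrA addr_gt0 ?bsig ?mulr_gt0.
- move=> s; rewrite /Gamma_quotient; congr (_ / _); apply: eq_bigr => i _; congr Gamma;
  by case: s => sr si; apply: CeqP => /=; ring.
Qed.

(** The absolute value extends the function to a continuous one on the line; the
    integrands are dominated by the one for [z = 0]. *)
Lemma continuous_mixG : continuous (fun z : R => mixG `|z|).
Proof.
apply: (@continuous_Rintegral _ _ R leb setT measurableT _ (fun u => fox u * expR (sig * u))).
- move=> z; apply: measurable_funM.
    by apply: measurable_funM => //; apply: measurableT_comp => //; exact: measurable_funM.
  apply: measurableT_comp => //; apply: measurableT_comp => //; apply: measurable_funM => //.
  exact: measurableT_comp.
- exact: fox_integrable.
- move=> z u _; rewrite normrM ger0_norm ?mulr_ge0 ?expR_ge0//.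
  rewrite -[leRHS]mulr1 ler_wpM2l ?mulr_ge0 ?expR_ge0//.
  by rewrite ger0_norm ?expR_ge0// expR_le1 oppr_le0 mulr_ge0 ?expR_ge0.
- move=> u _ z; apply: cvgM; first exact: cvg_cst.
  apply: (@continuous_comp _ _ _ (fun z : R => - (`|z| * expR (- u))) (@expR R)); last exact: continuous_expR.
  by apply: cvgN; apply: cvgM; [exact: norm_continuous|exact: cvg_cst].
Qed.

Lemma FoxG_pos_cvg (cG : R) : 0 < cG ->
  (FoxG_pos a alpha b beta d cG z : R[i]^o) @[z --> 0^'+] --> ((mixG 0)%:C : R[i]^o).
Proof.
move=> c0. have cphi := continuous_mixG.
apply/cvgrPdist_lt => e e0.
have [er e1] : e = (complex.Re e)%:C /\ 0 < complex.Re e.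
  by case: e e0 => x y; rewrite ltcE /= => /andP[/eqP -> ->].
have := cphi 0; rewrite /continuous_at normr0 => /cvgrPdist_lt/(_ _ e1) h.
have h' : \forall z \near (0 : R)^'+, `|mixG 0 - mixG `|z| | < complex.Re e.
  exact: cvg_within h.
near=> z; have z0 : 0 < z by near: z; exact: nbhs_right_gt.
rewrite FoxG_posE// -rmorphB/= er normc_def /= expr0n/= addr0 sqrtr_sqr ltcR.
by rewrite -[z]gtr0_norm//; near: z.
Unshelve. all: by end_near. Qed.

Lemma FoxGE (cG z : R) : 0 < cG -> 0 <= z ->
  FoxG a alpha b beta d cG z = (mixG z)%:C.
Proof.
move=> c0; rewrite /FoxG; have [->|z0] := eqVneq z 0 => z1.
  by apply: (cvg_lim _ (FoxG_pos_cvg c0)); exact: norm_hausdorff.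
by rewrite FoxG_posE// lt_def z0.
Qed.

End laplace_forms.

(** * Products of Gaussian densities *)
Section gauss_tuple.
Context {R : realType}.
Notation RR := (measurableTypeR R).
Notation leb := (@lebesgue_measure R).

Lemma Cintegral_cons n (m : {sigma_finite_measure set (Rtuple R n) -> \bar R}) (f : Rtuple R n.+1 -> R[i]) :
  Cmeasurable setT f ->
  Cintegrable (leb \x m)%E setT (fun z : RR * Rtuple R n => f [tuple of z.1 :: z.2]) ->
  Cintegrable (lebesgue_cons m) setT f /\
  Cintegral (lebesgue_cons m) setT f =
  Cintegral (leb \x m)%E setT (fun z : RR * Rtuple R n => f [tuple of z.1 :: z.2]).
Proof.
have mc : measurable_fun setT (fun z : RR * Rtuple R n => [tuple of z.1 :: z.2] : Rtuple R n.+1).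
  exact: measurable_cons.
have key (g : Rtuple R n.+1 -> R) : measurable_fun setT g ->
    (leb \x m)%E.-integrable setT (EFin \o (fun z : RR * Rtuple R n => g [tuple of z.1 :: z.2])) ->
    (lebesgue_cons m).-integrable setT (EFin \o g) /\
    Rintegral (lebesgue_cons m) setT g =
    Rintegral (leb \x m)%E setT (fun z : RR * Rtuple R n => g [tuple of z.1 :: z.2]).
  move=> mg Ig; have mEg : measurable_fun setT (EFin \o g) by exact/measurable_EFinP.
  split; first exact: (integrable_pushforward mc mEg Ig measurableT).
  congr fine; exact: (integral_pushforward mc mEg Ig measurableT).
move=> [m1 m2] [I1 I2]; have [J1 V1] := key _ m1 I1; have [J2 V2] := key _ m2 I2.
by split; [split|rewrite /Cintegral V1 V2].
Qed.

Let w (v y t : R) : R[i] := (gauss v t)%:C * Cexp (0 +i* (y * t)).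

Let w_facts v y : 0 < v -> Cintegrable leb setT (w v y) /\
  Cintegral leb setT (w v y) = (expR (- (v * y ^+ 2 / 2)))%:C.
Proof.
move=> v0.
have E t : w v y t = (gauss v t * cos (y * t + 0)) +i* (gauss v t * cos (y * t + - (pi / 2))).
  apply: CeqP; rewrite ?cReM ?cImM ?ReCexp ?ImCexp /= expR0 !mul1r -?sin_shift.
    by rewrite !mul0r !subr0 addr0.
  by rewrite !mul0r !addr0.
split.
  apply: (@eq_Cintegrable _ _ R leb setT (fun t => (gauss v t * cos (y * t + 0)) +i* (gauss v t * cos (y * t + - (pi / 2))))) => //.
  by split; exact: gauss_cos_integrable.
under eq_Cintegral do rewrite E.
by apply: CeqP => /=; rewrite gauss_fourier// ?cos0 ?mulr1// cosN cos_pihalf mulr0.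
Qed.

Let mprodw v n (y : 'I_n -> R) :
  Cmeasurable setT (fun x : Rtuple R n => \prod_(i < n) w v (y i) (tnth x i)).
Proof.
elim: (index_enum _) => [|i s IH].
  by under eq_fun do rewrite big_nil; exact: Cmeasurable_cst.
under eq_fun do rewrite big_cons; apply: CmeasurableM => //.
have mi : measurable_fun setT (fun x : Rtuple R n => tnth x i : RR) by exact: measurable_tnth.
apply: CmeasurableM.
  by apply: Cmeasurable_real; apply: (measurableT_comp (measurable_gauss v)).
by apply: Cmeasurable_Cexp_i; exact: measurable_funM.
Qed.

(** Induction on the dimension: the transforms of the coordinates multiply. *)
Lemma gauss_tuple v n (y : 'I_n -> R) : 0 < v ->
  Cintegrable (lebesgue_tuple R n) setT (fun x => \prod_(i < n) w v (y i) (tnth x i)) /\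
  Cintegral (lebesgue_tuple R n) setT (fun x => \prod_(i < n) w v (y i) (tnth x i)) =
  (expR (- (v * (\sum_(i < n) y i ^+ 2) / 2)))%:C.
Proof.
move=> v0; elim: n y => [|n IH] y.
  have I1 (f : Rtuple R 0 -> R) : (\d_([tuple] : Rtuple R 0)).-integrable setT (EFin \o (fun=> 1)).
    exact: finite_measure_integrable_cst.
  under eq_Cintegral do rewrite big_ord0.
  rewrite big_ord0 mulr0 mul0r oppr0 expR0 /=; split.
    apply: (@eq_Cintegrable _ _ R _ setT (fun=> 1%:C)) => //.
      by move=> x _; rewrite big_ord0.
    apply: Cintegrable_real; exact: finite_measure_integrable_cst.
  rewrite (Cintegral_real _ _ (fun=> 1)); congr (_%:C).
  by rewrite /Rintegral integral_dirac// diracT mul1e.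
have [I0 V0] := w_facts (y ord0) v0.
have [I1 V1] := IH (fun i => y (lift ord0 i)).
have E (z : RR * Rtuple R n) : \prod_(i < n.+1) w v (y i) (tnth [tuple of z.1 :: z.2] i) =
    w v (y ord0) z.1 * \prod_(i < n) w v (y (lift ord0 i)) (tnth z.2 i).
  rewrite big_ord_recl; congr (_ * _); apply: eq_bigr => i _; by rewrite tnthS.
have Ip : Cintegrable (leb \x lebesgue_tuple R n)%E setT (fun z : RR * Rtuple R n =>
    w v (y ord0) z.1 * \prod_(i < n) w v (y (lift ord0 i)) (tnth z.2 i)).
  apply: (@eq_Cintegrable _ _ R _ setT (fun z : RR * Rtuple R n =>
    w v (y ord0) z.1 * (\prod_(i < n) w v (y (lift ord0 i)) (tnth z.2 i)) * 1)) => //.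
    by move=> z _; rewrite mulr1.
  apply: (@Cintegrable_prod _ _ _ _ R leb (lebesgue_tuple R n) (w v (y ord0))
    (fun x => \prod_(i < n) w v (y (lift ord0 i)) (tnth x i)) (fun=> 1) 1) => //.
  by move=> z; rewrite (normc_real 1) normr1.
have [J1 ->] := @Cintegral_cons n (lebesgue_tuple R n) _ (mprodw v y)
  (eq_Cintegrable measurableT (fun z _ => esym (E z)) Ip).
split; first exact: J1.
under eq_Cintegral do rewrite E.
rewrite -Cfubini12//; last first.
  by move=> t; exact: (@CintegrableZ _ _ R _ setT _ (w v (y ord0) t) measurableT I1).
under eq_Cintegral => t _ do rewrite /= CintegralZ// V1 mulrC.
rewrite CintegralZ// V0 -rmorphM/= -expRD big_ord_recl; congr (expR _)%:C.
by set S := \sum_(i < n) _; field.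
Qed.

Lemma prod_wE v n (y : 'I_n -> R) (x : Rtuple R n) :
  \prod_(i < n) w v (y i) (tnth x i) =
  (\prod_(i < n) gauss v (tnth x i))%:C * Cexp (0 +i* \sum_(i < n) y i * tnth x i).
Proof.
rewrite big_split/= rmorph_prod; congr (_ * _).
rewrite (big_morph (fun t : R => Cexp (0 +i* t)) (id1 := 1) (op1 := *%R))//.
  by move=> s t; rewrite -CexpD; congr Cexp; apply: CeqP; rewrite ?cReD ?cImD/= ?addr0.
exact: Cexp0.
Qed.

Lemma gauss_tuple_fourier v n (y : 'I_n -> R) : 0 < v ->
  let f (x : Rtuple R n) := (\prod_(i < n) gauss v (tnth x i))%:C *
    Cexp (0 +i* \sum_(i < n) y i * tnth x i) in
  Cintegrable (lebesgue_tuple R n) setT f /\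
  Cintegral (lebesgue_tuple R n) setT f = (expR (- (v * (\sum_(i < n) y i ^+ 2) / 2)))%:C.
Proof.
move=> v0 f; have [I1 V1] := gauss_tuple y v0.
have -> : f = fun x => \prod_(i < n) w v (y i) (tnth x i).
  by apply/funext => x; rewrite prod_wE.
by [].
Qed.

Lemma gauss_tuple_mass v n : 0 < v ->
  (lebesgue_tuple R n).-integrable setT (EFin \o (fun x => \prod_(i < n) gauss v (tnth x i))) /\
  (\int[lebesgue_tuple R n]_x (\prod_(i < n) gauss v (tnth x i))%:E = 1)%E.
Proof.
move=> v0; have [I1 V1] := gauss_tuple_fourier (fun _ : 'I_n => 0) v0.
have E (x : Rtuple R n) : (\prod_(i < n) gauss v (tnth x i))%:C *
    Cexp (0 +i* \sum_(i < n) 0 * tnth x i) = (\prod_(i < n) gauss v (tnth x i))%:C.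
  by rewrite [X in 0 +i* X]big1 ?Cexp0 ?mulr1// => i _; rewrite mul0r.
have I2 : (lebesgue_tuple R n).-integrable setT (EFin \o (fun x => \prod_(i < n) gauss v (tnth x i))).
  by have [+ _] := I1; apply: eq_integrable => // x _; rewrite E.
split => //; have V2 : Rintegral (lebesgue_tuple R n) setT (fun x => \prod_(i < n) gauss v (tnth x i)) = 1.
  move: V1; under eq_Cintegral do rewrite E.
  rewrite Cintegral_real big1 ?mulr0 ?mul0r ?oppr0 ?expR0; last by move=> i _; rewrite expr0n.
  by case.
have fin := integrable_fin_num measurableT I2.
by rewrite -(fineK fin); congr (_%:E).
Qed.

(** The Gaussian of variance [tau = exp u], with the powers of [tau] made explicit. *)
Lemma prod_gaussE n (u : R) (x : Rtuple R n) :
  \prod_(i < n) gauss (expR u) (tnth x i) =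
  ((2 * pi) `^ (n%:R / 2))^-1 * expR (- (n%:R / 2) * u) * expR (- (dot x x / 2 * expR (- u))).
Proof.
have p2 : 0 < 2 * pi :> R by rewrite mulr_gt0// pi_gt0.
have sq : Num.sqrt (2 * pi * expR u) = expR ((ln (2 * pi) + u) / 2).
  rewrite -[RHS]ger0_norm ?expR_ge0// -sqrtr_sqr -expRM_natl; congr Num.sqrt.
  by rewrite -{1}[2 * pi]lnK ?posrE// -expRD; congr expR; field.
rewrite /gauss sq big_split/= prodr_const card_ord -expRN -expRM_natl -expR_sum powR_exp// -expRN -!expRD.
congr expR; rewrite sumrN -mulr_suml /dot expRN.
rewrite (eq_bigr (fun i => (tnth x i : R) * tnth x i)); last by move=> i _; rewrite expr2.
set S := \sum_(i < n) _; field.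
by rewrite expR_eq0.
Qed.

End gauss_tuple.

(** * The Gaussian mixture and its characteristic function *)
Section mixture.
Context {R : realType}.
Notation RR := (measurableTypeR R).
Notation leb := (@lebesgue_measure R).
Variables (p m d : nat) (a alpha : 'I_p -> R) (b beta : 'I_m -> R) (c : R).
Hypothesis al0 : forall i, 0 < alpha i.
Hypothesis be0 : forall j, 0 < beta j.
Hypothesis bc0 : forall j, 0 < b j + beta j * c.
Hypothesis pars : 0 < a_star alpha beta \/ (a_star alpha beta = 0 /\ mu_par a b < -1).
Hypothesis fox_ge0 : forall tau, 0 < tau -> 0 <= FoxH a alpha b beta c tau.
Hypothesis al1 : forall i, 0 < a i + alpha i.
Hypothesis be1 : forall j, 0 < b j + beta j.
Hypothesis bd : forall j, beta j * d%:R < 2 * (b j + beta j).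
Notation fox := (fox a alpha b beta c).
Notation mixG := (mixG a alpha b beta c d).
Notation Wm := (Wright_mass a alpha b beta c).
Notation lam := (lebesgue_tuple R d).

Let cd : R := (2 * pi) `^ (d%:R / 2).
Let cd0 : 0 < cd. Proof. by rewrite powR_gt0// mulr_gt0// pi_gt0. Qed.

Let bsig j : 0 < b j + beta j * (1 - d%:R / 2).
Proof. by have := bd j; lra. Qed.
Let bone j : 0 < b j + beta j * 1. Proof. by rewrite mulr1. Qed.

Let fox0 u : 0 <= fox u. Proof. exact: fox_nonneg. Qed.
Let cfox : continuous fox. Proof. exact: continuous_fox. Qed.
Let mfox : measurable_fun setT fox. Proof. exact: continuous_measurable_fun. Qed.
Let Wm0 : 0 < Wm. Proof. exact: Wright_mass_gt0. Qed.

Let Ifox : leb.-integrable setT (EFin \o (fun u => fox u * expR u)).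
Proof.
have := fox_integrable al0 be0 bc0 pars fox_ge0 bone; apply: eq_integrable => // u _.
by rewrite /= mul1r.
Qed.

(** The joint density of [x] and [u], unnormalized. *)
Let ker (z : Rtuple R d * RR) : R := fox z.2 * expR z.2 * \prod_(i < d) gauss (expR z.2) (tnth z.1 i).

Let ker_ge0 z : 0 <= ker z.
Proof. by rewrite /ker !mulr_ge0 ?expR_ge0 ?fox0// prodr_ge0// => i _; exact: gauss_ge0. Qed.

Let kerE (x : Rtuple R d) u : ker (x, u) =
  cd^-1 * (fox u * expR ((1 - d%:R / 2) * u) * expR (- (dot x x / 2 * expR (- u)))).
Proof.
rewrite /ker /= prod_gaussE -/cd.
have -> : expR ((1 - d%:R / 2) * u) = expR u * expR (- (d%:R / 2) * u).
  by rewrite -expRD; congr expR; ring.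
by ring.
Qed.

Let mdot : measurable_fun setT (fun x : Rtuple R d => dot x x : R).
Proof.
apply: measurable_sum => i; have mi : measurable_fun setT (fun x : Rtuple R d => tnth x i : RR).
  exact: measurable_tnth.
exact: measurable_funM.
Qed.

Let mker : measurable_fun setT ker.
Proof.
rewrite (_ : ker = fun z : Rtuple R d * RR => cd^-1 * (fox z.2 * expR ((1 - d%:R / 2) * z.2) *
    expR (- (dot z.1 z.1 / 2 * expR (- z.2))))); last by apply/funext => -[x u]; rewrite kerE.
apply: measurable_funM => //; apply: measurable_funM.
  apply: measurable_funM; first exact: (measurableT_comp mfox).
  by apply: measurableT_comp => //; exact: measurable_funM.
apply: measurableT_comp => //; apply: measurableT_comp => //; apply: measurable_funM.
  by apply: measurable_funM => //; exact: (measurableT_comp mdot).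
by apply: measurableT_comp => //; exact: measurableT_comp.
Qed.

Let Iker_x u : lam.-integrable setT (EFin \o (fun x => ker (x, u))).
Proof.
have [I1 _] := @gauss_tuple_mass R (expR u) d (expR_gt0 u).
exact: (integrableZl measurableT (fox u * expR u) I1).
Qed.

(** Here the hypothesis on [d] is needed: at [x = 0] only [tau^(- d/2)] remains. *)
Let Iker_u x : leb.-integrable setT (EFin \o (fun u => ker (x, u))).
Proof.
have I1 := integrableZl measurableT cd^-1 (fox_integrable al0 be0 bc0 pars fox_ge0 bsig).
apply: le_integrable I1 => //.
  by apply/measurable_EFinP; apply: (measurableT_comp mker); exact: measurable_fun_pair.
move=> u _; rewrite lee_fin kerE !normrM !ler_wpM2l//.
rewrite -[leRHS]mulr1 ler_wpM2l// ger0_norm ?expR_ge0// expR_le1 oppr_le0.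
by rewrite mulr_ge0 ?expR_ge0// divr_ge0// sumr_ge0// => i _; rewrite -expr2 sqr_ge0.
Qed.

(** Integrated over [x] first, each Gaussian has mass 1. *)
Let Iker : (lam \x leb)%E.-integrable setT (EFin \o ker).
Proof.
apply/integrable21ltyP; first exact/measurable_EFinP.
rewrite (_ : (\int[leb]_u \int[lam]_x `|(EFin \o ker) (x, u)|)%E = (\int[leb]_u (fox u * expR u)%:E)%E).
  by have /integrableP[_] := Ifox; under eq_integral => u _ do rewrite /= ger0_norm ?mulr_ge0 ?expR_ge0 ?fox0//.
apply: eq_integral => u _.
under eq_integral => x _ do rewrite /= ger0_norm ?ker_ge0// /ker /= EFinM.
have [I1 V1] := @gauss_tuple_mass R (expR u) d (expR_gt0 u).
by rewrite integralZl// V1 mule1.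
Qed.

Definition mix_density (x : Rtuple R d) : R := (cd * Wm)^-1 * mixG (dot x x / 2).

Let dot_ge0 (x : Rtuple R d) : 0 <= dot x x / 2.
Proof. by rewrite divr_ge0// sumr_ge0// => i _; rewrite -expr2 sqr_ge0. Qed.

Lemma mix_density_ge0 x : 0 <= mix_density x.
Proof.
apply: mulr_ge0; first by rewrite invr_ge0 mulr_ge0 ?(ltW cd0) ?(ltW Wm0).
by apply: Rintegral_ge0 => u _; rewrite !mulr_ge0 ?expR_ge0 ?fox0.
Qed.

Lemma measurable_mix_density : measurable_fun setT mix_density.
Proof.
apply: measurable_funM => //.
rewrite (_ : (fun x => _) = fun x : Rtuple R d => mixG `|dot x x / 2|); last first.
  by apply/funext => x; rewrite ger0_norm.
have mG : measurable_fun setT (fun z : R => mixG `|z|).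
  by apply: continuous_measurable_fun; exact: continuous_mixG.
by apply: (measurableT_comp mG); exact: measurable_funM.
Qed.

Let densE x : mix_density x = Wm^-1 * Rintegral leb setT (fun u => ker (x, u)).
Proof.
under eq_Rintegral do rewrite kerE.
rewrite RintegralZl//; first by rewrite /mix_density invfM mulrA [Wm^-1 * _]mulrC.
have := integrableZl measurableT cd (Iker_u x); apply: eq_integrable => // u _.
by rewrite /= -EFinM kerE mulVKf// gt_eqF.
Qed.

Lemma integrable_mix_density : lam.-integrable setT (EFin \o mix_density).
Proof.
have := integrableZl measurableT Wm^-1 (integrable_fubini_F Iker); apply: eq_integrable => // x _.
rewrite /= densE EFinM; congr (_ * _)%E.
by rewrite /Rintegral fineK//; exact: (integrable_fin_num measurableT (Iker_u x)).
Qed.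

Lemma mix_density_fourier (y : 'I_d -> R) :
  Cintegral lam setT (fun x => (mix_density x)%:C * Cexp (0 +i* \sum_(i < d) y i * tnth x i)) =
  (Wm^-1 * Rintegral leb setT (fun u => fox u * expR u * expR (- ((\sum_(i < d) y i ^+ 2) / 2 * expR u))))%:C.
Proof.
pose e (x : Rtuple R d) : R[i] := Cexp (0 +i* \sum_(i < d) y i * tnth x i).
have me : Cmeasurable setT e.
  apply: Cmeasurable_Cexp_i; apply: measurable_sum => i.
  have mi : measurable_fun setT (fun x : Rtuple R d => tnth x i : RR) by exact: measurable_tnth.
  exact: measurable_funM.
have e1 x : normc (e x) <= 1 by rewrite normc_Cexp_i.
have Ie d' (T : measurableType d') (nu : {measure set T -> \bar R}) (f : T -> R) (g : T -> Rtuple R d) :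
    nu.-integrable setT (EFin \o f) -> measurable_fun setT g ->
    Cintegrable nu setT (fun z => (f z)%:C * e (g z)).
  move=> If mg; apply: (CintegrableM_bounded (M := 1)) => //; first exact: Cintegrable_real.
  by case: me => m1 m2; split; [exact: (measurableT_comp m1)|exact: (measurableT_comp m2)].
have I12 := Ie _ _ (lam \x leb)%E ker fst Iker (@measurable_fst _ _ _ _).
have Ix u := Ie _ _ lam (fun x => ker (x, u)) id (Iker_x u) (@measurable_id _ _ _).
have Iu x := Ie _ _ leb (fun u => ker (x, u)) (fun=> x) (Iker_u x) (@measurable_cst _ _ _ _ _ _).
have := Cfubini I12 Iu Ix => F.
transitivity ((Wm^-1)%:C * Cintegral lam setT (fun x => Cintegral leb setT (fun u => (ker (x, u))%:C * e x))).
  rewrite -CintegralZ//.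
    apply: eq_Cintegral => x _; rewrite densE rmorphM/= -mulrA; congr (_ * _).
    under [RHS]eq_Cintegral do rewrite mulrC.
    rewrite CintegralZ//; last exact/Cintegrable_real/Iker_u.
    by rewrite Cintegral_real mulrC.
  have := CintegrableZ Wm%:C measurableT (Ie _ _ lam mix_density id integrable_mix_density (@measurable_id _ _ _)).
  apply: eq_Cintegrable => // x _.
  under [RHS]eq_Cintegral do rewrite mulrC.
  rewrite CintegralZ//; last exact/Cintegrable_real/Iker_u.
  rewrite Cintegral_real densE [LHS]mulrA -[in LHS]rmorphM/= mulVKf ?gt_eqF//.
  exact: mulrC.
rewrite F [RHS]rmorphM/=; congr (_ * _); rewrite -Cintegral_real; apply: eq_Cintegral => u _.
have [I1 V1] := @gauss_tuple_fourier R (expR u) d y (expR_gt0 u).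
transitivity ((fox u * expR u)%:C * (expR (- (expR u * (\sum_(i < d) y i ^+ 2) / 2)))%:C).
  by rewrite -V1 -CintegralZ//; apply: eq_Cintegral => x _; rewrite /ker /= [in LHS]rmorphM/= -mulrA.
by rewrite -rmorphM/=; congr (_ * expR (- _))%:C; rewrite [RHS]mulrC mulrA.
Qed.

Theorem mix_density_charfun (cPsi : R) (P : {finite_measure set (Rtuple R d) -> \bar R}) :
  0 < cPsi -> (forall j, cPsi < (b j + beta j) / beta j) ->
  (forall y : Rtuple R d, charfun P y =
     (Wright_const a alpha b beta)^-1 * Wright a alpha b beta cPsi (- (dot y y / 2))) ->
  is_density P mix_density.
Proof.
move=> c0 cb hP.
pose Q := wpush_measure integrable_mix_density mix_density_ge0 (@measurable_id _ (Rtuple R d) setT).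
split; [exact: measurable_mix_density|exact: mix_density_ge0|].
move=> A mA; transitivity (Q A); last by [].
apply: (@charfun_unique R _ (Rtuple R d) d (fun i x => tnth x i)) mA.
- by move=> i; exact: measurable_tnth.
- by move=> d' T' f hf; apply/measurable_fun_tnthP.
move=> y; pose Y : Rtuple R d := [tuple y i | i < d].
have Ye i : tnth Y i = y i by rewrite tnth_mktuple.
have dY (x : Rtuple R d) : dot Y x = \sum_(i < d) y i * tnth x i.
  by apply: eq_bigr => i _; rewrite Ye.
transitivity (charfun P Y); first by apply: eq_Cintegral => x _; rewrite dY.
have mE : Cmeasurable setT (fun x : Rtuple R d => Cexp (0 +i* \sum_(i < d) y i * (tnth x i : R))).
  apply: Cmeasurable_Cexp_i; apply: measurable_sum => i.
  have mi : measurable_fun setT (fun x : Rtuple R d => tnth x i : RR) by exact: measurable_tnth.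
  exact: measurable_funM.
rewrite [RHS]Cintegral_wpush// mix_density_fourier hP.
rewrite (WrightE al0 be0 bc0 pars fox_ge0 be1 c0 cb (dot_ge0 Y)).
rewrite (Wright_massE al0 be0 bc0 pars fox_ge0 be1) -fmorphV -rmorphM/=.
have -> // : dot Y Y = \sum_(i < d) y i ^+ 2.
by apply: eq_bigr => i _; rewrite Ye expr2.
Qed.

(** Back from [u] to [tau = exp u]. *)
Lemma mixture_tau (z : R) : 0 <= z ->
  let f tau := ((tau `^ (d%:R / 2))^-1 * expR (- (z / tau)))%:C * FoxH a alpha b beta c tau in
  Cintegrable leb `]0, +oo[ f /\ Cintegral leb `]0, +oo[ f = (mixG z)%:C.
Proof.
move=> zz f.
pose k (u : R) := fox u * expR (- (d%:R / 2) * u) * expR (- (z * expR (- u))).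
pose g t := k (ln t).
have fE t : 0 < t -> f t = (g t)%:C.
  move=> t0; have FE : FoxH a alpha b beta c t = (fox (ln t))%:C.
    by have := foxE fox_ge0 (ln t); rewrite lnK.
  rewrite /f /g /k FE.
  have -> : expR (- ln t) = t^-1 by rewrite expRN lnK.
  rewrite -rmorphM/= powR_exp// -expRN mulNr; congr (_%:C).
  by rewrite -[RHS]mulrA mulrC.
have ck : continuous k.
  have c1 : continuous (fun u : R => expR (- (d%:R / 2) * u)).
    by move=> u; apply: d_continuous; deriv_rules.
  have c2 : continuous (fun u : R => expR (- (z * expR (- u)))).
    by move=> u; apply: d_continuous; deriv_rules.
  by move=> u; apply: cvgM; [apply: cvgM; [exact: cfox|exact: c1]|exact: c2].
have cg t : 0 < t -> {for t, continuous g}.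
  move=> t0; apply: (@continuous_comp _ _ _ (@ln R) k); [exact: continuous_ln|exact: ck].
have g0 t : 0 < t -> 0 <= g t by move=> _; rewrite !mulr_ge0 ?expR_ge0 ?fox0.
have hE u : g (expR u) * expR u = fox u * expR ((1 - d%:R / 2) * u) * expR (- (z * expR (- u))).
  rewrite /g expRK /k.
  have -> : expR ((1 - d%:R / 2) * u) = expR (- (d%:R / 2) * u) * expR u.
    by rewrite -expRD; congr expR; ring.
  ring.
have Ih : leb.-integrable setT (EFin \o (fun u => g (expR u) * expR u)).
  have I1 := fox_integrable al0 be0 bc0 pars fox_ge0 bsig.
  apply: le_integrable I1 => //.
    apply/measurable_EFinP; apply: measurable_funM => //.
    rewrite (_ : (fun u => g (expR u)) = k); first exact: continuous_measurable_fun.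
    by apply/funext => u; rewrite /g expRK.
  move=> u _; rewrite lee_fin hE normrM -[leRHS]mulr1 ler_wpM2l//.
  by rewrite ger0_norm ?expR_ge0// expR_le1 oppr_le0 mulr_ge0 ?expR_ge0.
have Ig := integrable_ln cg g0 Ih.
have pos t : `]0, +oo[%classic t -> 0 < t by rewrite /= in_itv/= andbT.
split.
  apply: (@eq_Cintegrable _ _ R leb _ (fun t => (g t)%:C)); last exact: Cintegrable_real.
    exact: measurable_itv.
  by move=> t /pos t0; rewrite fE.
rewrite (@eq_Cintegral _ _ R leb _ _ (fun t => (g t)%:C)); last by move=> t /pos t0; rewrite fE.
rewrite Cintegral_real (Rintegral_exp cg Ig Ih); congr (_%:C).
by apply: eq_Rintegral => u _; rewrite hE.
Qed.

End mixture.

Theorem corollary2p16 (R : realType) (p m d : nat)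
    (a alpha : 'I_p -> R) (b beta : 'I_m -> R) (cH cG cPsi : R)
    (P : probability (Rtuple R d) R) :
  (0 < d)%N ->
  (forall i, 0 < alpha i /\ 0 < a i + alpha i) ->
  (forall j, 0 < beta j /\ 0 < b j + beta j) ->
  let a_star := \sum_(j < m) beta j - \sum_(i < p) alpha i in
  let mu := \sum_(j < m) b j - \sum_(i < p) a i + (p%:R - m%:R) / 2 in
  let K := Wright_const a alpha b beta in
  0 < a_star \/ (a_star = 0 /\ mu < -1) ->
  (* admissible abscissas of the contours defining H, G_d and Psi *)
  0 < cH < 1 -> (forall j, 0 < b j + beta j * cH) ->
  0 < cG < 1 ->
  0 < cPsi < 1 -> (forall j, cPsi < (b j + beta j) / beta j) ->
  (forall tau : R, 0 < tau -> 0 <= FoxH a alpha b beta cH tau) ->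
  (* P is the generalized Wright measure *)
  (forall y : Rtuple R d,
     charfun P y = K^-1 * Wright a alpha b beta cPsi (- (dot y y / 2))) ->
  (forall j, beta j * d%:R < 2 * (b j + beta j)) ->
  cvg ((FoxG_pos a alpha b beta d cG z : R[i]^o) @[z --> 0^'+]) /\
  exists2 rho : Rtuple R d -> R, is_density P rho &
    forall x : Rtuple R d,
      let norm := (((2 * pi) `^ (d%:R / 2))%:C * K)^-1 in
      let mixture (tau : R) : R[i] :=
        ((tau `^ (d%:R / 2))^-1 * expR (- (dot x x / (2 * tau))))%:C *
        FoxH a alpha b beta cH tau in
      [/\ Cintegrable lebesgue_measure `]0, +oo[ mixture,
          (rho x)%:C = norm * FoxG a alpha b beta d cG (dot x x / 2) &
          norm * FoxG a alpha b beta d cG (dot x x / 2) =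
          norm * Cintegral lebesgue_measure `]0, +oo[ mixture].
Proof.
move=> d0 ha hb as_ mu K pars /andP[cH0 _] bH /andP[cG0 _] /andP[cP0 _] bP fox_ge0 hP bd.
have al0 i : 0 < alpha i by have [] := ha i.
have al1 i : 0 < a i + alpha i by have [] := ha i.
have be0 j : 0 < beta j by have [] := hb j.
have be1 j : 0 < b j + beta j by have [] := hb j.
split; first by apply/cvg_ex; eexists; exact: (FoxG_pos_cvg al0 be0 bH pars fox_ge0 bd cG0).
exists (mix_density a alpha b beta cH).
  exact: (mix_density_charfun al0 be0 bH pars fox_ge0 al1 be1 bd cP0 bP hP).
move=> x norm mixture.
have dot0 : 0 <= dot x x / 2 by rewrite divr_ge0// sumr_ge0// => i _; rewrite -expr2 sqr_ge0.
have [I1 V1] := mixture_tau al0 be0 bH pars fox_ge0 bd dot0.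
have mixE : mixture = fun tau => ((tau `^ (d%:R / 2))^-1 * expR (- (dot x x / 2 / tau)))%:C *
    FoxH a alpha b beta cH tau.
  by apply/funext => tau; rewrite /mixture [X in (_ * expR (- X))%:C * _](_ : _ = dot x x / 2 / tau)// invfM mulrA.
have GE := FoxGE al0 be0 bH pars fox_ge0 bd cG0 dot0.
split; first by rewrite mixE.
  by rewrite GE /norm /K (Wright_massE al0 be0 bH pars fox_ge0 be1) -rmorphM/= -fmorphV -rmorphM.
by rewrite mixE V1 GE.
Qed.
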